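(* Let $\alpha\ge 0$, let $f\in\mathcal{W}(\alpha)$, and let $F=f^{-1}$ be the inverse function of $f$. Then the first three logarithmic inverse coefficients $\Gamma_1,\Gamma_2,\Gamma_3$ of $f$ satisfy the sharp estimates $$|\Gamma_1|\le\frac{1}{2(1+\alpha)},\quad \alpha\ge 0,$$ $$|\Gamma_2|\le\begin{cases}\dfrac{5+10\alpha-4\alpha^2}{12(1+2\alpha)(1+\alpha)^2}, & 0\le\alpha<1/2,\\[2mm] \dfrac{1}{3(1+2\alpha)}, & \alpha\ge 1/2,\end{cases}$$ $$|\Gamma_3|\le\begin{cases}\dfrac{1}{4(1+3\alpha)}-\dfrac{4}{3(1+\alpha)(1+2\alpha)}+\dfrac{5}{3(1+\alpha)^3}, & 0\le\alpha\le 0.8090,\\[2mm] \dfrac{1}{4(1+3\alpha)}, & \alpha>0.8090.\end{cases}$$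
   Context: Let $\mathbb{D}=\{z\in\mathbb{C}:|z|<1\}$ and let $\mathcal{A}$ be the class of holomorphic functions $f$ on $\mathbb{D}$ with $f(0)=0$ and $f'(0)=1$, written $f(z)=z+\sum_{n\ge 2}a_nz^n$. For $\alpha\ge 0$, $\mathcal{W}(\alpha)$ is the class of all $f\in\mathcal{A}$ with $\mathrm{Re}\,\{f'(z)+\alpha z f''(z)\}>0$ for all $z\in\mathbb{D}$. It is known that every $f\in\mathcal{W}(\alpha)$ is univalent in $\mathbb{D}$, so its inverse $F=f^{-1}$ is defined on $|w|<1/4$, with $F(w)=w+\sum_{n\ge2}A_nw^n$. The logarithmic inverse coefficients $\Gamma_n$ of $f$ are defined by $\log\frac{f^{-1}(w)}{w}=2\sum_{n=1}^\infty\Gamma_nw^n$, $|w|<1/4$ (branch of the logarithm vanishing at $w=0$); in particular $\Gamma_1=-\frac12a_2$, $\Gamma_2=-\frac12\left(a_3-\frac32a_2^2\right)$, $\Gamma_3=-\frac12\left(a_4-4a_2a_3+\frac{10}{3}a_2^3\right)$. Sharp means that equality is attained by some $f\in\mathcal{W}(\alpha)$ (possibly a different $f$ for each estimate).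
   Formalization: The threshold 0.8090 in the estimate of |Γ_3| is replaced by the exact value (1+√5)/4 = 0.809016…, of which it is a rounding; for α strictly between the two, the stated bound 1/(4(1+3α)) is false. *)

(* Defs.v *)
From Stdlib Require Import Reals.
From Coquelicot Require Import Coquelicot.
Local Open Scope R_scope.

Definition holomorphic_on_disc (r : R) (f : C -> C) : Prop :=
  forall z : C, Cmod z < r -> ex_derive f z.

(* Functions on a disc are total functions [C -> C] whose values outside the
   disc are irrelevant. *)
Definition class_A (f : C -> C) : Prop :=
  holomorphic_on_disc 1 f /\ f (RtoC 0) = RtoC 0 /\ C_derive f (RtoC 0) = RtoC 1.

Definition class_W (alpha : R) (f : C -> C) : Prop :=
  class_A f /\
  forall z : C, Cmod z < 1 ->
    0 < Re (C_derive f z + RtoC alpha * z * C_derive (C_derive f) z)%C.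

(* [F] is the inverse of the restriction of [f] to the unit disc, on the disc
   [|w| < r]. *)
Definition inverse_on_disc (r : R) (f F : C -> C) : Prop :=
  (forall w : C, Cmod w < r -> Cmod (F w) < 1 /\ f (F w) = w) /\
  (forall z : C, Cmod z < 1 -> Cmod (f z) < r -> F (f z) = z).

Definition Cexp (z : C) : C :=
  (exp (Re z) * cos (Im z), exp (Re z) * sin (Im z)).

(* [L] is the branch on [|w| < r] of [log (F w / w)] with [L 0 = 0]; the
   quotient has a removable singularity at 0, hence the condition [w <> 0]. *)
Definition log_branch_on_disc (r : R) (F L : C -> C) : Prop :=
  L (RtoC 0) = RtoC 0 /\
  forall w : C, Cmod w < r ->
    continuous L w /\ (w <> RtoC 0 -> Cexp (L w) = (F w / w)%C).

(* [log (F w / w) = 2 * sum_(n >= 1) Gamma_n w^n] on [|w| < 1/4], where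
   [F = f^-1]; the value [Gamma 0] is irrelevant. *)
Definition log_inverse_coefficients (F : C -> C) (Gamma : nat -> C) : Prop :=
  exists L : C -> C,
    log_branch_on_disc (1 / 4) F L /\
    forall w : C, Cmod w < 1 / 4 ->
      exists S : C,
        is_series (fun k : nat => (Gamma (k + 1)%nat * w ^ (k + 1))%C) S /\
        L w = (RtoC 2 * S)%C.

Definition bound1 (alpha : R) : R := 1 / (2 * (1 + alpha)).

Definition bound2 (alpha : R) : R :=
  if Rlt_dec alpha (1 / 2)
  then (5 + 10 * alpha - 4 * alpha ^ 2)
       / (12 * (1 + 2 * alpha) * (1 + alpha) ^ 2)
  else 1 / (3 * (1 + 2 * alpha)).

(* The exact value of the threshold 0.8090...: the positive root of
   4 x^2 - 2 x - 1 = 0, where the two expressions of [bound3] agree.  With the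
   rounded value 0.8090 the estimate would fail for alpha between the two. *)
Definition alpha3 : R := (1 + sqrt 5) / 4.

Definition bound3 (alpha : R) : R :=
  if Rle_dec alpha alpha3
  then 1 / (4 * (1 + 3 * alpha))
       - 4 / (3 * (1 + alpha) * (1 + 2 * alpha))
       + 5 / (3 * (1 + alpha) ^ 3)
  else 1 / (4 * (1 + 3 * alpha)).

(* Main.v *)
Require Import Defs.
From Stdlib Require Import Reals Lra Lia ClassicalEpsilon.
From Coquelicot Require Import Coquelicot.
Local Open Scope R_scope.

(** Put p = f' + alpha z f''. If f = z + a_2 z^2 + ..., the coefficients of p are
  c_n = (n + 1) (1 + n alpha) a_(n+1), and f belongs to W(alpha) exactly when p
  is a Caratheodory function: p(0) = 1 and Re p > 0. Substituting w = f(z) in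
  exp (L w) w = F w, where L = log (F w / w), and differentiating gives
  f = z f' (1 + f L'(f)); comparing coefficients expresses Gamma_1, Gamma_2 and
  Gamma_3 through c_1, c_2, c_3 ([log_inverse_relation], [gamma_formula]): up to
  explicit factors they are c_1, c_2 - v c_1^2 and c_3 - 2 B c_1 c_2 + D c_1^3
  with v, B, D rational in alpha.

  The upper bounds use a single estimate, |c_n| <= 2 for Caratheodory functions
  ([caratheodory_bound]). It applies not only to p but to every function whose
  Schwarz function is a rotation eps omega of omega = (p - 1) / (p + 1); for
  eps = -1 this function is 1/p. The second and third coefficients of these
  functions are again quadratic and cubic expressions in c_1, c_2, c_3
  ([jet_schwarz_rotate]), and in every range of alpha the functional at hand is
  a combination of such coefficients and of their products with weights that
  add up to the asserted bound: this is the content of [quadratic_bound_low],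
  [quadratic_bound_high], [cubic_bound_steep], [cubic_bound_mid] and
  [cubic_bound_flat]. The threshold alpha3 is the value at which B = D.

  The estimates are attained for p = (1 + z^k) / (1 - z^k) with k = 1, 2, 3. The
  equation f' + alpha z f'' = p is solved coefficientwise. A minimum principle
  gives Re f' >= (1 - |z|) / (1 + |z|) ([Re_derive_lower]), which makes f
  injective and makes |f| at least 1/3 on the circle |z| = 4/5; hence f covers
  the disc of radius 1/4, its inverse F is holomorphic there, and log (F w / w)
  exists as a primitive of the logarithmic derivative ([inverse_exists]).

  All of this rests on the fact that a differentiable function on a disc is the
  sum of a power series ([holomorphic_is_powser]). Goursat's theorem for triangles
  provides primitives; a primitive P of f has a second-order expansion at every
  point, so its difference quotients are holomorphic without exception
  ([divdiff_holomorphic]); integrating them over a circle gives Cauchy's formula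
  for P, hence a power series for P and, by differentiation, for f. *)

(** * Complex numbers and derivatives *)

Ltac norm_split :=
  first [eapply Rle_trans | eapply Rle_lt_trans]; [apply Cmod_triangle|].

(** Proves an equation from another one by exhibiting the difference of the two
    sides as a multiple; [ring] or [field] checks the multiple. *)
Lemma Ceq_comb (A B l r k : C) : l = r -> (A - B = k * (l - r))%C -> A = B.
Proof. intros -> H. replace A with ((A - B) + B)%C by ring. rewrite H. ring. Qed.

Lemma Csub_0_eq (u v : C) : (u - v)%C = RtoC 0 -> u = v.
Proof. intros H. apply (Ceq_comb _ _ _ _ (RtoC 1) H). ring. Qed.

Lemma RtoC_m1 : RtoC (-1) = (- (1))%C.
Proof. unfold RtoC, Copp; simpl. f_equal; lra. Qed.

Lemma Cmod_le_add (u z : C) : Cmod u <= Cmod z + Cmod (u - z).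
Proof. replace u with (z + (u - z))%C at 1 by ring. apply Cmod_triangle. Qed.

Lemma Cconj_0 : Cconj (RtoC 0) = RtoC 0.
Proof. unfold Cconj, RtoC; simpl. f_equal; ring. Qed.

Lemma is_derive_C_eps (f : C -> C) (z l : C) :
  is_derive f z l <->
  forall eps : R, 0 < eps -> exists delta : R, 0 < delta /\
    forall u : C, Cmod (u - z) < delta ->
      Cmod (f u - f z - l * (u - z))%C <= eps * Cmod (u - z)%C.
Proof.
  split.
  - intros [_ H] eps Heps.
    specialize (H z (fun P HP => HP) (mkposreal eps Heps)).
    destruct H as [d Hd]. exists d; split; [apply cond_pos|].
    intros u Hu. specialize (Hd u Hu).
    unfold norm, minus, scal, plus, opp in Hd; simpl in Hd.
    unfold Cminus at 1 2 4. rewrite (Cmult_comm l). exact Hd.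
  - intros H. split.
    + apply is_linear_scal_l.
    + intros x Hx eps.
      assert (x = z) as ->.
      { symmetry. now apply (is_filter_lim_locally_unique (V:=AbsRing_NormedModule C_AbsRing)). }
      destruct (H eps (cond_pos eps)) as [d [Hd H']].
      exists (mkposreal d Hd). intros u Hu. specialize (H' u Hu).
      unfold norm, minus, scal, plus, opp; simpl.
      unfold Cminus at 1 2 4 in H'. rewrite (Cmult_comm l) in H'. exact H'.
Qed.

(** C carries two structures of normed module over itself that differ in their
    uniform structure only; derivatives do not see the difference, so the
    product and chain rules stated for the ring structure can be used. *)
Lemma is_derive_C_AbsRing (f : C -> C) (z l : C) :
  is_derive f z l <->
  is_derive (K := C_AbsRing) (V := AbsRing_NormedModule C_AbsRing) f z l.
Proof.
  split; intros [[H1 H2 H3] H4]; (split; [constructor; assumption | exact H4]).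
Qed.

Lemma is_derive_C_mult {f g : C -> C} {z lf lg : C} :
  is_derive f z lf -> is_derive g z lg ->
  is_derive (fun u => f u * g u)%C z (lf * g z + f z * lg)%C.
Proof.
  rewrite !is_derive_C_AbsRing. intros Hf Hg.
  apply (is_derive_mult (K:=C_AbsRing) f g z lf lg Hf Hg).
  exact Cmult_comm.
Qed.

Lemma is_derive_C_comp (f g : C -> C) (z lf lg : C) :
  is_derive f (g z) lf -> is_derive g z lg ->
  is_derive (fun u => f (g u)) z (lf * lg)%C.
Proof.
  rewrite !is_derive_C_AbsRing. intros Hf Hg. rewrite Cmult_comm.
  apply (is_derive_comp (K:=C_AbsRing) (V:=AbsRing_NormedModule C_AbsRing) f g z lf lg Hf Hg).
Qed.

Lemma is_derive_C_plus {f g : C -> C} {z lf lg : C} :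
  is_derive f z lf -> is_derive g z lg ->
  is_derive (fun u => f u + g u)%C z (lf + lg)%C.
Proof. intros Hf Hg. exact (is_derive_plus f g z lf lg Hf Hg). Qed.

Lemma is_derive_C_minus {f g : C -> C} {z lf lg : C} :
  is_derive f z lf -> is_derive g z lg ->
  is_derive (fun u => f u - g u)%C z (lf - lg)%C.
Proof. intros Hf Hg. exact (is_derive_minus f g z lf lg Hf Hg). Qed.

Lemma is_derive_C_const (c z : C) : is_derive (fun _ : C => c) z (RtoC 0).
Proof. exact (is_derive_const c z). Qed.

Lemma is_derive_C_id (z : C) : is_derive (fun u : C => u) z (RtoC 1).
Proof. apply is_derive_C_AbsRing. exact (is_derive_id (K := C_AbsRing) z). Qed.

Lemma continuous_C_eps (f : C -> C) (z : C) :
  continuous f z <-> forall eps : R, 0 < eps -> exists delta : R, 0 < delta /\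
    forall u : C, Cmod (u - z) < delta -> Cmod (f u - f z) < eps.
Proof.
  split.
  - intros H eps Heps.
    assert (H1 : locally (T := C_UniformSpace) z (fun u => Cmod (f u - f z) < eps)%C).
    { apply (H (fun v => Cmod (v - f z)%C < eps)). apply (locally_C (f z)). exists (mkposreal eps Heps). now intros y Hy. }
    apply (locally_C z) in H1. destruct H1 as [d Hd].
    exists d; split; [apply cond_pos|]. exact Hd.
  - intros H P HP. apply (locally_C (f z)) in HP. destruct HP as [e He].
    destruct (H e (cond_pos e)) as [d [Hd H']].
    apply (locally_C z). exists (mkposreal d Hd). intros u Hu. apply He, H', Hu.
Qed.

Lemma continuous_RC_eps (h : R -> C) (t : R) :
  continuous h t <-> forall eps : R, 0 < eps -> exists delta : R, 0 < delta /\
    forall s : R, Rabs (s - t) < delta -> Cmod (h s - h t) < eps.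
Proof.
  split.
  - intros H eps Heps.
    assert (H1 : locally (T := R_UniformSpace) t (fun s => Cmod (h s - h t) < eps)%C).
    { apply (H (fun v => Cmod (v - h t)%C < eps)). apply (locally_C (h t)). exists (mkposreal eps Heps). now intros y Hy. }
    destruct H1 as [d Hd].
    exists d; split; [apply cond_pos|]. exact Hd.
  - intros H P HP. apply (locally_C (h t)) in HP. destruct HP as [e He].
    destruct (H e (cond_pos e)) as [d [Hd H']].
    exists (mkposreal d Hd). intros s Hs. apply He, H', Hs.
Qed.

Lemma is_derive_C_continuous (f : C -> C) (z l : C) :
  is_derive f z l -> continuous f z.
Proof.
  intros H. apply continuous_C_eps. intros eps Heps.
  destruct (proj1 (is_derive_C_eps f z l) H 1 Rlt_0_1) as [d [Hd H']].
  assert (Hm := Cmod_ge_0 l).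
  exists (Rmin d (eps / (Cmod l + 2))). split.
  { apply Rmin_glb_lt; [assumption|]. apply Rdiv_lt_0_compat; lra. }
  intros u Hu.
  assert (Hu1 := Rlt_le_trans _ _ _ Hu (Rmin_l _ _)).
  assert (Hu2 := Rlt_le_trans _ _ _ Hu (Rmin_r _ _)).
  specialize (H' u Hu1).
  replace (f u - f z)%C with ((f u - f z - l * (u - z)) + l * (u - z))%C by ring.
  norm_split. rewrite Cmod_mult.
  apply Rmult_lt_compat_r with (r := Cmod l + 2) in Hu2; [|lra].
  replace (eps / (Cmod l + 2) * (Cmod l + 2)) with eps in Hu2 by (field; lra).
  assert (H0 := Cmod_ge_0 (u - z)%C). nra.
Qed.

Lemma continuous_C_minus (f g : C -> C) (z : C) :
  continuous f z -> continuous g z -> continuous (fun u => f u - g u)%C z.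
Proof. apply (continuous_minus (V := C_NormedModule) (U := C_UniformSpace)). Qed.

Lemma continuous_RC_comp (f : C -> C) (h : R -> C) (t : R) :
  continuous h t -> continuous f (h t) -> continuous (fun s => f (h s)) t.
Proof. intros H1 H2. exact (continuous_comp h f t H1 H2). Qed.

Lemma continuous_RC_mult (g h : R -> C) (t : R) :
  continuous g t -> continuous h t -> continuous (fun s => (g s * h s)%C) t.
Proof.
  intros Hg Hh.
  apply continuous_RC_eps. intros eps Heps.
  assert (Hm := Cmod_ge_0 (h t)). assert (Hm' := Cmod_ge_0 (g t)).
  set (k := Cmod (h t) + Cmod (g t) + 1).
  assert (Hk : 0 < k) by (unfold k; lra).
  assert (He : 0 < Rmin 1 (eps / (2 * k))).
  { apply Rmin_glb_lt; [lra|]. apply Rdiv_lt_0_compat; lra. }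
  destruct (proj1 (continuous_RC_eps g t) Hg _ He) as [d1 [Hd1 H1]].
  destruct (proj1 (continuous_RC_eps h t) Hh _ He) as [d2 [Hd2 H2]].
  exists (Rmin d1 d2). split; [now apply Rmin_glb_lt|].
  intros s Hs.
  specialize (H1 s (Rlt_le_trans _ _ _ Hs (Rmin_l _ _))).
  specialize (H2 s (Rlt_le_trans _ _ _ Hs (Rmin_r _ _))).
  set (m := Rmin 1 (eps / (2 * k))) in *.
  assert (m <= 1) by apply Rmin_l.
  assert (Hm2 : m <= eps / (2 * k)) by apply Rmin_r.
  assert (Hmk : m * k <= eps / 2).
  { apply Rmult_le_compat_r with (r := k) in Hm2; [|lra].
    replace (eps / (2 * k) * k) with (eps / 2) in Hm2 by (field; lra). lra. }
  replace (g s * h s - g t * h t)%C with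
    ((g s - g t) * (h s - h t) + ((g s - g t) * h t + g t * (h s - h t)))%C by ring.
  norm_split.
  eapply Rle_lt_trans; [apply Rplus_le_compat_l, Cmod_triangle|].
  rewrite !Cmod_mult.
  assert (A := Cmod_ge_0 (g s - g t)%C). assert (B := Cmod_ge_0 (h s - h t)%C).
  assert (Cmod (g s - g t)%C * Cmod (h s - h t)%C <= m * 1) by (apply Rmult_le_compat; lra).
  assert (Cmod (g s - g t)%C * Cmod (h t) <= m * Cmod (h t)) by (apply Rmult_le_compat_r; lra).
  assert (Cmod (g t) * Cmod (h s - h t)%C <= m * Cmod (g t)) by (rewrite Rmult_comm; apply Rmult_le_compat_r; lra).
  unfold k in Hmk. nra.
Qed.

Lemma continuous_RC_plus (g h : R -> C) (t : R) :
  continuous g t -> continuous h t -> continuous (fun s => (g s + h s)%C) t.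
Proof. intros Hg Hh. exact (continuous_plus (V := C_R_NormedModule) g h t Hg Hh). Qed.

Lemma continuous_RC_minus (g h : R -> C) (t : R) :
  continuous g t -> continuous h t -> continuous (fun s => (g s - h s)%C) t.
Proof. intros Hg Hh. exact (continuous_minus (V := C_R_NormedModule) g h t Hg Hh). Qed.

Lemma continuous_RC_const (c : C) (t : R) : continuous (fun _ : R => c) t.
Proof. apply continuous_const. Qed.

Lemma continuous_RC_RtoC (t : R) : continuous RtoC t.
Proof.
  apply continuous_RC_eps. intros eps He. exists eps; split; [easy|].
  intros s Hs. rewrite <- RtoC_minus, Cmod_R. exact Hs.
Qed.

Lemma continuous_RC_conj (h : R -> C) (t : R) :
  continuous h t -> continuous (fun s => Cconj (h s)) t.
Proof.
  intros H. apply continuous_RC_eps. intros eps He.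
  destruct (proj1 (continuous_RC_eps h t) H eps He) as [d [Hd H']].
  exists d; split; [easy|]. intros s Hs.
  rewrite <- Cminus_conj, Cmod_conj. now apply H'.
Qed.

Lemma Cnorm_R (x : C) : @norm _ C_R_NormedModule x = Cmod x.
Proof.
  unfold norm; simpl. unfold prod_norm, Cmod, norm; simpl.
  unfold abs; simpl. rewrite !Rmult_1_r. f_equal.
  unfold Rabs; destruct (Rcase_abs (fst x)); destruct (Rcase_abs (snd x)); ring.
Qed.

Lemma Cscal_R (x : R) (y : C) : @scal _ C_R_NormedModule x y = (RtoC x * y)%C.
Proof.
  destruct y as [y1 y2]. unfold scal; simpl. unfold prod_scal, Cmult, RtoC, scal; simpl.
  unfold mult; simpl. f_equal; ring.
Qed.

Notation curve_derive := (is_derive (V := C_R_NormedModule)).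

Lemma is_derive_curve_eps (h : R -> C) (t : R) (l : C) :
  curve_derive h t l <->
  forall eps : R, 0 < eps -> exists delta : R, 0 < delta /\
    forall s : R, Rabs (s - t) < delta ->
      Cmod (h s - h t - RtoC (s - t) * l)%C <= eps * Rabs (s - t)%R.
Proof.
  split.
  - intros [_ H] eps Heps.
    specialize (H t (fun P HP => HP) (mkposreal eps Heps)).
    destruct H as [d Hd]. exists d; split; [apply cond_pos|].
    intros u Hu. specialize (Hd u Hu). simpl in Hd. rewrite Cnorm_R, Cscal_R in Hd. exact Hd.
  - intros H. split.
    + apply is_linear_scal_l.
    + intros x Hx eps.
      assert (x = t) as ->.
      { symmetry. now apply (is_filter_lim_locally_unique (V:=R_NormedModule)). }
      destruct (H eps (cond_pos eps)) as [d [Hd H']].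
      exists (mkposreal d Hd). intros u Hu. specialize (H' u Hu).
      rewrite Cnorm_R, Cscal_R. exact H'.
Qed.

Lemma is_derive_curve_pair (x y : R -> R) (t x' y' : R) :
  is_derive x t x' -> is_derive y t y' ->
  curve_derive (fun s => (x s, y s) : C) t ((x', y') : C).
Proof.
  intros Hx Hy. apply is_derive_curve_eps. intros eps He.
  apply is_derive_Reals in Hx. apply is_derive_Reals in Hy.
  destruct (Hx (eps / 2)) as [d1 H1]; [lra|].
  destruct (Hy (eps / 2)) as [d2 H2]; [lra|].
  exists (Rmin d1 d2). split; [apply Rmin_glb_lt; apply cond_pos|].
  intros s Hs.
  destruct (Req_dec s t) as [->|Hst].
  { replace ((x t, y t) - (x t, y t) - RtoC (t - t) * (x', y'))%C with (RtoC 0).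
    - rewrite Cmod_0, Rminus_diag, Rabs_R0; lra.
    - unfold RtoC, Cminus, Cplus, Copp, Cmult; simpl. f_equal; ring. }
  assert (Hh : s - t <> 0) by lra.
  specialize (H1 (s - t) Hh (Rlt_le_trans _ _ _ Hs (Rmin_l _ _))).
  specialize (H2 (s - t) Hh (Rlt_le_trans _ _ _ Hs (Rmin_r _ _))).
  replace (t + (s - t)) with s in * by ring.
  assert (K : forall u v e : R, Rabs ((u - v) / (s - t) - e) < eps / 2 ->
     Rabs (u - v - (s - t) * e) <= eps / 2 * Rabs (s - t)).
  { intros u v e Hu.
    replace (u - v - (s - t) * e) with (((u - v) / (s - t) - e) * (s - t)) by (field; lra).
    rewrite Rabs_mult. apply Rmult_le_compat_r; [apply Rabs_pos|lra]. }
  apply K in H1. apply K in H2.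
  replace ((x s, y s) - (x t, y t) - RtoC (s - t) * (x', y'))%C
    with ((RtoC (x s - x t - (s - t) * x') + Ci * RtoC (y s - y t - (s - t) * y')))%C.
  - norm_split. rewrite Cmod_mult, !Cmod_R, Cmod_Ci. lra.
  - unfold RtoC, Cminus, Cplus, Copp, Cmult, Ci; simpl. f_equal; ring.
Qed.

Lemma is_derive_curve_Re (h : R -> C) (t : R) (l : C) :
  curve_derive h t l -> is_derive (fun s => Re (h s)) t (Re l).
Proof.
  intros H. apply is_derive_Reals. intros eps He.
  destruct (proj1 (is_derive_curve_eps h t l) H (eps / 2)) as [d [Hd H1]]; [lra|].
  exists (mkposreal d Hd). intros k Hk Hkd. simpl in Hkd.
  specialize (H1 (t + k)). replace (t + k - t) with k in H1 by ring. specialize (H1 Hkd).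
  assert (H2 := re_le_Cmod (h (t + k)%R - h t - RtoC k * l)%C).
  replace (Re (h (t + k)%R - h t - RtoC k * l)%C) with
     (((Re (h (t + k)%R) - Re (h t)) / k - Re l) * k) in H2.
  - rewrite Rabs_mult in H2.
    assert (0 < Rabs k) by now apply Rabs_pos_lt.
    apply Rmult_lt_reg_r with (Rabs k); [assumption|]. nra.
  - unfold Re, RtoC, Cminus, Cplus, Copp, Cmult; simpl. field; assumption.
Qed.

Lemma is_derive_curve_comp (f : C -> C) (h : R -> C) (t : R) (l m : C) :
  is_derive f (h t) l -> curve_derive h t m ->
  curve_derive (fun s => f (h s)) t (l * m)%C.
Proof.
  intros Hf Hh. apply is_derive_curve_eps. intros eps He.
  assert (Hl := Cmod_ge_0 l). assert (Hm := Cmod_ge_0 m).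
  set (e1 := Rmin 1 (eps / (2 * (Cmod l + Cmod m + 1)))).
  assert (He1 : 0 < e1).
  { apply Rmin_glb_lt; [lra|]. apply Rdiv_lt_0_compat; lra. }
  assert (Hb : e1 * (Cmod l + Cmod m + 1) <= eps / 2).
  { assert (H : e1 <= eps / (2 * (Cmod l + Cmod m + 1))) by apply Rmin_r.
    apply Rmult_le_compat_r with (r := Cmod l + Cmod m + 1) in H; [|lra].
    replace (eps / (2 * (Cmod l + Cmod m + 1)) * (Cmod l + Cmod m + 1)) with (eps / 2) in H
      by (field; lra). exact H. }
  assert (He1' : e1 <= 1) by apply Rmin_l.
  destruct (proj1 (is_derive_C_eps f (h t) l) Hf e1 He1) as [d1 [Hd1 H1]].
  destruct (proj1 (is_derive_curve_eps h t m) Hh e1 He1) as [d2 [Hd2 H2]].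
  exists (Rmin d2 (d1 / (Cmod m + 1))). split.
  { apply Rmin_glb_lt; [assumption|]. apply Rdiv_lt_0_compat; lra. }
  intros s Hs.
  specialize (H2 s (Rlt_le_trans _ _ _ Hs (Rmin_l _ _))).
  assert (Hs2 := Rlt_le_trans _ _ _ Hs (Rmin_r _ _)).
  apply Rmult_lt_compat_r with (r := Cmod m + 1) in Hs2; [|lra].
  replace (d1 / (Cmod m + 1) * (Cmod m + 1)) with d1 in Hs2 by (field; lra).
  assert (Hst := Rabs_pos (s - t)).
  assert (Hinc : Cmod (h s - h t)%C <= (Cmod m + 1) * Rabs (s - t)).
  { replace (h s - h t)%C with ((h s - h t - RtoC (s - t) * m) + RtoC (s - t) * m)%C by ring.
    norm_split. rewrite Cmod_mult, Cmod_R. nra. }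
  specialize (H1 (h s)). assert (Hn : Cmod (h s - h t)%C < d1) by lra. specialize (H1 Hn).
  replace (f (h s) - f (h t) - RtoC (s - t) * (l * m))%C with
    ((f (h s) - f (h t) - l * (h s - h t)) + l * (h s - h t - RtoC (s - t) * m))%C by ring.
  norm_split. rewrite Cmod_mult.
  assert (e1 * Cmod (h s - h t)%C <= e1 * ((Cmod m + 1) * Rabs (s - t))) by (apply Rmult_le_compat_l; lra).
  assert (Cmod l * Cmod (h s - h t - RtoC (s - t) * m)%C <= Cmod l * (e1 * Rabs (s - t))) by (apply Rmult_le_compat_l; lra).
  nra.
Qed.

Definition Cint (h : R -> C) (a b : R) : C := @RInt C_R_CompleteNormedModule h a b.

(** * Integrals of complex-valued functions of a real variable *)

Definition cont_on (h : R -> C) (a b : R) : Prop := forall t, a <= t <= b -> continuous h t.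

Lemma is_Cint (h : R -> C) (a b : R) : a <= b -> cont_on h a b ->
  is_RInt (V := C_R_CompleteNormedModule) h a b (Cint h a b).
Proof.
  intros Hab H. apply (RInt_correct (V := C_R_CompleteNormedModule)).
  apply (ex_RInt_continuous (V := C_R_CompleteNormedModule)). intros z Hz.
  rewrite Rmin_left, Rmax_right in Hz by assumption. now apply H.
Qed.

Lemma Cint_unique (h : R -> C) (a b : R) (l : C) :
  is_RInt (V := C_R_CompleteNormedModule) h a b l -> Cint h a b = l.
Proof. intros H. now apply (is_RInt_unique (V := C_R_CompleteNormedModule)). Qed.

Lemma Cint_ext (g h : R -> C) (a b : R) : a <= b ->
  (forall t, a <= t <= b -> g t = h t) -> Cint g a b = Cint h a b.
Proof.
  intros Hab H. apply (RInt_ext (V := C_R_CompleteNormedModule)). intros x Hx.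
  rewrite Rmin_left, Rmax_right in Hx by assumption. apply H; lra.
Qed.

Lemma Cint_plus (g h : R -> C) (a b : R) : a <= b -> cont_on g a b -> cont_on h a b ->
  Cint (fun t => g t + h t)%C a b = (Cint g a b + Cint h a b)%C.
Proof.
  intros Hab Hg Hh. apply Cint_unique.
  apply (is_RInt_plus (V := C_R_NormedModule)); now apply is_Cint.
Qed.

Lemma is_RInt_C_Ci (h : R -> C) (a b : R) (l : C) :
  is_RInt (V := C_R_NormedModule) h a b l ->
  is_RInt (V := C_R_NormedModule) (fun t => Ci * h t)%C a b (Ci * l)%C.
Proof.
  intros H.
  assert (H1 := is_RInt_fct_extend_fst (U:=R_NormedModule) (V:=R_NormedModule) h a b l H).
  assert (H2 := is_RInt_fct_extend_snd (U:=R_NormedModule) (V:=R_NormedModule) h a b l H).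
  assert (E : forall z : C, (Ci * z)%C = (opp (snd z), fst z)).
  { intros z. unfold Cmult, Ci, opp; simpl. f_equal; ring. }
  rewrite E.
  apply is_RInt_ext with (fun t => (opp (snd (h t)), fst (h t))).
  { intros x _. symmetry. apply E. }
  apply (is_RInt_fct_extend_pair (U:=R_NormedModule) (V:=R_NormedModule)).
  - now apply (is_RInt_opp (V := R_NormedModule)).
  - exact H1.
Qed.

Lemma Cint_scal (c : C) (h : R -> C) (a b : R) : a <= b -> cont_on h a b ->
  Cint (fun t => c * h t)%C a b = (c * Cint h a b)%C.
Proof.
  intros Hab Hh. apply Cint_unique. apply is_Cint in Hh; [|assumption].
  assert (E : forall z : C, (c * z)%C = plus (scal (Re c) z) (scal (Im c) (Ci * z)%C) :> C_R_NormedModule).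
  { intros z. rewrite !Cscal_R. unfold plus; simpl. destruct c as [c1 c2], z as [z1 z2].
    unfold prod_plus, Cmult, RtoC, Ci, plus, Re, Im; simpl. f_equal; ring. }
  rewrite E.
  apply (is_RInt_ext (V := C_R_NormedModule)) with (fun t => plus (scal (Re c) (h t)) (scal (Im c) (Ci * h t)%C) : C_R_NormedModule).
  { intros x _. symmetry; apply E. }
  apply (is_RInt_plus (V := C_R_NormedModule)).
  - now apply (is_RInt_scal (V := C_R_NormedModule)).
  - apply (is_RInt_scal (V := C_R_NormedModule)). now apply is_RInt_C_Ci.
Qed.

Lemma cont_on_plus g h a b : cont_on g a b -> cont_on h a b -> cont_on (fun t => g t + h t)%C a b.
Proof. intros Hg Hh t Ht. apply continuous_RC_plus; auto. Qed.

Lemma cont_on_mult g h a b : cont_on g a b -> cont_on h a b -> cont_on (fun t => g t * h t)%C a b.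
Proof. intros Hg Hh t Ht. apply continuous_RC_mult; auto. Qed.

Lemma cont_on_const c a b : cont_on (fun t => c)%C a b.
Proof. intros t Ht. apply continuous_RC_const; auto. Qed.

Lemma Cint_minus (g h : R -> C) (a b : R) : a <= b -> cont_on g a b -> cont_on h a b ->
  Cint (fun t => g t - h t)%C a b = (Cint g a b - Cint h a b)%C.
Proof.
  intros Hab Hg Hh. apply Cint_unique.
  apply (is_RInt_minus (V := C_R_NormedModule)); now apply is_Cint.
Qed.

Lemma Cint_const (c : C) (a b : R) : Cint (fun _ => c) a b = (RtoC (b - a) * c)%C.
Proof.
  rewrite <- Cscal_R. apply Cint_unique. apply (is_RInt_const (V := C_R_NormedModule)).
Qed.

Lemma Cint_bound (h : R -> C) (a b M : R) : a <= b -> cont_on h a b ->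
  (forall t, a <= t <= b -> Cmod (h t) <= M) -> Cmod (Cint h a b) <= M * (b - a).
Proof.
  intros Hab Hh HM. rewrite <- Cnorm_R, Rmult_comm.
  apply (norm_RInt_le (V := C_R_NormedModule) h (fun _ => M) a b _ _ Hab).
  - intros x Hx. rewrite Cnorm_R. now apply HM.
  - now apply is_Cint.
  - apply (is_RInt_const (V := R_NormedModule)).
Qed.

Lemma Cint_FTC (H h : R -> C) (a b : R) : a <= b ->
  (forall t, a <= t <= b -> curve_derive H t (h t)) ->
  cont_on h a b -> Cint h a b = (H b - H a)%C.
Proof.
  intros Hab Hd Hh. apply Cint_unique.
  apply (is_RInt_derive (V := C_R_CompleteNormedModule) H h a b); intros x Hx;
  rewrite Rmin_left, Rmax_right in Hx by assumption; auto.
Qed.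

Lemma Cint_Re (h : R -> C) (a b : R) : a <= b -> cont_on h a b ->
  is_RInt (fun t => Re (h t)) a b (Re (Cint h a b)).
Proof.
  intros Hab Hh. apply (is_RInt_fct_extend_fst (U:=R_NormedModule) (V:=R_NormedModule)).
  now apply is_Cint.
Qed.

Lemma Cint_conj (h : R -> C) (a b : R) : a <= b -> cont_on h a b ->
  Cint (fun t => Cconj (h t)) a b = Cconj (Cint h a b).
Proof.
  intros Hab Hh. apply is_Cint in Hh; [|assumption]. apply Cint_unique.
  apply (is_RInt_fct_extend_pair (U:=R_NormedModule) (V:=R_NormedModule)).
  - apply (is_RInt_fct_extend_fst (U:=R_NormedModule) (V:=R_NormedModule) h a b _ Hh).
  - apply (is_RInt_opp (V := R_NormedModule)).
    apply (is_RInt_fct_extend_snd (U:=R_NormedModule) (V:=R_NormedModule) h a b _ Hh).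
Qed.

Lemma Cint_Re_ge0 (h : R -> C) (a b : R) : a <= b -> cont_on h a b ->
  (forall t, a <= t <= b -> 0 <= Re (h t)) -> 0 <= Re (Cint h a b).
Proof.
  intros Hab Hh Hp. assert (H := Cint_Re h a b Hab Hh).
  apply (is_RInt_le (fun _ => 0) (fun t => Re (h t)) a b 0 (Re (Cint h a b))); auto.
  - assert (H0 := is_RInt_const (V := R_NormedModule) a b 0).
    unfold scal in H0; simpl in H0; unfold mult in H0; simpl in H0.
    rewrite Rmult_0_r in H0. exact H0.
  - intros x Hx. apply Hp; lra.
Qed.

(** * Integrals over segments and Goursat's theorem *)

Definition line (u v : C) (t : R) : C := (u + RtoC t * (v - u))%C.

Lemma line_disc (u v : C) (t r : R) :
  Cmod u <= r -> Cmod v <= r -> 0 <= t <= 1 -> Cmod (line u v t) <= r.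
Proof.
  intros Hu Hv Ht. unfold line.
  replace (u + RtoC t * (v - u))%C with (RtoC (1 - t) * u + RtoC t * v)%C
    by (rewrite RtoC_minus; ring).
  norm_split. rewrite !Cmod_mult, !Cmod_R.
  rewrite !Rabs_pos_eq by lra. nra.
Qed.

Lemma line_dist (u v z : C) (t : R) : 0 <= t <= 1 ->
  Cmod (line u v t - z)%C <= Cmod (u - z)%C + Cmod (v - u)%C.
Proof.
  intros Ht. unfold line.
  replace (u + RtoC t * (v - u) - z)%C with ((u - z) + RtoC t * (v - u))%C by ring.
  norm_split. rewrite Cmod_mult, Cmod_R.
  rewrite Rabs_pos_eq by lra. assert (H := Cmod_ge_0 (v - u)%C). nra.
Qed.

Lemma line_derive (u v : C) (t : R) :
  curve_derive (line u v) t (v - u)%C.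
Proof.
  apply is_derive_curve_eps. intros eps He. exists 1; split; [lra|]. intros s _.
  unfold line. replace (_ - _)%C with (RtoC 0).
  - rewrite Cmod_0. assert (H := Rabs_pos (s - t)). nra.
  - rewrite RtoC_minus. ring.
Qed.

Lemma line_continuous (u v : C) (t : R) : continuous (line u v) t.
Proof.
  unfold line. apply continuous_RC_plus; [apply continuous_RC_const|].
  apply continuous_RC_mult; [apply continuous_RC_RtoC|apply continuous_RC_const].
Qed.

(** The path integral of f along the segment from u to v. *)
Definition seg_int (f : C -> C) (u v : C) : C :=
  ((v - u) * Cint (fun t => f (line u v t)) 0 1)%C.

Definition cont_on_seg (f : C -> C) (u v : C) : Prop :=
  forall t, 0 <= t <= 1 -> continuous f (line u v t).

Lemma cont_on_seg_line f u v : cont_on_seg f u v -> cont_on (fun t => f (line u v t)) 0 1.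
Proof.
  intros H t Ht. apply continuous_RC_comp; [apply line_continuous|now apply H].
Qed.

Lemma seg_int_bound f u v M : cont_on_seg f u v ->
  (forall t, 0 <= t <= 1 -> Cmod (f (line u v t)) <= M) ->
  Cmod (seg_int f u v) <= M * Cmod (v - u)%C.
Proof.
  intros H HM. unfold seg_int. rewrite Cmod_mult, Rmult_comm.
  apply Rmult_le_compat_r; [apply Cmod_ge_0|].
  replace M with (M * (1 - 0)) by ring. apply Cint_bound; auto; [lra|].
  now apply cont_on_seg_line.
Qed.

Lemma seg_int_minus f g u v : cont_on_seg f u v -> cont_on_seg g u v ->
  seg_int (fun z => f z - g z)%C u v = (seg_int f u v - seg_int g u v)%C.
Proof.
  intros Hf Hg. unfold seg_int. rewrite Cint_minus; try apply cont_on_seg_line; auto; [ring|lra].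
Qed.

Lemma seg_int_FTC F f u v :
  (forall t, 0 <= t <= 1 -> is_derive F (line u v t) (f (line u v t))) ->
  cont_on_seg f u v -> seg_int f u v = (F v - F u)%C.
Proof.
  intros Hd Hf. unfold seg_int. rewrite <- Cint_scal; [|lra|now apply cont_on_seg_line].
  rewrite (Cint_FTC (fun t => F (line u v t))).
  - f_equal; f_equal; [f_equal|f_equal]; unfold line; ring.
  - lra.
  - intros t Ht. rewrite Cmult_comm. apply is_derive_curve_comp; [now apply Hd|apply line_derive].
  - apply cont_on_mult; [apply cont_on_const|now apply cont_on_seg_line].
Qed.

Lemma Cint_comp_lin (h : R -> C) (k c : R) : cont_on h (Rmin c (k + c)) (Rmax c (k + c)) ->
  (RtoC k * Cint (fun s => h (k * s + c)%R) 0 1)%C = @RInt C_R_CompleteNormedModule h c (k + c).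
Proof.
  intros H.
  assert (Hx : ex_RInt (V := C_R_CompleteNormedModule) h (k * 0 + c) (k * 1 + c)).
  { apply (ex_RInt_continuous (V := C_R_CompleteNormedModule)). intros z Hz.
    rewrite Rmult_0_r, Rplus_0_l, Rmult_1_r in Hz. now apply H. }
  assert (E := RInt_comp_lin (V := C_R_CompleteNormedModule) h k c 0 1 Hx).
  rewrite Rmult_0_r, Rplus_0_l, Rmult_1_r in E.
  rewrite <- E. rewrite <- Cint_scal; [|lra|].
  - apply Cint_ext; [lra|]. intros t _. symmetry. apply Cscal_R.
  - intros t Ht. 
    assert (Hc : continuous h (k * t + c)).
    { apply H. unfold Rmin, Rmax. destruct (Rle_dec c (k + c)); nra. }
    apply (continuous_comp (fun s => k * s + c) h); [|exact Hc].
    apply (continuous_plus (V := R_NormedModule) (fun s => k * s) (fun _ => c)); [|apply continuous_const].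
    apply (continuous_scal_r (V := R_NormedModule) k (fun s => s)). apply continuous_id.
Qed.

Lemma seg_int_rev f u v : cont_on_seg f u v -> seg_int f v u = (- seg_int f u v)%C.
Proof.
  intros H. unfold seg_int.
  assert (E := Cint_comp_lin (fun t => f (line u v t)) (-1) 1).
  replace (-1 + 1) with 0 in E by ring. rewrite Rmin_right, Rmax_left in E by lra.
  specialize (E (cont_on_seg_line _ _ _ H)).
  assert (X : ex_RInt (V := C_R_CompleteNormedModule) (fun t => f (line u v t)) 0 1).
  { exists (Cint (fun t => f (line u v t)) 0 1). apply is_Cint; [lra|]. now apply cont_on_seg_line. }
  rewrite <- (opp_RInt_swap (V := C_R_CompleteNormedModule) _ _ _ X) in E.
  change (@opp _ (@RInt C_R_CompleteNormedModule (fun t => f (line u v t)) 0 1)) with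
    (Copp (Cint (fun t => f (line u v t)) 0 1)) in E.
  rewrite (Cint_ext (fun t => f (line v u t)) (fun s => f (line u v (-1 * s + 1)))).
  - transitivity ((v - u) * (RtoC (-1) * Cint (fun s => f (line u v (-1 * s + 1)%R)) 0 1))%C.
    + rewrite RtoC_m1. ring.
    + rewrite E. ring.
  - lra.
  - intros t _. f_equal. unfold line. rewrite RtoC_plus, RtoC_mult.
    rewrite RtoC_m1. ring.
Qed.

Definition mid (u v : C) : C := (RtoC (1 / 2) * (u + v))%C.

Lemma RtoC_half2 : (RtoC (1 / 2) + RtoC (1 / 2))%C = RtoC 1.
Proof. rewrite <- RtoC_plus. f_equal. lra. Qed.

Lemma seg_int_mid f u v : cont_on_seg f u v ->
  seg_int f u v = (seg_int f u (mid u v) + seg_int f (mid u v) v)%C.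
Proof.
  intros H. assert (Hc := cont_on_seg_line _ _ _ H).
  set (h := fun t => f (line u v t)) in *.
  assert (E1 := Cint_comp_lin h (1 / 2) 0).
  assert (E2 := Cint_comp_lin h (1 / 2) (1 / 2)).
  replace (1 / 2 + 1 / 2) with 1 in E2 by lra. rewrite Rplus_0_r in E1.
  rewrite Rmin_left, Rmax_right in E1, E2 by lra.
  assert (Hi : forall a b, 0 <= a -> a <= b -> b <= 1 -> cont_on h a b).
  { intros a b Ha Hab Hb t Ht. apply Hc. lra. }
  specialize (E1 (Hi 0 (1 / 2) ltac:(lra) ltac:(lra) ltac:(lra))).
  specialize (E2 (Hi (1 / 2) 1 ltac:(lra) ltac:(lra) ltac:(lra))).
  assert (E3 : Cint h 0 1 = (RtoC (1 / 2) * Cint (fun s => h (1 / 2 * s + 0)%R) 0 1 +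
     RtoC (1 / 2) * Cint (fun s => h (1 / 2 * s + 1 / 2)%R) 0 1)%C).
  { rewrite E1, E2. symmetry. apply (RInt_Chasles (V := C_R_CompleteNormedModule)).
    - exists (Cint h 0 (1 / 2)). apply is_Cint; [|apply Hi]; lra.
    - exists (Cint h (1 / 2) 1). apply is_Cint; [|apply Hi]; lra. }
  assert (M : (mid u v = u + RtoC (1/2) * (v - u))%C).
  { unfold mid. replace u with (RtoC 1 * u)%C at 2 by ring. rewrite <- RtoC_half2. ring. }
  unfold seg_int. fold h. rewrite E3.
  rewrite (Cint_ext (fun t => f (line u (mid u v) t)) (fun s => h (1 / 2 * s + 0)%R)); [|lra|].
  rewrite (Cint_ext (fun t => f (line (mid u v) v t)) (fun s => h (1 / 2 * s + 1 / 2)%R)); [|lra|].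
  - rewrite M. replace (v - (u + RtoC (1/2) * (v - u)))%C with (RtoC (1/2) * (v - u))%C.
    + ring.
    + replace (v - (u + RtoC (1/2) * (v - u)))%C with (RtoC 1 * (v - u) - RtoC (1/2) * (v - u))%C by ring.
      rewrite <- RtoC_half2. ring.
  - intros t _. unfold h. f_equal. unfold line. rewrite M, RtoC_plus, RtoC_mult.
    replace (v - (u + RtoC (1/2) * (v - u)))%C with (RtoC 1 * (v - u) - RtoC (1/2) * (v - u))%C by ring.
    rewrite <- RtoC_half2. ring.
  - intros t _. unfold h. f_equal. unfold line. rewrite M, RtoC_plus, RtoC_mult. ring.
Qed.

Definition tri_int (f : C -> C) (u v w : C) : C := (seg_int f u v + seg_int f v w + seg_int f w u)%C.

Lemma mid_disc u v r : Cmod u <= r -> Cmod v <= r -> Cmod (mid u v) <= r.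
Proof.
  intros Hu Hv. unfold mid. rewrite Cmod_mult, Cmod_R, Rabs_pos_eq by lra.
  assert (H := Cmod_triangle u v). lra.
Qed.

(** The inner edges are travelled twice in opposite directions and cancel. *)
Lemma tri_int_split f r u v w :
  (forall z, Cmod z <= r -> continuous f z) ->
  Cmod u <= r -> Cmod v <= r -> Cmod w <= r ->
  tri_int f u v w = (tri_int f u (mid u v) (mid w u) + tri_int f v (mid v w) (mid u v)
    + tri_int f w (mid w u) (mid v w) + tri_int f (mid u v) (mid v w) (mid w u))%C.
Proof.
  intros Hf Hu Hv Hw.
  assert (S : forall a b, Cmod a <= r -> Cmod b <= r -> cont_on_seg f a b).
  { intros a b Ha Hb t Ht. apply Hf. now apply line_disc. }
  assert (H1 := mid_disc _ _ _ Hu Hv). assert (H2 := mid_disc _ _ _ Hv Hw).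
  assert (H3 := mid_disc _ _ _ Hw Hu).
  unfold tri_int.
  rewrite (seg_int_mid f u v), (seg_int_mid f v w), (seg_int_mid f w u) by auto.
  rewrite (seg_int_rev f (mid v w) (mid u v)), (seg_int_rev f (mid w u) (mid v w)),
    (seg_int_rev f (mid u v) (mid w u)) by auto.
  ring.
Qed.

Lemma Cmod_sym (u v : C) : Cmod (u - v)%C = Cmod (v - u)%C.
Proof. rewrite <- Cmod_opp. f_equal. ring. Qed.

Definition small_tri (L : R) (u v w : C) : Prop :=
  Cmod (v - u)%C <= L /\ Cmod (w - v)%C <= L /\ Cmod (u - w)%C <= L.

Lemma half_eq (x y : C) : (x + x = y -> x = RtoC (1 / 2) * y)%C.
Proof.
  intros <-. replace (RtoC (1/2) * (x + x))%C with ((RtoC (1/2) + RtoC (1/2)) * x)%C by ring.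
  rewrite RtoC_half2. ring.
Qed.

Lemma mid2 u v : (mid u v + mid u v = u + v)%C.
Proof.
  unfold mid. replace (RtoC (1/2) * (u + v) + RtoC (1/2) * (u + v))%C
   with ((RtoC (1/2) + RtoC (1/2)) * (u + v))%C by ring.
  rewrite RtoC_half2. ring.
Qed.

(** One of the four triangles cut out by the midpoints carries at least a
    quarter of the integral, and it is half as large. The displacement of the
    first vertex is recorded because that vertex is the sequence whose limit is
    taken. *)
Lemma tri_int_step f r :
  (forall z, Cmod z <= r -> continuous f z) ->
  forall u v w, Cmod u <= r -> Cmod v <= r -> Cmod w <= r ->
  exists u' v' w', (Cmod u' <= r /\ Cmod v' <= r /\ Cmod w' <= r) /\
    (forall L, small_tri L u v w -> small_tri (L / 2) u' v' w' /\ Cmod (u' - u)%C <= L) /\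
    Cmod (tri_int f u v w) <= 4 * Cmod (tri_int f u' v' w').
Proof.
  intros Hf u v w Hu Hv Hw.
  assert (H1 := mid_disc _ _ _ Hu Hv). assert (H2 := mid_disc _ _ _ Hv Hw).
  assert (H3 := mid_disc _ _ _ Hw Hu).
  assert (M1 := mid2 u v). assert (M2 := mid2 v w). assert (M3 := mid2 w u).
  assert (E := tri_int_split f r u v w Hf Hu Hv Hw).
  set (m1 := mid u v) in *. set (m2 := mid v w) in *. set (m3 := mid w u) in *.
  assert (T : Cmod (tri_int f u v w) <= Cmod (tri_int f u m1 m3) + Cmod (tri_int f v m2 m1)
     + Cmod (tri_int f w m3 m2) + Cmod (tri_int f m1 m2 m3)).
  { rewrite E. norm_split. apply Rplus_le_compat_r.
    norm_split. apply Rplus_le_compat_r. apply Cmod_triangle. }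
  assert (P : forall a b c L, Cmod (a - b)%C <= L -> (c + c = a - b -> Cmod c <= L / 2)%C).
  { intros a b c L H Hc. apply half_eq in Hc. rewrite Hc, Cmod_mult, Cmod_R, Rabs_pos_eq by lra. lra. }
  assert (DD : forall a b : C, (a + a - (b + b) = (a - b) + (a - b))%C) by (intros; ring).
  destruct (Rle_dec (Cmod (tri_int f u v w)) (4 * Cmod (tri_int f u m1 m3))) as [D1|D1];
  [|destruct (Rle_dec (Cmod (tri_int f u v w)) (4 * Cmod (tri_int f v m2 m1))) as [D2|D2];
  [|destruct (Rle_dec (Cmod (tri_int f u v w)) (4 * Cmod (tri_int f w m3 m2))) as [D3|D3]]].
  - exists u, m1, m3. repeat split; auto; destruct H as (S1 & S2 & S3).
    + apply (P v u); auto. rewrite <- DD, M1. ring.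
    + apply (P w v); auto. rewrite <- DD, M1, M3. ring.
    + apply (P u w); auto. rewrite <- DD, M3. ring.
    + replace (u - u)%C with (RtoC 0) by ring. rewrite Cmod_0.
      assert (X := Cmod_ge_0 (v - u)%C). lra.
  - exists v, m2, m1. repeat split; auto; destruct H as (S1 & S2 & S3); auto.
    + apply (P w v); auto. rewrite <- DD, M2. ring.
    + apply (P u w); auto. rewrite <- DD, M1, M2. ring.
    + apply (P v u); auto. rewrite <- DD, M1. ring.
  - exists w, m3, m2. repeat split; auto; destruct H as (S1 & S2 & S3).
    + apply (P u w); auto. rewrite <- DD, M3. ring.
    + apply (P v u); auto. rewrite <- DD, M2, M3. ring.
    + apply (P w v); auto. rewrite <- DD, M2. ring.
    + rewrite Cmod_sym. auto.
  - exists m1, m2, m3. repeat split; auto; try destruct H as (S1 & S2 & S3).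
    + apply (P w u); [rewrite Cmod_sym; auto|]. rewrite <- DD, M1, M2. ring.
    + apply (P u v); [rewrite Cmod_sym; auto|]. rewrite <- DD, M3, M2. ring.
    + apply (P v w); [rewrite Cmod_sym; auto|]. rewrite <- DD, M1, M3. ring.
    + assert (Cmod (m1 - u)%C <= L / 2).
      { apply (P v u); auto. rewrite <- DD, M1. ring. }
      assert (X := Cmod_ge_0 (v - u)%C). lra.
    + lra.
Qed.

Lemma pow2_small (K eps : R) : 0 <= K -> 0 < eps ->
  exists N, forall n, (N <= n)%nat -> K / 2 ^ n < eps.
Proof.
  intros HK He. destruct (pow_lt_1_zero (1 / 2)) with (y := eps / (K + 1)) as [N HN].
  - rewrite Rabs_pos_eq; lra.
  - apply Rdiv_lt_0_compat; lra.
  - exists N. intros n Hn. specialize (HN n Hn).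
    assert (P2 : 0 < 2 ^ n) by (apply pow_lt; lra).
    rewrite Rabs_pos_eq in HN by (apply pow_le; lra).
    unfold Rdiv at 1 in HN. rewrite Rmult_1_l, pow_inv in HN.
    unfold Rdiv. apply Rle_lt_trans with ((K + 1) * / 2 ^ n).
    + apply Rmult_le_compat_r; [left; apply Rinv_0_lt_compat, P2|lra].
    + apply Rmult_lt_compat_l with (r := K + 1) in HN; [|lra].
      replace ((K + 1) * (eps / (K + 1))) with eps in HN by (field; lra). exact HN.
Qed.

(** The explicit rate of convergence locates every triangle of the bisection
    close to the limit. *)
Lemma geometric_limit (z : nat -> C) (L : R) :
  (forall n, Cmod (z (S n) - z n)%C <= L / 2 ^ n) ->
  exists z0, forall n, Cmod (z n - z0)%C <= 2 * L / 2 ^ n.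
Proof.
  intros H.
  assert (P2 : forall n, 0 < 2 ^ n) by (intros; apply pow_lt; lra).
  assert (T : forall n k, Cmod (z (n + k)%nat - z n)%C <= 2 * L / 2 ^ n - 2 * L / 2 ^ (n + k)).
  { intros n k; induction k.
    - rewrite Nat.add_0_r. replace (z n - z n)%C with (RtoC 0) by ring. rewrite Cmod_0. lra.
    - replace (z (n + S k)%nat - z n)%C with ((z (S (n + k))%nat - z (n + k)%nat) + (z (n + k)%nat - z n))%C
        by (rewrite Nat.add_succ_r; ring).
      norm_split.
      specialize (H (n + k)%nat). rewrite Nat.add_succ_r. simpl pow at 2.
      replace (2 * L / (2 * 2 ^ (n + k))) with (L / 2 ^ (n + k)) by (field; apply Rgt_not_eq, P2).
      replace (2 * L / 2 ^ (n + k)) with (2 * (L / 2 ^ (n + k))) in IHk by (field; apply Rgt_not_eq, P2).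
      lra. }
  assert (HL : 0 <= L).
  { specialize (H 0%nat). simpl in H. assert (X := Cmod_ge_0 (z 1%nat - z 0%nat)%C). lra. }
  assert (B : forall n k, Cmod (z (n + k)%nat - z n)%C <= 2 * L / 2 ^ n).
  { intros n k. assert (0 <= 2 * L / 2 ^ (n + k)) by (apply Rdiv_le_0_compat; [lra|apply P2]).
    specialize (T n k). lra. }
  assert (Cau : forall (g : C -> R), (forall c, Rabs (g c) <= Cmod c) -> 
     (forall a b, g (a - b)%C = g a - g b) -> {l : R | Un_cv (fun n => g (z n)) l}).
  { intros g Hg1 Hg2. apply Rcomplete.R_complete. intros eps He.
    destruct (pow2_small (2 * L) (eps / 2)) as [N HN]; [lra|lra|]. exists N. intros n m Hn Hm. unfold Rdist.
    assert (Q : forall n, (N <= n)%nat -> Rabs (g (z n) - g (z N)) < eps / 2).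
    { intros k Hk. rewrite <- Hg2. eapply Rle_lt_trans; [apply Hg1|].
      replace k with (N + (k - N))%nat by lia. eapply Rle_lt_trans; [apply B|]. now apply HN. }
    assert (Q1 := Q n Hn). assert (Q2 := Q m Hm).
    replace (g (z n) - g (z m)) with ((g (z n) - g (z N)) - (g (z m) - g (z N))) by ring.
    eapply Rle_lt_trans; [apply Rabs_triang|]. rewrite Rabs_Ropp. lra. }
  destruct (Cau fst) as [x Hx].
  { intros c. eapply Rle_trans; [apply Rmax_l|apply Rmax_Cmod]. }
  { intros [a1 a2] [b1 b2]. simpl. ring. }
  destruct (Cau snd) as [y Hy].
  { intros c. eapply Rle_trans; [apply Rmax_r|apply Rmax_Cmod]. }
  { intros [a1 a2] [b1 b2]. simpl. ring. }
  exists (x, y). intros n. apply le_epsilon. intros eps He.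
  destruct (Hx (eps / 2)) as [N1 H1]; [lra|]. destruct (Hy (eps / 2)) as [N2 H2]; [lra|].
  set (k := (n + (N1 + N2))%nat).
  specialize (H1 k ltac:(lia)). specialize (H2 k ltac:(lia)). unfold Rdist in *.
  replace (z n - (x, y))%C with (- (z k - z n) + (z k - (x, y)))%C by ring.
  norm_split. rewrite Cmod_opp.
  assert (Cmod (z k - (x, y))%C <= eps).
  { replace (z k - (x, y))%C with (RtoC (fst (z k) - x) + Ci * RtoC (snd (z k) - y))%C.
    - norm_split. rewrite Cmod_mult, Cmod_Ci, !Cmod_R. lra.
    - destruct (z k). unfold RtoC, Cminus, Cplus, Copp, Cmult, Ci; simpl. f_equal; ring. }
  specialize (B n (N1 + N2)%nat). fold k in B. lra.
Qed.

Lemma is_derive_affine_primitive (a l z0 z : C) :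
  is_derive (fun u => a * u + l * (RtoC (1 / 2) * ((u - z0) * (u - z0))))%C z
    (a + l * (z - z0))%C.
Proof.
  assert (D : is_derive (fun u => u - z0)%C z (RtoC 1 - RtoC 0)%C).
  { eapply is_derive_C_minus; [apply is_derive_C_id|apply is_derive_C_const]. }
  assert (D2 := is_derive_C_mult D D).
  assert (D3 := is_derive_C_mult (is_derive_C_const (RtoC (1/2)) z) D2).
  assert (D4 := is_derive_C_mult (is_derive_C_const l z) D3).
  assert (D5 := is_derive_C_mult (is_derive_C_const a z) (is_derive_C_id z)).
  assert (D6 := is_derive_C_plus D5 D4).
  cbv beta in D6.
  replace (a + l * (z - z0))%C with (RtoC 0 * z + a * RtoC 1 + (RtoC 0 * (RtoC (1 / 2) * ((z - z0) * (z - z0))) + l * (RtoC 0 * ((z - z0) * (z - z0)) + RtoC (1 / 2) * ((RtoC 1 - RtoC 0) * (z - z0) + (z - z0) * (RtoC 1 - RtoC 0)))))%C.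
  exact D6.
  replace (RtoC 0 * z + a * RtoC 1 + _)%C with (a + l * ((RtoC (1/2) + RtoC (1/2)) * (z - z0)))%C by ring.
  rewrite RtoC_half2. ring.
Qed.

Lemma affine_continuous (a l z0 z : C) : continuous (fun u => a + l * (u - z0))%C z.
Proof.
  eapply is_derive_C_continuous.
  exact (is_derive_C_plus (is_derive_C_const a z) (is_derive_C_mult (is_derive_C_const l z)
    (is_derive_C_minus (is_derive_C_id z) (is_derive_C_const z0 z)))).
Qed.

(** Affine functions have primitives, so they contribute nothing to the integral
    over a closed triangle, and only the error of the linear approximation at z0
    remains; it is of the order of eps L on edges of length L. *)
Lemma tri_int_affine_bound f (z0 l u v w : C) (L eps : R) : 0 <= L -> 0 <= eps ->
  cont_on_seg f u v -> cont_on_seg f v w -> cont_on_seg f w u ->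
  small_tri L u v w -> Cmod (u - z0)%C <= 2 * L ->
  (forall z, Cmod (z - z0)%C <= 4 * L ->
     Cmod (f z - f z0 - l * (z - z0))%C <= eps * Cmod (z - z0)%C) ->
  Cmod (tri_int f u v w) <= 12 * eps * (L * L).
Proof.
  intros HL He C1 C2 C3 (S1 & S2 & S3) Hu Hf.
  set (A := (fun z => f z0 * z + l * (RtoC (1 / 2) * ((z - z0) * (z - z0))))%C).
  set (a := (fun z => f z0 + l * (z - z0))%C).
  assert (HA : forall z, is_derive A z (a z)) by (intros; apply is_derive_affine_primitive).
  assert (Ha : forall x y, cont_on_seg a x y).
  { intros x y t _. apply affine_continuous. }
  assert (B : forall x y, cont_on_seg f x y -> Cmod (x - z0)%C <= 3 * L -> Cmod (y - x)%C <= L ->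
     Cmod (seg_int f x y - (A y - A x))%C <= 4 * eps * L * L).
  { intros x y Hc Hx Hy.
    rewrite <- (seg_int_FTC A a) by (auto; intros; apply HA).
    rewrite <- seg_int_minus by auto.
    eapply Rle_trans; [apply seg_int_bound with (M := 4 * eps * L)|].
    - intros t Ht.
      apply continuous_C_minus; [now apply Hc|now apply (Ha x y)].
    - intros t Ht. assert (D := line_dist x y z0 t Ht).
      unfold a. replace (f (line x y t) - (f z0 + l * (line x y t - z0)))%C with
        (f (line x y t) - f z0 - l * (line x y t - z0))%C by ring.
      eapply Rle_trans; [apply Hf; lra|].
      replace (4 * eps * L) with (eps * (4 * L)) by ring. apply Rmult_le_compat_l; lra.
    - apply Rmult_le_compat_l; [|lra]. nra. }
  assert (Hv : Cmod (v - z0)%C <= 3 * L).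
  { replace (v - z0)%C with ((v - u) + (u - z0))%C by ring.
    norm_split. lra. }
  assert (Hw : Cmod (w - z0)%C <= 3 * L).
  { replace (w - z0)%C with (- (u - w) + (u - z0))%C by ring.
    norm_split. rewrite Cmod_opp. lra. }
  replace (tri_int f u v w) with ((seg_int f u v - (A v - A u)) + ((seg_int f v w - (A w - A v)) + (seg_int f w u - (A u - A w))))%C
    by (unfold tri_int; ring).
  assert (B1 := B u v C1 ltac:(lra) S1). assert (B2 := B v w C2 Hv S2). assert (B3 := B w u C3 Hw S3).
  norm_split.
  eapply Rle_trans; [apply Rplus_le_compat_l, Cmod_triangle|]. lra.
Qed.

Lemma holomorphic_continuous {rho : R} {f : C -> C} {z : C} :
  holomorphic_on_disc rho f -> Cmod z < rho -> continuous f z.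
Proof. intros Hf Hz. destruct (Hf z Hz) as [l Hl]. now apply is_derive_C_continuous with l. Qed.

(** After n bisections the integral has lost at most a factor 4^n, while
    differentiability at the limit point bounds it by eps (L / 2^n)^2; the two
    powers cancel and eps is arbitrary. *)
Theorem goursat (rho : R) (f : C -> C) (u v w : C) :
  holomorphic_on_disc rho f -> Cmod u < rho -> Cmod v < rho -> Cmod w < rho ->
  tri_int f u v w = RtoC 0.
Proof.
  intros Hf Hu Hv Hw.
  set (r := Rmax (Cmod u) (Rmax (Cmod v) (Cmod w))).
  assert (Hr : r < rho) by (repeat apply Rmax_lub_lt; assumption).
  assert (Hcont : forall z, Cmod z <= r -> continuous f z).
  { intros z Hz. apply (holomorphic_continuous Hf). lra. }
  pose (disc := fun x : C * C * C => Cmod (fst (fst x)) <= r /\ Cmod (snd (fst x)) <= r /\ Cmod (snd x) <= r).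
  pose (T := fun x : C * C * C => Cmod (tri_int f (fst (fst x)) (snd (fst x)) (snd x))).
  pose (sm := fun L (x : C * C * C) => small_tri L (fst (fst x)) (snd (fst x)) (snd x)).
  assert (N : forall x, exists x', disc x -> disc x' /\
     (forall L, sm L x -> sm (L / 2) x' /\ Cmod (fst (fst x') - fst (fst x))%C <= L) /\ T x <= 4 * T x').
  { intros [[a b] c]. destruct (classic (disc (a, b, c))) as [D|D].
    - destruct D as (D1 & D2 & D3).
      destruct (tri_int_step f r Hcont a b c D1 D2 D3) as (a' & b' & c' & Q).
      exists (a', b', c'). intros _. exact Q.
    - (* Triangles outside the disc are never reached. *)
      exists (a, b, c). intros; contradiction. }
  pose (next := fun x => proj1_sig (constructive_indefinite_description _ (N x))).
  assert (Hnext : forall x, disc x -> disc (next x) /\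
     (forall L, sm L x -> sm (L / 2) (next x) /\ Cmod (fst (fst (next x)) - fst (fst x))%C <= L) /\ T x <= 4 * T (next x)).
  { intros x. unfold next. exact (proj2_sig (constructive_indefinite_description _ (N x))). }
  pose (x := fun n => Nat.iter n next (u, v, w)).
  pose (L := Cmod (v - u)%C + Cmod (w - v)%C + Cmod (u - w)%C).
  assert (HL : 0 <= L).
  { unfold L. assert (A1 := Cmod_ge_0 (v - u)%C). assert (A2 := Cmod_ge_0 (w - v)%C).
    assert (A3 := Cmod_ge_0 (u - w)%C). lra. }
  assert (P2 : forall n, 0 < 2 ^ n) by (intros; apply pow_lt; lra).
  assert (X : forall n, disc (x n) /\ sm (L / 2 ^ n) (x n) /\ T (u, v, w) <= 4 ^ n * T (x n)).
  { induction n as [|n (I1 & I2 & I3)].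
    - simpl. split; [|split; [|lra]].
      + unfold disc, r. simpl. split; [apply Rmax_l|].
        split; (eapply Rle_trans; [|apply Rmax_r]); [apply Rmax_l|apply Rmax_r].
      + unfold sm, small_tri, L. simpl.
        assert (A1 := Cmod_ge_0 (v - u)%C). assert (A2 := Cmod_ge_0 (w - v)%C).
        assert (A3 := Cmod_ge_0 (u - w)%C). lra.
    - destruct (Hnext (x n) I1) as (J1 & J2 & J3). change (x (S n)) with (next (x n)).
      split; [exact J1|]. split.
      + replace (L / 2 ^ S n) with (L / 2 ^ n / 2) by (simpl; field; apply Rgt_not_eq, P2).
        now apply J2.
      + simpl. assert (0 < 4 ^ n) by (apply pow_lt; lra). nra. }
  destruct (geometric_limit (fun n => fst (fst (x n))) L) as [z0 Hz0].
  { intros n. destruct (X n) as (I1 & I2 & I3). destruct (Hnext (x n) I1) as (J1 & J2 & J3).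
    now apply J2. }
  assert (Hz0r : Cmod z0 <= r).
  { apply le_epsilon. intros eps He. destruct (pow2_small (2 * L) eps) as [n Hn]; [lra|assumption|].
    specialize (Hn n (le_n n)).
    destruct (X n) as ((I1 & _) & _).
    specialize (Hz0 n). simpl in Hz0.
    replace z0 with (fst (fst (x n)) - (fst (fst (x n)) - z0))%C by ring.
    norm_split. rewrite Cmod_opp. lra. }
  destruct (Hf z0) as [l Hl]; [lra|].
  apply Cmod_eq_0. apply Rle_antisym; [|apply Cmod_ge_0].
  apply le_epsilon. intros eps He. rewrite Rplus_0_l.
  set (e1 := eps / (12 * (L * L) + 1)).
  assert (He1 : 0 < e1) by (apply Rdiv_lt_0_compat; nra).
  destruct (proj1 (is_derive_C_eps f z0 l) Hl e1 He1) as [d [Hd Hd']].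
  destruct (pow2_small (4 * L) d) as [n Hn]; [lra|assumption|].
  specialize (Hn n (le_n n)).
  destruct (X n) as ((I1 & I1' & I1'') & I2 & I3).
  specialize (Hz0 n). simpl in Hz0.
  assert (SC : forall a b, Cmod a <= r -> Cmod b <= r -> cont_on_seg f a b).
  { intros a b Ha Hb t Ht. apply Hcont. now apply line_disc. }
  assert (Q : T (x n) <= 12 * e1 * (L / 2 ^ n * (L / 2 ^ n))).
  { unfold T. apply tri_int_affine_bound with z0 l; auto.
    - apply Rdiv_le_0_compat; auto.
    - lra.
    - lra.
    - intros z Hz. apply Hd'. lra. }
  assert (E4 : 4 ^ n = 2 ^ n * 2 ^ n).
  { rewrite <- Rpow_mult_distr. now replace (2 * 2) with 4 by lra. }
  change (T (u, v, w) <= eps).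
  assert (0 < 4 ^ n) by (apply pow_lt; lra).
  apply Rle_trans with (4 ^ n * (12 * e1 * (L / 2 ^ n * (L / 2 ^ n)))).
  { eapply Rle_trans; [exact I3|]. apply Rmult_le_compat_l; lra. }
  rewrite E4. replace (_ * _) with (e1 * (12 * (L * L))).
  - unfold e1. apply Rmult_le_reg_r with (12 * (L * L) + 1); [nra|].
    replace (eps / (12 * (L * L) + 1) * (12 * (L * L)) * (12 * (L * L) + 1)) with (eps * (12 * (L * L))) by (field; nra).
    nra.
  - field. apply Rgt_not_eq, P2.
Qed.

(** Goursat's theorem makes the integral from 0 to z additive along triangles,
    so its increment from z to u is the integral over the segment [z, u], on
    which f is almost constant. *)
Theorem holomorphic_primitive (rho : R) (f : C -> C) :
  holomorphic_on_disc rho f ->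
  exists P : C -> C, P (RtoC 0) = RtoC 0 /\
    forall z, Cmod z < rho -> is_derive P z (f z).
Proof.
  intros Hf. exists (seg_int f (RtoC 0)). split.
  { unfold seg_int. ring. }
  intros z Hz.
  assert (Hc := fun u => holomorphic_continuous (z := u) Hf).
  assert (H0 : Cmod (RtoC 0) < rho).
  { rewrite Cmod_0. assert (X := Cmod_ge_0 z). lra. }
  assert (SC : forall a b, Cmod a < rho -> Cmod b < rho -> cont_on_seg f a b).
  { intros a b Ha Hb t Ht. apply Hc.
    eapply Rle_lt_trans; [apply (line_disc a b t (Rmax (Cmod a) (Cmod b)))|]; auto.
    - apply Rmax_l.
    - apply Rmax_r.
    - now apply Rmax_lub_lt. }
  apply is_derive_C_eps. intros eps He.
  destruct (proj1 (continuous_C_eps f z) (Hc z Hz) eps He) as [d [Hd Hd']].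
  exists (Rmin d (rho - Cmod z)). split; [apply Rmin_glb_lt; lra|].
  intros u Hu.
  assert (Hu1 := Rlt_le_trans _ _ _ Hu (Rmin_l _ _)).
  assert (Hu2 := Rlt_le_trans _ _ _ Hu (Rmin_r _ _)).
  assert (Hur : Cmod u < rho).
  { assert (Y := Cmod_le_add u z). lra. }
  assert (G := goursat rho f (RtoC 0) z u Hf H0 Hz Hur).
  unfold tri_int in G. rewrite (seg_int_rev f (RtoC 0) u) in G by auto.
  replace (seg_int f (RtoC 0) u - seg_int f (RtoC 0) z)%C with (seg_int f z u).
  2:{ replace (seg_int f z u) with ((seg_int f 0 z + seg_int f z u + - seg_int f 0 u) + seg_int f 0 u - seg_int f 0 z)%C by ring.
      rewrite G. ring. }
  assert (E : (f z * (u - z))%C = seg_int (fun _ => f z) z u).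
  { unfold seg_int. rewrite Cint_const. replace (1 - 0) with 1 by ring. ring. }
  rewrite E, <- seg_int_minus; [|now apply SC|intros t _; apply continuous_const].
  apply seg_int_bound.
  - intros t Ht.
    apply continuous_C_minus; [now apply SC|apply continuous_const].
  - intros t Ht. left. apply Hd'. unfold line.
    replace (z + RtoC t * (u - z) - z)%C with (RtoC t * (u - z))%C by ring.
    rewrite Cmod_mult, Cmod_R, Rabs_pos_eq by lra. assert (X := Cmod_ge_0 (u - z)%C). nra.
Qed.

(** * Power series *)

Fixpoint partial_sum (u : nat -> C) (N : nat) : C :=
  match N with O => RtoC 0 | S n => (partial_sum u n + u n)%C end.

Lemma partial_sum_sum_n (u : nat -> C) (n : nat) : sum_n u n = partial_sum u (S n).
Proof.
  induction n.
  - rewrite sum_O. simpl. ring.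
  - rewrite sum_Sn, IHn. reflexivity.
Qed.

Notation Cseries := (is_series (V := C_NormedModule)).

Lemma is_series_C_eps (u : nat -> C) (s : C) :
  Cseries u s <->
  forall eps, 0 < eps -> exists N, forall n, (N <= n)%nat -> Cmod (partial_sum u n - s)%C < eps.
Proof.
  split.
  - intros H eps He.
    assert (H1 : locally (T := C_UniformSpace) s (fun v => Cmod (v - s)%C < eps)).
    { apply (locally_C s). exists (mkposreal eps He). now intros y Hy. }
    destruct (H _ H1) as [N HN]. exists (S N). intros n Hn.
    destruct n as [|n]; [lia|]. rewrite <- partial_sum_sum_n. apply HN. lia.
  - intros H P HP. apply (locally_C s) in HP. destruct HP as [e He].
    destruct (H e (cond_pos e)) as [N HN]. exists N. intros n Hn. apply He.
    rewrite partial_sum_sum_n. apply HN. lia.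
Qed.

Lemma is_series_C_unique (u : nat -> C) (s t : C) :
  Cseries u s -> Cseries u t -> s = t.
Proof.
  rewrite !is_series_C_eps. intros Hs Ht.
  assert (E : (s - t)%C = RtoC 0).
  { apply Cmod_eq_0. apply Rle_antisym; [|apply Cmod_ge_0]. apply le_epsilon. intros eps He.
    destruct (Hs (eps / 2)) as [N1 H1]; [lra|]. destruct (Ht (eps / 2)) as [N2 H2]; [lra|].
    specialize (H1 (N1 + N2)%nat ltac:(lia)). specialize (H2 (N1 + N2)%nat ltac:(lia)).
    replace (s - t)%C with (- (partial_sum u (N1 + N2) - s) + (partial_sum u (N1 + N2) - t))%C by ring.
    norm_split. rewrite Cmod_opp. lra. }
  now apply Csub_0_eq.
Qed.

Lemma partial_sum_S_l u n : partial_sum u (S n) = (u 0%nat + partial_sum (fun k => u (S k)) n)%C.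
Proof.
  induction n.
  - simpl. ring.
  - change (partial_sum u (S (S n))) with (partial_sum u (S n) + u (S n))%C. rewrite IHn. simpl. ring.
Qed.

Lemma is_series_C_shift (u : nat -> C) (s : C) :
  Cseries (fun n => u (S n)) s <->
  Cseries u (u 0%nat + s)%C.
Proof.
  rewrite !is_series_C_eps. split; intros H eps He; destruct (H eps He) as [N HN].
  - exists (S N). intros [|n] Hn; [lia|]. rewrite partial_sum_S_l.
    replace (u 0%nat + partial_sum (fun k => u (S k)) n - (u 0%nat + s))%C with
      (partial_sum (fun k => u (S k)) n - s)%C by ring. apply HN. lia.
  - exists N. intros n Hn. specialize (HN (S n) ltac:(lia)). rewrite partial_sum_S_l in HN.
    replace (u 0%nat + partial_sum (fun k => u (S k)) n - (u 0%nat + s))%C with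
      (partial_sum (fun k => u (S k)) n - s)%C in HN by ring. exact HN.
Qed.

Lemma is_series_C_plus (u v : nat -> C) (s t : C) : Cseries u s ->
  Cseries v t ->
  Cseries (fun n => u n + v n)%C (s + t)%C.
Proof. intros H1 H2. exact (is_series_plus (V := C_NormedModule) u v s t H1 H2). Qed.

Lemma is_series_C_minus (u v : nat -> C) (s t : C) : Cseries u s ->
  Cseries v t ->
  Cseries (fun n => u n - v n)%C (s - t)%C.
Proof. intros H1 H2. exact (is_series_minus (V := C_NormedModule) u v s t H1 H2). Qed.

Lemma is_series_C_scal (c : C) (u : nat -> C) (s : C) : Cseries u s ->
  Cseries (fun n => c * u n)%C (c * s)%C.
Proof. intros H1. exact (is_series_scal (V := C_NormedModule) c u s H1). Qed.

Lemma is_series_C_ext (u v : nat -> C) (s : C) : (forall n, u n = v n) -> Cseries u s ->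
  Cseries v s.
Proof. apply is_series_ext. Qed.

Lemma is_series_C_bounded (u : nat -> C) (s : C) :
  Cseries u s -> exists M, 0 < M /\ forall n, Cmod (u n) <= M.
Proof.
  rewrite is_series_C_eps. intros H. destruct (H 1 Rlt_0_1) as [N HN].
  assert (F : forall k, exists M, 0 < M /\ forall n, (n < k)%nat -> Cmod (u n) <= M).
  { induction k as [|k [M [HM IH]]].
    - exists 1. split; [lra|]. intros; lia.
    - exists (Rmax M (Cmod (u k))). split; [eapply Rlt_le_trans; [apply HM|apply Rmax_l]|].
      intros n Hn. destruct (Nat.eq_dec n k) as [->|Hk]; [apply Rmax_r|].
      eapply Rle_trans; [apply IH; lia|apply Rmax_l]. }
  destruct (F N) as [M [HM HF]]. exists (Rmax M 2).
  split; [eapply Rlt_le_trans; [apply HM|apply Rmax_l]|].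
  intros n. destruct (Nat.lt_ge_cases n N) as [Hn|Hn].
  - eapply Rle_trans; [now apply HF|apply Rmax_l].
  - eapply Rle_trans; [|apply Rmax_r].
    assert (H1 := HN n Hn). assert (H2 := HN (S n) ltac:(lia)). simpl in H2.
    replace (u n) with ((partial_sum u n + u n - s) - (partial_sum u n - s))%C by ring.
    norm_split. rewrite Cmod_opp. lra.
Qed.

Lemma is_series_C_le (u : nat -> C) (b : nat -> R) (s : C) :
  Cseries u s -> (forall n, Cmod (u n) <= b n) -> ex_series b ->
  Cmod s <= Series b.
Proof.
  intros Hu Hb Hs. apply le_epsilon. intros eps He.
  destruct (proj1 (is_series_C_eps u s) Hu eps He) as [N HN].
  specialize (HN (S N) ltac:(lia)).
  assert (B : forall n, Cmod (partial_sum u (S n)) <= sum_n b n).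
  { induction n.
    - rewrite sum_O. simpl. rewrite Cplus_0_l. apply Hb.
    - rewrite sum_Sn. change (partial_sum u (S (S n))) with (partial_sum u (S n) + u (S n))%C.
      norm_split. apply Rplus_le_compat; auto. }
  assert (L : sum_n b N <= Series b).
  { apply (is_lim_seq_incr_compare (sum_n b) (Series b)).
    - apply Series_correct, Hs.
    - intros n. rewrite sum_Sn. unfold plus; simpl.
      assert (0 <= b (S n)) by (eapply Rle_trans; [apply Cmod_ge_0|apply Hb]). lra. }
  specialize (B N).
  replace s with (partial_sum u (S N) - (partial_sum u (S N) - s))%C by ring.
  norm_split. rewrite Cmod_opp. lra.
Qed.

Lemma ex_series_C_le (u : nat -> C) (b : nat -> R) :
  (forall n, Cmod (u n) <= b n) -> ex_series b -> exists s, Cseries u s.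
Proof.
  intros Hb Hs. exact (ex_series_le (V := C_CompleteNormedModule) u b Hb Hs).
Qed.

(** The majorant of the series of second-order remainders in termwise
    differentiation. *)
Lemma ex_series_sq_geom (q : R) : 0 < q < 1 ->
  ex_series (fun n => INR (S n) ^ 2 * q ^ n).
Proof.
  intros Hq.
  assert (Hp : forall n, 0 < INR (S n) ^ 2 * q ^ n).
  { intros n. apply Rmult_lt_0_compat; apply pow_lt; [|lra]. apply lt_0_INR. lia. }
  apply ex_series_ext with (fun n => Rabs (INR (S n) ^ 2 * q ^ n)).
  { intros n. apply Rabs_pos_eq. left; apply Hp. }
  apply ex_series_DAlembert with q.
  - lra.
  - intros n. apply Rgt_not_eq, Hp.
  - apply is_lim_seq_ext with (fun n => (1 + / INR (S n)) * ((1 + / INR (S n)) * q)).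
    + intros n. assert (0 < INR (S n)) by (apply lt_0_INR; lia).
      assert (0 < q ^ n) by (apply pow_lt; lra).
      rewrite Rabs_pos_eq.
      * rewrite (S_INR (S n)). set (x := INR (S n)) in *. change (q ^ S n) with (q * q ^ n). field. split; apply Rgt_not_eq; assumption.
      * left. apply Rdiv_lt_0_compat; apply Hp.
    + assert (L : is_lim_seq (fun n => 1 + / INR (S n)) 1).
      { replace 1 with (1 + 0) at 1 by ring.
        apply (is_lim_seq_plus' _ _ 1 0); [apply is_lim_seq_const|].
        assert (Q := is_lim_seq_inv (fun n => INR (S n)) p_infty).
        apply Q; [|discriminate]. apply (is_lim_seq_incr_1 INR). apply is_lim_seq_INR. }
      replace q with (1 * (1 * q)) at 1 by ring.
      apply is_lim_seq_mult'; [assumption|]. apply is_lim_seq_mult'; [assumption|].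
      apply is_lim_seq_const.
Qed.

Definition is_powser (rho : R) (a : nat -> C) (f : C -> C) : Prop :=
  forall z, Cmod z < rho -> Cseries (fun n => a n * z ^ n)%C (f z).

Lemma is_powser_bound rho a f r : is_powser rho a f -> 0 <= r < rho ->
  exists M, 0 < M /\ forall n, Cmod (a n) * r ^ n <= M.
Proof.
  intros Ha Hr. destruct (is_series_C_bounded _ _ (Ha (RtoC r) ltac:(rewrite Cmod_R, Rabs_pos_eq; lra))) as [M [HM H]].
  exists M. split; [exact HM|]. intros n. specialize (H n).
  rewrite Cmod_mult, Cmod_pow, Cmod_R, Rabs_pos_eq in H by lra. exact H.
Qed.

(** Stated with r^2 on the left so that no exponent n - 2 occurs. *)
Lemma pow_remainder (u z : C) (r : R) (n : nat) : Cmod u <= r -> Cmod z <= r ->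
  Cmod (u ^ n - z ^ n - RtoC (INR n) * z ^ (pred n) * (u - z))%C * r ^ 2
   <= INR n ^ 2 * r ^ n * Cmod (u - z)%C ^ 2.
Proof.
  intros Hu Hz. assert (Hr : 0 <= r) by (eapply Rle_trans; [apply Cmod_ge_0|exact Hu]).
  induction n as [|n IH].
  { simpl. replace (1 - 1 - 0 * 1 * (u - z))%C with (RtoC 0) by ring. rewrite Cmod_0. lra. }
  set (h := Cmod (u - z)%C) in *. assert (Hh : 0 <= h) by apply Cmod_ge_0.
  destruct n as [|n].
  { simpl. replace (u * 1 - z * 1 - 1 * 1 * (u - z))%C with (RtoC 0) by ring. rewrite Cmod_0. nra. }
  set (m := S n) in *.
  replace (u ^ S m - z ^ S m - RtoC (INR (S m)) * z ^ pred (S m) * (u - z))%C with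
    (u * (u ^ m - z ^ m - RtoC (INR m) * z ^ pred m * (u - z)) + RtoC (INR m) * z ^ n * ((u - z) * (u - z)))%C.
  2:{ rewrite (S_INR m), RtoC_plus. unfold m. simpl pred. rewrite !Cpow_S. ring. }
  assert (T : Cmod (u * (u ^ m - z ^ m - RtoC (INR m) * z ^ pred m * (u - z)) + RtoC (INR m) * z ^ n * ((u - z) * (u - z)))%C
     <= r * Cmod (u ^ m - z ^ m - RtoC (INR m) * z ^ pred m * (u - z))%C + INR m * r ^ n * h ^ 2).
  { norm_split. rewrite !Cmod_mult, Cmod_pow, Cmod_R.
    rewrite (Rabs_pos_eq (INR m)) by apply pos_INR.
    apply Rplus_le_compat.
    - apply Rmult_le_compat_r; [apply Cmod_ge_0|assumption].
    - fold h. replace (h * h) with (h ^ 2) by ring. apply Rmult_le_compat_r; [apply pow_le; lra|].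
      apply Rmult_le_compat_l; [apply pos_INR|]. apply pow_incr. split; [apply Cmod_ge_0|assumption]. }
  apply Rmult_le_compat_r with (r := r ^ 2) in T; [|apply pow_le; lra].
  eapply Rle_trans; [exact T|].
  set (D := Cmod (u ^ m - z ^ m - RtoC (INR m) * z ^ pred m * (u - z))%C) in *.
  rewrite Rmult_plus_distr_r, Rmult_assoc.
  apply Rmult_le_compat_l with (r := r) in IH; [|assumption].
  eapply Rle_trans; [apply Rplus_le_compat_r; exact IH|].
  rewrite (S_INR m). change (r ^ S m) with (r * r ^ m).
  replace (r ^ m) with (r * r ^ n) by reflexivity.
  assert (HI := pos_INR m).
  assert (0 <= r * (r * r ^ n) * h ^ 2).
  { apply Rmult_le_pos; [|apply pow_le; lra]. repeat apply Rmult_le_pos; try lra. apply pow_le; lra. }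
  replace (r * (INR m ^ 2 * (r * r ^ n) * h ^ 2) + INR m * r ^ n * h ^ 2 * r ^ 2) with
    ((INR m ^ 2 + INR m) * (r * (r * r ^ n) * h ^ 2)) by ring.
  replace ((INR m + 1) ^ 2 * (r * (r * r ^ n)) * h ^ 2) with ((INR m + 1) ^ 2 * (r * (r * r ^ n) * h ^ 2)) by ring.
  apply Rmult_le_compat_r; [assumption|]. nra.
Qed.

Definition deriv_coef (a : nat -> C) (n : nat) : C := (RtoC (INR (S n)) * a (S n))%C.

(** Termwise differentiation: the remainders of the monomials sum to at most a
    constant times |u - z|^2, because the coefficients are dominated by a
    geometric sequence of ratio 1/R with r < R < rho. *)
Theorem is_powser_derive rho a f z : is_powser rho a f -> Cmod z < rho ->
  exists l, Cseries (fun n => deriv_coef a n * z ^ n)%C l /\ is_derive f z l.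
Proof.
  intros Ha Hz. assert (Hz0 := Cmod_ge_0 z).
  (* |z| < r < R < rho: points near z stay in the disc of radius r, and convergence
     at R bounds the coefficients. *)
  set (r := Cmod z + (rho - Cmod z) / 3). set (R := Cmod z + 2 * (rho - Cmod z) / 3).
  assert (Hr : 0 < r /\ Cmod z < r /\ r < R /\ R < rho) by (unfold r, R; lra).
  destruct (is_powser_bound rho a f R Ha ltac:(lra)) as [M [HM HB]].
  set (q := r / R). assert (Hq : 0 < q < 1).
  { unfold q. split; [apply Rdiv_lt_0_compat; lra|]. apply Rmult_lt_reg_r with R; [lra|].
    unfold Rdiv. rewrite Rmult_assoc, Rinv_l; lra. }
  set (b := fun n => INR (S n) ^ 2 * q ^ n).
  assert (Hbs : ex_series b) by now apply ex_series_sq_geom.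
  assert (Hrq : forall n, r ^ n = q ^ n * R ^ n).
  { intros n. rewrite <- Rpow_mult_distr. f_equal. unfold q. field. lra. }
  assert (Hb0 : forall n, 0 <= q ^ n) by (intros; apply pow_le; lra).
  assert (HR : forall n, 0 < R ^ n) by (intros; apply pow_lt; lra).
  assert (Har : forall n, Cmod (a n) * r ^ n <= M * q ^ n).
  { intros n. rewrite Hrq. specialize (HB n). specialize (Hb0 n).
    replace (Cmod (a n) * (q ^ n * R ^ n)) with (Cmod (a n) * R ^ n * q ^ n) by ring.
    now apply Rmult_le_compat_r. }
  destruct (ex_series_C_le (fun n => deriv_coef a n * z ^ n)%C (fun n => (M / R) * b n)) as [l Hl].
  { intros n. unfold deriv_coef. rewrite !Cmod_mult, Cmod_pow, Cmod_R, (Rabs_pos_eq (INR (S n))) by apply pos_INR.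
    apply Rle_trans with (INR (S n) * Cmod (a (S n)) * r ^ n).
    - apply Rmult_le_compat_l; [|apply pow_incr; lra].
      apply Rmult_le_pos; [apply pos_INR|apply Cmod_ge_0].
    - assert (X : Cmod (a (S n)) * r ^ n <= M / R * q ^ n).
      { rewrite Hrq. specialize (HB (S n)). simpl in HB.
        apply Rmult_le_reg_r with R; [lra|].
        replace (M / R * q ^ n * R) with (M * q ^ n) by (field; lra).
        replace (Cmod (a (S n)) * (q ^ n * R ^ n) * R) with (Cmod (a (S n)) * (R * R ^ n) * q ^ n) by ring.
        now apply Rmult_le_compat_r. }
      assert (1 <= INR (S n)) by (rewrite S_INR; assert (Y := pos_INR n); lra).
      assert (0 <= M / R * q ^ n).
      { apply Rmult_le_pos; [|apply Hb0]. apply Rdiv_le_0_compat; lra. }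
      unfold b. set (i := INR (S n)) in *. set (B := M / R * q ^ n) in *.
      apply Rle_trans with (i * B).
      + rewrite Rmult_assoc. apply Rmult_le_compat_l; lra.
      + replace (M / R * (i ^ 2 * q ^ n)) with (i * i * B) by (unfold B; ring).
        apply Rmult_le_compat_r; nra. }
  { now apply (ex_series_scal_l (V := R_NormedModule)). }
  exists l. split; [exact Hl|].
  (* The series of derivatives with the index of f; for n = 0 the factor INR n
     makes the value of pred 0 irrelevant. *)
  assert (Hl' : Cseries (fun n => a n * (RtoC (INR n) * z ^ pred n))%C l).
  { assert (E : (a 0%nat * (RtoC (INR 0) * z ^ pred 0) + l)%C = l :> C) by (change (INR 0) with 0; ring).
    rewrite <- E.
    apply (is_series_C_shift (fun n => a n * (RtoC (INR n) * z ^ pred n))%C).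
    eapply is_series_C_ext; [|exact Hl]. intros n. unfold deriv_coef. simpl pred. ring. }
  assert (Q : forall u, Cmod u <= r -> Cmod (f u - f z - l * (u - z))%C <= M / r ^ 2 * Series b * Cmod (u - z)%C ^ 2).
  { intros u Hu. assert (Hur : Cmod u < rho) by lra.
    assert (Z := is_series_C_minus _ _ _ _ (is_series_C_minus _ _ _ _ (Ha u Hur) (Ha z Hz))
       (is_series_C_scal (u - z)%C _ _ Hl')).
    replace (l * (u - z))%C with ((u - z) * l)%C by ring.
    replace (M / r ^ 2 * Series b * Cmod (u - z)%C ^ 2) with (Series (fun n => (M / r ^ 2 * Cmod (u - z)%C ^ 2) * b n)).
    2:{ rewrite Series_scal_l. ring. }
    apply (is_series_C_le _ _ _ Z).
    - intros n.
      replace (a n * u ^ n - a n * z ^ n - (u - z) * (a n * (RtoC (INR n) * z ^ pred n)))%C with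
        (a n * (u ^ n - z ^ n - RtoC (INR n) * z ^ (pred n) * (u - z)))%C by ring.
      assert (X := pow_remainder u z r n Hu ltac:(lra)).
      rewrite Cmod_mult. assert (0 < r ^ 2) by (apply pow_lt; lra).
      apply Rmult_le_reg_r with (r ^ 2); [assumption|].
      rewrite Rmult_assoc.
      apply Rle_trans with (Cmod (a n) * (INR n ^ 2 * r ^ n * Cmod (u - z)%C ^ 2)).
      + apply Rmult_le_compat_l; [apply Cmod_ge_0|exact X].
      + replace (M / r ^ 2 * Cmod (u - z)%C ^ 2 * b n * r ^ 2) with (Cmod (u - z)%C ^ 2 * (INR (S n) ^ 2 * (M * q ^ n)))
          by (unfold b; field; lra).
        replace (Cmod (a n) * (INR n ^ 2 * r ^ n * Cmod (u - z)%C ^ 2)) with (Cmod (u - z)%C ^ 2 * (INR n ^ 2 * (Cmod (a n) * r ^ n))) by ring.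
        apply Rmult_le_compat_l; [apply pow_le, Cmod_ge_0|].
        apply Rmult_le_compat.
        * apply pow_le, pos_INR.
        * apply Rmult_le_pos; [apply Cmod_ge_0|apply pow_le; lra].
        * apply pow_incr. split; [apply pos_INR|rewrite S_INR; lra].
        * apply Har.
    - now apply (ex_series_scal_l (V := R_NormedModule)). }
  set (K := M / r ^ 2 * Series b) in *.
  assert (HK : 0 <= K).
  { apply Rmult_le_pos.
    - apply Rdiv_le_0_compat; [lra|apply pow_lt; lra].
    - assert (B0 : forall n, 0 <= b n).
      { intros n. apply Rmult_le_pos; [apply pow_le, pos_INR|apply Hb0]. }
      apply Rle_trans with (sum_n b 0); [rewrite sum_O; apply B0|].
      apply (is_lim_seq_incr_compare (sum_n b) (Series b)); [apply Series_correct, Hbs|].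
      intros n. rewrite sum_Sn. unfold plus; simpl. specialize (B0 (S n)). lra. }
  apply is_derive_C_eps. intros eps He.
  exists (Rmin (r - Cmod z) (eps / (K + 1))).
  split; [apply Rmin_glb_lt; [lra|apply Rdiv_lt_0_compat; lra]|].
  intros u Hu.
  assert (Hu1 := Rlt_le_trans _ _ _ Hu (Rmin_l _ _)).
  assert (Hu2 := Rlt_le_trans _ _ _ Hu (Rmin_r _ _)).
  eapply Rle_trans; [apply Q|].
  - assert (Y := Cmod_le_add u z). lra.
  - assert (H0 := Cmod_ge_0 (u - z)%C).
    assert (X : K * Cmod (u - z)%C <= eps).
    { apply Rmult_lt_compat_l with (r := K + 1) in Hu2; [|lra].
      replace ((K + 1) * (eps / (K + 1))) with eps in Hu2 by (field; lra). nra. }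
    replace (K * Cmod (u - z)%C ^ 2) with ((K * Cmod (u - z)%C) * Cmod (u - z)%C) by ring.
    now apply Rmult_le_compat_r.
Qed.

Lemma is_series_C_first (u : nat -> C) :
  (forall n, u (S n) = RtoC 0) -> Cseries u (u 0%nat).
Proof.
  intros H. apply is_series_C_eps. intros eps He. exists 1%nat. intros [|n] Hn; [lia|].
  replace (partial_sum u (S n) - u 0%nat)%C with (RtoC 0); [now rewrite Cmod_0|].
  clear Hn. induction n.
  - simpl. ring.
  - change (partial_sum u (S (S n))) with (partial_sum u (S n) + u (S n))%C. rewrite H.
    rewrite Cplus_0_r. exact IHn.
Qed.

Lemma is_powser_0 rho a f : 0 < rho -> is_powser rho a f -> f (RtoC 0) = a 0%nat.
Proof.
  intros Hr H. apply (is_series_C_unique (fun n => a n * RtoC 0 ^ n)%C).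
  - apply H. now rewrite Cmod_0.
  - replace (a 0%nat) with (a 0%nat * RtoC 0 ^ 0)%C by (simpl; ring).
    apply (is_series_C_first (fun n => a n * RtoC 0 ^ n)%C). intros n. simpl. ring.
Qed.

Lemma is_powser_shift {rho a f} : 0 < rho -> is_powser rho a f ->
  exists f1, is_powser rho (fun n => a (S n)) f1 /\
    forall z, Cmod z < rho -> f z = (a 0%nat + z * f1 z)%C.
Proof.
  intros Hr H. assert (H0 := is_powser_0 rho a f Hr H).
  exists (fun z => if excluded_middle_informative (z = RtoC 0) then a 1%nat
                   else ((f z - a 0%nat) / z)%C).
  split; intros z Hz; destruct (excluded_middle_informative (z = RtoC 0)) as [Z|Z].
  - subst z. replace (a 1%nat) with (a 1%nat * RtoC 0 ^ 0)%C by (simpl; ring).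
    apply (is_series_C_first (fun n => a (S n) * RtoC 0 ^ n)%C). intros n. simpl. ring.
  - replace ((f z - a 0%nat) / z)%C with (/ z * (f z - a 0%nat))%C by (field; assumption).
    eapply is_series_C_ext; [|apply is_series_C_scal].
    2:{ apply (is_series_C_shift (fun n => a n * z ^ n)%C).
        replace (a 0%nat * z ^ 0 + (f z - a 0%nat))%C with (f z) by (simpl; ring).
        now apply H. }
    intros n. cbv beta. rewrite Cpow_S. field. assumption.
  - subst z. rewrite H0. ring.
  - field. assumption.
Qed.

Lemma is_powser_continuous rho a f z : is_powser rho a f -> Cmod z < rho -> continuous f z.
Proof.
  intros H Hz. destruct (is_powser_derive rho a f z H Hz) as (l & _ & Hl).
  now apply is_derive_C_continuous with l.
Qed.

(** Used at a removable singularity, where two functions are compared off the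
    origin only. *)
Lemma punctured_limit (f g : C -> C) (d : R) : 0 < d ->
  continuous f (RtoC 0) -> continuous g (RtoC 0) ->
  (forall z, 0 < Cmod z < d -> f z = g z) -> f (RtoC 0) = g (RtoC 0).
Proof.
  intros Hd Hf Hg E.
  assert (X : (f (RtoC 0) - g (RtoC 0))%C = RtoC 0).
  { apply Cmod_eq_0. apply Rle_antisym; [|apply Cmod_ge_0]. apply le_epsilon. intros eps He.
    destruct (proj1 (continuous_C_eps _ _) Hf (eps / 2)) as [d1 [Hd1 H1]]; [lra|].
    destruct (proj1 (continuous_C_eps _ _) Hg (eps / 2)) as [d2 [Hd2 H2]]; [lra|].
    set (t := Rmin d (Rmin d1 d2) / 2).
    assert (Ht : 0 < Rmin d (Rmin d1 d2)) by (repeat apply Rmin_glb_lt; assumption).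
    assert (A1 : Rmin d (Rmin d1 d2) <= d) by apply Rmin_l.
    assert (A2 : Rmin d (Rmin d1 d2) <= d1) by (eapply Rle_trans; [apply Rmin_r|apply Rmin_l]).
    assert (A3 : Rmin d (Rmin d1 d2) <= d2) by (eapply Rle_trans; [apply Rmin_r|apply Rmin_r]).
    assert (Hm : Cmod (RtoC t) = t) by (rewrite Cmod_R; apply Rabs_pos_eq; unfold t; lra).
    specialize (H1 (RtoC t)). specialize (H2 (RtoC t)).
    replace (RtoC t - RtoC 0)%C with (RtoC t) in H1, H2 by ring. rewrite Hm in H1, H2.
    assert (Hfg := E (RtoC t) ltac:(rewrite Hm; unfold t; lra)). rewrite <- Hfg in H2.
    specialize (H1 ltac:(unfold t; lra)). specialize (H2 ltac:(unfold t; lra)).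
    replace (f 0 - g 0)%C with (- (f (RtoC t) - f 0) + (f (RtoC t) - g 0))%C by ring.
    norm_split. rewrite Cmod_opp. lra. }
  now apply Csub_0_eq.
Qed.

(** The constant terms agree by continuity; dividing by z reduces the n-th
    coefficient to the previous one, and the quotients agree off the origin
    only, hence the form of the hypothesis. *)
Theorem is_powser_unique rho d a b f g : 0 < rho -> 0 < d ->
  is_powser rho a f -> is_powser rho b g ->
  (forall z, 0 < Cmod z < d -> f z = g z) -> forall n, a n = b n.
Proof.
  intros Hr Hd Ha Hb E n. revert a b f g Ha Hb E. induction n as [|n IH]; intros.
  all: assert (E0 : a 0%nat = b 0%nat) by
    (rewrite <- (is_powser_0 rho a f Hr Ha), <- (is_powser_0 rho b g Hr Hb);
     apply punctured_limit with d; auto;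
      [apply is_powser_continuous with rho a|apply is_powser_continuous with rho b];
      [assumption|now rewrite Cmod_0|assumption|now rewrite Cmod_0]).
  - exact E0.
  - destruct (is_powser_shift Hr Ha) as (f1 & Hf1 & Ef).
    destruct (is_powser_shift Hr Hb) as (g1 & Hg1 & Eg).
    assert (G : is_powser rho (fun n => b (S n)) 
       (fun z => if Rlt_dec (Cmod z) rho then g1 z else f1 z)).
    { intros z Hz. destruct (Rlt_dec (Cmod z) rho); [now apply Hg1|contradiction]. }
    apply (IH (fun n => a (S n)) (fun n => b (S n)) _ _ Hf1 G).
    intros z Hz. destruct (Rlt_dec (Cmod z) rho) as [Hzr|]; [|reflexivity].
    assert (Hz0 : z <> RtoC 0) by (apply Cmod_gt_0; lra).
    assert (X := E z Hz). rewrite Ef, Eg, E0 in X by assumption.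
    replace (f1 z) with (/ z * ((b 0%nat + z * f1 z) - b 0%nat))%C by (field; assumption).
    rewrite X. field. assumption.
Qed.

Lemma is_powser_le rho rho' a f : rho' <= rho -> is_powser rho a f -> is_powser rho' a f.
Proof. intros Hr H z Hz. apply H. lra. Qed.

Lemma is_powser_C_derive {rho a f} : is_powser rho a f ->
  is_powser rho (deriv_coef a) (C_derive f) /\
  forall z, Cmod z < rho -> is_derive f z (C_derive f z).
Proof.
  intros H. split; intros z Hz; destruct (is_powser_derive rho a f z H Hz) as (l & H1 & H2);
  now rewrite (is_C_derive_unique f z l H2).
Qed.

(** * Difference quotients *)

Lemma is_derive_C_ext_loc (f g : C -> C) (z l : C) (d : R) : 0 < d ->
  (forall u, Cmod (u - z)%C < d -> f u = g u) -> is_derive f z l -> is_derive g z l.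
Proof.
  intros Hd E H. apply is_derive_C_eps. intros eps He.
  destruct (proj1 (is_derive_C_eps f z l) H eps He) as [d1 [Hd1 H1]].
  exists (Rmin d d1). split; [now apply Rmin_glb_lt|]. intros u Hu.
  rewrite <- (E u), <- (E z).
  - apply H1. eapply Rlt_le_trans; [exact Hu|apply Rmin_r].
  - replace (z - z)%C with (RtoC 0) by ring. now rewrite Cmod_0.
  - eapply Rlt_le_trans; [exact Hu|apply Rmin_l].
Qed.

Lemma is_derive_C_inv (z : C) : z <> RtoC 0 -> is_derive Cinv z (- / (z * z))%C.
Proof.
  intros Hz. apply is_derive_C_eps. intros eps He.
  assert (Hm : 0 < Cmod z) by now apply Cmod_gt_0.
  set (m := Cmod z) in *.
  exists (Rmin (m / 2) (eps * m ^ 3 / 2)). split.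
  { apply Rmin_glb_lt; [lra|]. assert (0 < m ^ 3) by (apply pow_lt; lra).
    assert (0 < eps * m ^ 3) by (apply Rmult_lt_0_compat; lra). lra. }
  intros u Hu.
  assert (Hu1 := Rlt_le_trans _ _ _ Hu (Rmin_l _ _)).
  assert (Hu2 := Rlt_le_trans _ _ _ Hu (Rmin_r _ _)).
  assert (Hum : m / 2 < Cmod u).
  { assert (X : m <= Cmod u + Cmod (u - z)%C).
    { unfold m. replace z with (u + - (u - z))%C at 1 by ring.
      norm_split. rewrite Cmod_opp. lra. }
    lra. }
  assert (Hu0 : u <> RtoC 0) by (apply Cmod_gt_0; lra).
  replace (/ u - / z - - / (z * z) * (u - z))%C with (/ (u * (z * z)) * ((u - z) * (u - z)))%C
    by (field; auto).
  rewrite !Cmod_mult, Cmod_inv by (repeat apply Cmult_neq_0; assumption).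
  rewrite !Cmod_mult. fold m. set (h := Cmod (u - z)%C) in *.
  assert (Hh : 0 <= h) by apply Cmod_ge_0.
  rewrite <- Rmult_assoc. apply Rmult_le_compat_r; [assumption|].
  assert (Hp : 0 < Cmod u * (m * m)) by (repeat apply Rmult_lt_0_compat; lra).
  apply Rmult_le_reg_l with (Cmod u * (m * m)); [assumption|].
  rewrite <- Rmult_assoc, Rinv_r, Rmult_1_l by lra.
  apply Rle_trans with (m / 2 * (m * m) * eps).
  - simpl in Hu2. nra.
  - apply Rmult_le_compat_r; [lra|]. apply Rmult_le_compat_r; nra.
Qed.

Lemma is_derive_C_div {f g : C -> C} {z lf lg : C} :
  is_derive f z lf -> is_derive g z lg -> g z <> RtoC 0 ->
  is_derive (fun u => f u / g u)%C z ((lf * g z - f z * lg) / (g z * g z))%C.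
Proof.
  intros Hf Hg H0.
  assert (D := is_derive_C_mult Hf (is_derive_C_comp Cinv g z _ _ (is_derive_C_inv _ H0) Hg)).
  replace ((lf * g z - f z * lg) / (g z * g z))%C with (lf * / g z + f z * (- / (g z * g z) * lg))%C
    by (field; assumption).
  exact D.
Qed.

Definition divdiff (P f : C -> C) (z zeta : C) : C :=
  if excluded_middle_informative (zeta = z) then f z else ((P zeta - P z) / (zeta - z))%C.

(** At the point z itself: since P' = f and f is differentiable at z with
    derivative l, P z + f z (u - z) + l/2 (u - z)^2 approximates P to second
    order, so the quotient has the derivative l/2 there. Thus Goursat's theorem
    applies to it without an exceptional point. *)
Lemma divdiff_holomorphic rho P f z :
  (forall u, Cmod u < rho -> is_derive P u (f u)) -> holomorphic_on_disc rho f ->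
  Cmod z < rho -> holomorphic_on_disc rho (divdiff P f z).
Proof.
  intros HP Hf Hz zeta Hzeta.
  destruct (excluded_middle_informative (zeta = z)) as [->|Hne].
  - destruct (Hf z Hz) as [l Hl]. exists (l * RtoC (1 / 2))%C. apply is_derive_C_eps. intros eps He.
    destruct (proj1 (is_derive_C_eps f z l) Hl eps He) as [d [Hd Hd']].
    exists (Rmin d (rho - Cmod z)). split; [apply Rmin_glb_lt; lra|]. intros u Hu.
    assert (Hu1 := Rlt_le_trans _ _ _ Hu (Rmin_l _ _)).
    assert (Hu2 := Rlt_le_trans _ _ _ Hu (Rmin_r _ _)).
    unfold divdiff. destruct (excluded_middle_informative (z = z)) as [_|]; [|easy].
    destruct (excluded_middle_informative (u = z)) as [->|Hu0].
    { replace (f z - f z - l * RtoC (1 / 2) * (z - z))%C with (RtoC 0) by ring. 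
      replace (z - z)%C with (RtoC 0) by ring. rewrite Cmod_0. lra. }
    assert (Hu3 : (u - z)%C <> RtoC 0).
    { intros E. now apply Hu0, Csub_0_eq. }
    assert (Hln : forall t, 0 <= t <= 1 -> Cmod (line z u t - z)%C <= Cmod (u - z)%C).
    { intros t Ht. unfold line. replace (z + RtoC t * (u - z) - z)%C with (RtoC t * (u - z))%C by ring.
      rewrite Cmod_mult, Cmod_R, Rabs_pos_eq by lra. assert (X := Cmod_ge_0 (u - z)%C). nra. }
    assert (Hlr : forall t, 0 <= t <= 1 -> Cmod (line z u t) < rho).
    { intros t Ht. replace (line z u t) with (z + (line z u t - z))%C by ring.
      norm_split. specialize (Hln t Ht). lra. }
    set (A := (fun x => f z * x + l * (RtoC (1 / 2) * ((x - z) * (x - z))))%C).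
    set (a := (fun x => f z + l * (x - z))%C).
    assert (HA : forall x, is_derive (fun x => P x - A x)%C x (f x - a x)%C \/ rho <= Cmod x).
    { intros x. destruct (Rlt_le_dec (Cmod x) rho); [left|now right].
      eapply is_derive_C_minus; [now apply HP|apply is_derive_affine_primitive]. }
    assert (E := seg_int_FTC (fun x => P x - A x)%C (fun x => f x - a x)%C z u).
    assert (Sc : cont_on_seg (fun x => f x - a x)%C z u).
    { intros t Ht. apply continuous_C_minus; [|apply affine_continuous].
      exact (holomorphic_continuous Hf (Hlr t Ht)). }
    specialize (E ltac:(intros t Ht; destruct (HA (line z u t)) as [Q|Q]; [exact Q|specialize (Hlr t Ht); lra]) Sc).
    assert (B : Cmod (seg_int (fun x => f x - a x)%C z u) <= eps * Cmod (u - z)%C * Cmod (u - z)%C).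
    { apply seg_int_bound; [exact Sc|]. intros t Ht. unfold a.
      replace (f (line z u t) - (f z + l * (line z u t - z)))%C with
        (f (line z u t) - f z - l * (line z u t - z))%C by ring.
      specialize (Hln t Ht). eapply Rle_trans; [apply Hd'; lra|]. apply Rmult_le_compat_l; lra. }
    rewrite E in B.
    replace ((P u - P z) / (u - z) - f z - l * RtoC (1 / 2) * (u - z))%C with
      ((P u - A u - (P z - A z)) / (u - z))%C by (unfold A; field; assumption).
    rewrite Cmod_div by assumption.
    assert (H0 : 0 < Cmod (u - z)%C) by now apply Cmod_gt_0.
    apply Rmult_le_reg_r with (Cmod (u - z)%C); [assumption|].
    unfold Rdiv. rewrite Rmult_assoc, Rinv_l, Rmult_1_r by lra. exact B.
  - assert (H0 : (zeta - z)%C <> RtoC 0).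
    { intros E. now apply Hne, Csub_0_eq. }
    eexists.
    apply (is_derive_C_ext_loc (fun u => (P u - P z) / (u - z))%C _ _ _ (Cmod (zeta - z)%C)).
    + now apply Cmod_gt_0.
    + intros u Hu. unfold divdiff. destruct (excluded_middle_informative (u = z)) as [->|]; [|reflexivity].
      rewrite Cmod_sym in Hu. lra.
    + eapply is_derive_C_div; [| |exact H0].
      * eapply is_derive_C_minus; [now apply HP|apply is_derive_C_const].
      * eapply is_derive_C_minus; [apply is_derive_C_id|apply is_derive_C_const].
Qed.

(** * Cauchy's formula on circles and power series expansions *)

Definition circ (r t : R) : C := (RtoC r * (cos t, sin t))%C.

Lemma circ_derive r t :
  curve_derive (circ r) t (Ci * circ r t)%C.
Proof.
  assert (D : curve_derive (fun s => (cos s, sin s) : C) t ((- sin t, cos t) : C)).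
  { apply is_derive_curve_pair; apply is_derive_Reals; [apply derivable_pt_lim_cos|apply derivable_pt_lim_sin]. }
  assert (E := is_derive_curve_comp (fun z => RtoC r * z)%C _ t _ _
    (is_derive_C_mult (is_derive_C_const (RtoC r) _) (is_derive_C_id (cos t, sin t))) D).
  replace (Ci * circ r t)%C with ((RtoC 0 * (cos t, sin t) + RtoC r * RtoC 1) * ((- sin t)%R, cos t))%C.
  - exact E.
  - unfold circ, Cmult, Cplus, RtoC, Ci; simpl. f_equal; ring.
Qed.

Lemma circ_continuous r t : continuous (circ r) t.
Proof.
  apply (ex_derive_continuous (V := C_R_NormedModule)). eexists. apply circ_derive.
Qed.

Lemma circ_mod r t : 0 <= r -> Cmod (circ r t) = r.
Proof.
  intros Hr. unfold circ. rewrite Cmod_mult, Cmod_R, Rabs_pos_eq by assumption.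
  unfold Cmod; simpl. replace (cos t * (cos t * 1) + sin t * (sin t * 1)) with 1.
  - rewrite sqrt_1. ring.
  - assert (H := sin2_cos2 t). unfold Rsqr in H. lra.
Qed.

(** With z = r e^(i t), the integrand is -i times the derivative of t |-> H z
    for a primitive H of h. *)
Lemma circle_integral_0 rho h r : holomorphic_on_disc rho h -> 0 <= r < rho ->
  Cint (fun t => circ r t * h (circ r t))%C 0 (2 * PI) = RtoC 0.
Proof.
  intros Hh Hr. destruct (holomorphic_primitive rho h Hh) as (H & _ & HH).
  assert (Hp := PI_RGT_0).
  assert (Hm : forall t, Cmod (circ r t) < rho) by (intros; rewrite circ_mod; lra).
  assert (Hc : cont_on (fun t => circ r t * h (circ r t))%C 0 (2 * PI)).
  { intros t _. apply continuous_RC_mult; [apply circ_continuous|].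
    apply continuous_RC_comp; [apply circ_continuous|].
    exact (holomorphic_continuous Hh (Hm t)). }
  assert (E : Cint (fun t => Ci * (circ r t * h (circ r t)))%C 0 (2 * PI) = RtoC 0).
  { rewrite (Cint_FTC (fun t => H (circ r t))).
    - assert (X : circ r (2 * PI) = circ r 0).
      { unfold circ. now rewrite sin_2PI, cos_2PI, sin_0, cos_0. }
      rewrite X. ring.
    - lra.
    - intros t _. replace (Ci * (circ r t * h (circ r t)))%C with (h (circ r t) * (Ci * circ r t))%C by ring.
      apply is_derive_curve_comp; [apply HH, Hm|apply circ_derive].
    - apply cont_on_mult; [apply cont_on_const|exact Hc]. }
  rewrite Cint_scal in E by (auto; lra).
  apply (f_equal (fun x => - Ci * x)%C) in E.
  replace (- Ci * (Ci * Cint (fun t : R => circ r t * h (circ r t))%C 0 (2 * PI)))%C with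
   (- (Ci * Ci) * Cint (fun t : R => circ r t * h (circ r t))%C 0 (2 * PI))%C in E by ring.
  replace (- (Ci * Ci))%C with (RtoC 1) in E
    by (unfold Ci, Cmult, Copp, RtoC; simpl; f_equal; ring).
  rewrite Cmult_1_l in E. rewrite E. ring.
Qed.

Lemma holomorphic_pow rho n : holomorphic_on_disc rho (fun z => z ^ n)%C.
Proof.
  intros z _. induction n as [|n [l Hl]].
  - exists (RtoC 0). exact (is_derive_C_const (RtoC 1) z).
  - eexists. apply (@is_derive_C_mult (fun z => z) (fun z => z ^ n)%C); [apply is_derive_C_id|exact Hl].
Qed.

(** This is 1/z on the circle of radius r; in the form conj z / r^2 the
    integrals of its powers are conjugates of those of powers of z. *)
Definition circ_inv (r t : R) : C := (Cconj (circ r t) * RtoC (/ r ^ 2))%C.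

Lemma circ_inv_spec r t : 0 < r -> (circ r t * circ_inv r t)%C = RtoC 1.
Proof.
  intros Hr. unfold circ_inv. rewrite Cmult_assoc.
  rewrite <- Cmod2_conj, circ_mod by lra. rewrite <- RtoC_mult. f_equal.
  field. lra.
Qed.

Lemma circ_inv_mod r t : 0 < r -> Cmod (circ_inv r t) = / r.
Proof.
  intros Hr. unfold circ_inv. rewrite Cmod_mult, Cmod_conj, circ_mod, Cmod_R by lra.
  rewrite Rabs_pos_eq; [field; lra|]. left. apply Rinv_0_lt_compat, pow_lt. lra.
Qed.

Lemma circ_inv_continuous r t : continuous (circ_inv r) t.
Proof.
  unfold circ_inv. apply continuous_RC_mult; [|apply continuous_RC_const].
  apply continuous_RC_conj, circ_continuous.
Qed.

Lemma continuous_RC_pow (h : R -> C) (n : nat) (t : R) : continuous h t -> continuous (fun s => h s ^ n)%C t.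
Proof.
  intros H. induction n; simpl; [apply continuous_RC_const|]. now apply continuous_RC_mult.
Qed.

Lemma circ_pow_int0 r n : 0 < r -> Cint (fun t => circ r t ^ S n)%C 0 (2 * PI) = RtoC 0.
Proof.
  intros Hr. rewrite (Cint_ext _ (fun t => circ r t * (fun z => z ^ n) (circ r t))%C).
  - assert (Hr1 : 0 <= r < r + 1) by lra.
    exact (circle_integral_0 (r + 1) (fun z => z ^ n)%C r (holomorphic_pow _ n) Hr1).
  - assert (X := PI_RGT_0). lra.
  - intros t _. apply Cpow_S.
Qed.

Lemma circ_conj_pow_int0 r n : 0 < r -> Cint (fun t => Cconj (circ r t) ^ S n)%C 0 (2 * PI) = RtoC 0.
Proof.
  intros Hr. assert (X := PI_RGT_0).
  rewrite (Cint_ext _ (fun t => Cconj (circ r t ^ S n))%C); [|lra|intros; now rewrite Cpow_conj].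
  rewrite Cint_conj; [|lra|].
  - rewrite circ_pow_int0 by assumption. unfold Cconj, RtoC; simpl. f_equal; ring.
  - intros t _. apply continuous_RC_pow, circ_continuous.
Qed.

Lemma circ_inv_pow_int0 r n : 0 < r -> Cint (fun t => circ_inv r t ^ S n)%C 0 (2 * PI) = RtoC 0.
Proof.
  intros Hr. assert (X := PI_RGT_0).
  rewrite (Cint_ext _ (fun t => RtoC (/ r ^ 2) ^ S n * Cconj (circ r t) ^ S n)%C); [|lra|].
  - rewrite Cint_scal; [|lra|].
    + rewrite circ_conj_pow_int0 by assumption. ring.
    + intros t _. apply continuous_RC_pow, continuous_RC_conj, circ_continuous.
  - intros t _. unfold circ_inv. rewrite Cpow_mult_l. ring.
Qed.

(** The Cauchy kernel zeta / (zeta - z) at the point zeta of the circle. *)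
Definition cauchy_kern (r : R) (z : C) (t : R) : C := (/ (1 - z * circ_inv r t))%C.

Lemma cauchy_kern_den_lower r z t : Cmod z < r -> 0 < 1 - Cmod z / r <= Cmod (1 - z * circ_inv r t)%C.
Proof.
  intros Hz. assert (Hz0 := Cmod_ge_0 z). split.
  - replace (1 - Cmod z / r) with ((r - Cmod z) / r) by (field; lra).
    apply Rdiv_lt_0_compat; lra.
  - assert (X := Cmod_le_add (RtoC 1) (z * circ_inv r t)%C).
    rewrite Cmod_1, Cmod_mult, circ_inv_mod in X by lra. unfold Rdiv. lra.
Qed.

Lemma cauchy_kern_den r z t : Cmod z < r -> (1 - z * circ_inv r t)%C <> RtoC 0.
Proof. intros Hz. apply Cmod_gt_0. assert (X := cauchy_kern_den_lower r z t Hz). lra. Qed.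

Lemma cauchy_kern_mod r z t : Cmod z < r -> Cmod (cauchy_kern r z t) <= r / (r - Cmod z).
Proof.
  intros Hz. assert (Hz0 := Cmod_ge_0 z). assert (X := cauchy_kern_den_lower r z t Hz).
  unfold cauchy_kern. rewrite Cmod_inv by now apply cauchy_kern_den.
  replace (r / (r - Cmod z)) with (/ (1 - Cmod z / r)) by (field; lra).
  apply Rinv_le_contravar; lra.
Qed.

Lemma cauchy_kern_continuous r z t : Cmod z < r -> continuous (cauchy_kern r z) t.
Proof.
  intros Hz. unfold cauchy_kern. apply continuous_RC_comp.
  - apply continuous_RC_minus; [apply continuous_RC_const|].
    apply continuous_RC_mult; [apply continuous_RC_const|apply circ_inv_continuous].
  - eapply is_derive_C_continuous. apply is_derive_C_inv. now apply cauchy_kern_den.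
Qed.

(** The kernel is the sum of the geometric series of z / zeta; the remainder
    after N terms is z^N times an integral of size r^(-N). *)
Lemma cauchy_kern_expansion r z g : Cmod z < r -> cont_on g 0 (2 * PI) ->
  (exists M, forall t, 0 <= t <= 2 * PI -> Cmod (g t) <= M) ->
  Cseries (fun k => Cint (fun t => g t * circ_inv r t ^ k)%C 0 (2 * PI) * z ^ k)%C
     (Cint (fun t => g t * cauchy_kern r z t)%C 0 (2 * PI)).
Proof.
  intros Hz Hg [M HM]. assert (Hz0 := Cmod_ge_0 z). assert (HP := PI_RGT_0).
  assert (HM0 : 0 <= M).
  { eapply Rle_trans; [apply Cmod_ge_0|]. apply (HM 0). lra. }
  set (J := Cint (fun t => g t * cauchy_kern r z t)%C 0 (2 * PI)).
  set (u := fun k => (Cint (fun t => g t * circ_inv r t ^ k)%C 0 (2 * PI) * z ^ k)%C).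
  assert (Ci1 : forall k, cont_on (fun t => g t * circ_inv r t ^ k)%C 0 (2 * PI)).
  { intros k t Ht. apply continuous_RC_mult; [now apply Hg|]. apply continuous_RC_pow, circ_inv_continuous. }
  assert (Ck : forall k, cont_on (fun t => (g t * circ_inv r t ^ k) * cauchy_kern r z t)%C 0 (2 * PI)).
  { intros k t Ht. apply continuous_RC_mult; [now apply Ci1|now apply cauchy_kern_continuous]. }
  assert (E : forall N, (J - partial_sum u N)%C = (z ^ N * Cint (fun t => (g t * circ_inv r t ^ N) * cauchy_kern r z t)%C 0 (2 * PI))%C).
  { induction N.
    - simpl. rewrite (Cint_ext (fun t => g t * 1 * cauchy_kern r z t)%C (fun t => g t * cauchy_kern r z t)%C); [unfold J; ring|lra|].
      intros; ring.
    - change (partial_sum u (S N)) with (partial_sum u N + u N)%C.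
      replace (J - (partial_sum u N + u N))%C with ((J - partial_sum u N) - u N)%C by ring. rewrite IHN.
      rewrite (Cint_ext (fun t => g t * circ_inv r t ^ N * cauchy_kern r z t)%C
        (fun t => g t * circ_inv r t ^ N + z * (g t * circ_inv r t ^ S N * cauchy_kern r z t))%C).
      + rewrite Cint_plus; [|lra|apply Ci1|apply cont_on_mult; [apply cont_on_const|apply (Ck (S N))]].
        rewrite Cint_scal; [|lra|apply (Ck (S N))].
        unfold u. rewrite (Cpow_S z). ring.
      + lra.
      + intros t _. unfold cauchy_kern. rewrite (Cpow_S (circ_inv r t)). field. now apply cauchy_kern_den. }
  apply is_series_C_eps. intros eps He.
  set (B := M * (r / (r - Cmod z)) * (2 * PI)).
  assert (HB : 0 <= B).
  { unfold B. apply Rmult_le_pos; [apply Rmult_le_pos; [lra|apply Rdiv_le_0_compat; lra]|lra]. }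
  set (q := Cmod z * / r).
  assert (Hq : 0 <= q < 1).
  { assert (0 < / r) by (apply Rinv_0_lt_compat; lra). unfold q. split; [apply Rmult_le_pos; lra|].
    apply Rmult_lt_reg_r with r; [lra|]. rewrite Rmult_assoc, Rinv_l; lra. }
  destruct (pow_lt_1_zero q) with (y := eps / (B + 1)) as [N HN].
  { rewrite Rabs_pos_eq; lra. }
  { apply Rdiv_lt_0_compat; lra. }
  exists N. intros n Hn. specialize (HN n Hn). rewrite Rabs_pos_eq in HN by (apply pow_le; lra).
  replace (partial_sum u n - J)%C with (- (J - partial_sum u n))%C by ring. rewrite Cmod_opp, E, Cmod_mult, Cmod_pow.
  assert (X : Cmod (Cint (fun t => (g t * circ_inv r t ^ n) * cauchy_kern r z t)%C 0 (2 * PI)) <=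
     (M * (/ r) ^ n * (r / (r - Cmod z))) * (2 * PI - 0)).
  { apply Cint_bound; [lra|apply Ck|]. intros t Ht. rewrite !Cmod_mult, Cmod_pow, circ_inv_mod by lra.
    assert (0 <= (/ r) ^ n) by (apply pow_le; left; apply Rinv_0_lt_compat; lra).
    apply Rmult_le_compat; [|apply Cmod_ge_0| |now apply cauchy_kern_mod].
    - apply Rmult_le_pos; [apply Cmod_ge_0|assumption].
    - apply Rmult_le_compat_r; [assumption|now apply HM]. }
  eapply Rle_lt_trans; [apply Rmult_le_compat_l; [apply pow_le; lra|exact X]|].
  replace (Cmod z ^ n * (M * (/ r) ^ n * (r / (r - Cmod z)) * (2 * PI - 0))) with (q ^ n * B)
    by (unfold q, B; rewrite Rpow_mult_distr; ring).
  apply Rmult_lt_compat_r with (r := B + 1) in HN; [|lra].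
  replace (eps / (B + 1) * (B + 1)) with eps in HN by (field; lra).
  assert (0 <= q ^ n) by (apply pow_le; lra). nra.
Qed.

(** In the expansion for g = 1 all terms but the first vanish. *)
Lemma cauchy_kern_int r z : Cmod z < r -> Cint (cauchy_kern r z) 0 (2 * PI) = RtoC (2 * PI).
Proof.
  intros Hz. assert (Hz0 := Cmod_ge_0 z). assert (HP := PI_RGT_0).
  rewrite (Cint_ext _ (fun t => RtoC 1 * cauchy_kern r z t)%C) by (intros; try lra; ring).
  assert (B1 : exists M, forall t, 0 <= t <= 2 * PI -> Cmod (RtoC 1) <= M).
  { exists 1. intros _ _. rewrite Cmod_1. lra. }
  assert (S := cauchy_kern_expansion r z (fun _ => RtoC 1) Hz (cont_on_const _ _ _) B1).
  apply (is_series_C_unique _ _ _ S).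
  replace (RtoC (2 * PI)) with (Cint (fun t => RtoC 1 * circ_inv r t ^ 0)%C 0 (2 * PI) * z ^ 0)%C.
  - apply (is_series_C_first (fun k => Cint (fun t => RtoC 1 * circ_inv r t ^ k)%C 0 (2 * PI) * z ^ k)%C).
    intros n. rewrite (Cint_ext _ (fun t => circ_inv r t ^ Datatypes.S n)%C).
    + rewrite circ_inv_pow_int0 by lra. ring.
    + lra.
    + intros; ring.
  - simpl. rewrite (Cint_ext _ (fun _ => RtoC 1)); [|lra|intros; ring].
    rewrite Cint_const. rewrite Rminus_0_r. ring.
Qed.

(** Cauchy's formula for P: the difference quotient of P at z integrates to 0
    over the circle, so the integral of P against the kernel is P z times that
    of the kernel. *)
Lemma primitive_is_powser rho P f r :
  (forall u, Cmod u < rho -> is_derive P u (f u)) -> holomorphic_on_disc rho f -> 0 < r < rho ->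
  exists a, is_powser r a P.
Proof.
  intros HP Hf Hr. assert (Hpi := PI_RGT_0).
  exists (fun k => RtoC (/ (2 * PI)) * Cint (fun t => P (circ r t) * circ_inv r t ^ k)%C 0 (2 * PI))%C.
  intros z Hz.
  assert (Hm : forall t, Cmod (circ r t) = r) by (intros; apply circ_mod; lra).
  assert (HcP : cont_on (fun t => P (circ r t)) 0 (2 * PI)).
  { intros t _. apply continuous_RC_comp; [apply circ_continuous|].
    eapply is_derive_C_continuous. apply HP. rewrite Hm. lra. }
  assert (Hck : cont_on (cauchy_kern r z) 0 (2 * PI)) by (intros t _; now apply cauchy_kern_continuous).
  assert (E : Cint (fun t => P (circ r t) * cauchy_kern r z t)%C 0 (2 * PI) = (RtoC (2 * PI) * P z)%C).
  { assert (X := circle_integral_0 rho (divdiff P f z) r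
       (divdiff_holomorphic rho P f z HP Hf ltac:(lra)) ltac:(lra)).
    rewrite (Cint_ext _ (fun t => P (circ r t) * cauchy_kern r z t - P z * cauchy_kern r z t)%C) in X.
    - rewrite Cint_minus in X; [|lra|now apply cont_on_mult|apply cont_on_mult; [apply cont_on_const|assumption]].
      rewrite Cint_scal, cauchy_kern_int in X; [|assumption|lra|assumption].
      apply (f_equal (fun c => c + P z * RtoC (2 * PI))%C) in X.
      replace (RtoC (2 * PI) * P z)%C with (RtoC 0 + P z * RtoC (2 * PI))%C by ring.
      rewrite <- X. ring.
    - lra.
    - intros t _. unfold divdiff.
      destruct (excluded_middle_informative (circ r t = z)) as [Q|Q].
      { rewrite <- Q, Hm in Hz. lra. }
      assert (Q' : (circ r t - z)%C <> RtoC 0).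
      { intros Q'. now apply Q, Csub_0_eq. }
      assert (I := circ_inv_spec r t ltac:(lra)).
      assert (K := cauchy_kern_den r z t Hz).
      unfold cauchy_kern.
      replace (circ r t * ((P (circ r t) - P z) / (circ r t - z)))%C with
        ((P (circ r t) - P z) * (circ r t / (circ r t - z)))%C by (field; assumption).
      replace (circ r t / (circ r t - z))%C with (/ (1 - z * circ_inv r t))%C; [ring|].
      assert (N0 : circ r t <> RtoC 0) by (apply Cmod_gt_0; rewrite Hm; lra).
      assert (Ei : circ_inv r t = (/ circ r t)%C).
      { replace (circ_inv r t) with (/ circ r t * (circ r t * circ_inv r t))%C by (field; assumption).
        rewrite I. ring. }
      rewrite Ei. field. split; assumption. }
  assert (S := cauchy_kern_expansion r z (fun t => P (circ r t)) Hz HcP).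
  replace (P z) with (RtoC (/ (2 * PI)) * (RtoC (2 * PI) * P z))%C.
  2:{ rewrite Cmult_assoc, <- RtoC_mult, Rinv_l by lra. ring. }
  rewrite <- E.
  eapply is_series_C_ext; [|apply is_series_C_scal, S].
  - intros n. cbv beta. ring.
  - destruct (continuity_ab_maj (fun t => Cmod (P (circ r t))) 0 (2 * PI)) as [t0 [Ht0 _]].
    + lra.
    + intros t Ht. apply continuity_pt_filterlim.
      apply (continuous_comp (fun t => P (circ r t)) Cmod); [now apply HcP|].
      intros Q [e HQ]. apply (locally_C (P (circ r t))). exists e. intros y Hy. apply HQ.
      unfold ball; simpl. unfold AbsRing_ball, abs, minus, plus, opp; simpl.
      eapply Rle_lt_trans; [|exact Hy].
      unfold abs; simpl. unfold minus, plus, opp; simpl.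
      assert (A1 : Cmod y <= Cmod (y - P (circ r t))%C + Cmod (P (circ r t))).
      { replace y with ((y - P (circ r t)) + P (circ r t))%C at 1 by ring. apply Cmod_triangle. }
      assert (A2 : Cmod (P (circ r t)) <= Cmod (y - P (circ r t))%C + Cmod y).
      { replace (P (circ r t)) with (- (y - P (circ r t)) + y)%C at 1 by ring.
        norm_split. rewrite Cmod_opp. lra. }
      unfold Cminus in *. apply Rabs_le. lra.
    + exists (Cmod (P (circ r t0))). exact Ht0.
Qed.

(** Differentiate the power series of a primitive. This gives a series on every
    smaller disc; by uniqueness they all have the same coefficients. *)
Theorem holomorphic_is_powser rho f : 0 < rho -> holomorphic_on_disc rho f ->
  exists a, is_powser rho a f.
Proof.
  intros Hr Hf. destruct (holomorphic_primitive rho f Hf) as (P & _ & HP).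
  assert (L : forall r, 0 < r < rho -> exists a, is_powser r a f).
  { intros r H. destruct (primitive_is_powser rho P f r HP Hf H) as [a Ha].
    exists (deriv_coef a). intros z Hz. destruct (is_powser_C_derive Ha) as [D _].
    rewrite <- (is_C_derive_unique P z (f z)); [now apply D|]. apply HP. lra. }
  destruct (L (rho / 2)) as [a Ha]; [lra|]. exists a. intros z Hz.
  set (r := Rmax (rho / 2) ((Cmod z + rho) / 2)).
  assert (Hr1 : rho / 2 <= r) by apply Rmax_l.
  assert (Hr2 : (Cmod z + rho) / 2 <= r) by apply Rmax_r.
  assert (Hr3 : r < rho) by (apply Rmax_lub_lt; lra).
  destruct (L r) as [b Hb]; [lra|].
  eapply is_series_C_ext; [|apply (Hb z); lra].
  intros n. cbv beta. f_equal.
  apply (is_powser_unique (rho / 2) 1 b a f f); auto; try lra.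
  apply is_powser_le with r; auto.
Qed.

(** * Coefficients of functions with positive real part *)

Lemma is_powser_holomorphic rho a f : is_powser rho a f -> holomorphic_on_disc rho f.
Proof.
  intros H z Hz. destruct (is_powser_derive rho a f z H Hz) as (l & _ & Hl). now exists l.
Qed.

(** Shifting the power series reduces the exponent by one, as z conj z = r^2 on
    the circle. *)
Lemma coefficient_integral rho c p r n : 0 < r < rho -> is_powser rho c p ->
  Cint (fun t => Cconj (circ r t) ^ n * p (circ r t))%C 0 (2 * PI)
   = (RtoC (2 * PI * (r ^ 2) ^ n) * c n)%C.
Proof.
  intros Hr. assert (HP := PI_RGT_0). revert c p.
  assert (Hm : forall t, Cmod (circ r t) < rho) by (intros; rewrite circ_mod; lra).
  induction n as [|n IH]; intros c p Hp;
    destruct (is_powser_shift (rho := rho) ltac:(lra) Hp) as (p1 & Hp1 & E).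
  - assert (Hc1 : cont_on (fun t => circ r t * p1 (circ r t))%C 0 (2 * PI)).
    { intros t _. apply continuous_RC_mult; [apply circ_continuous|].
      apply continuous_RC_comp; [apply circ_continuous|]. eapply is_powser_continuous; [exact Hp1|apply Hm]. }
    rewrite (Cint_ext _ (fun t => c 0%nat + circ r t * p1 (circ r t))%C).
    + rewrite Cint_plus; [|lra|apply cont_on_const|exact Hc1].
      rewrite (circle_integral_0 rho p1 r); [|now apply is_powser_holomorphic with (fun n => c (S n))|lra].
      rewrite Cint_const, Rminus_0_r. simpl. rewrite Rmult_1_r. ring.
    + lra.
    + intros t _. rewrite E by apply Hm. simpl. ring.
  - assert (Hc1 : cont_on (fun t => Cconj (circ r t) ^ n * p1 (circ r t))%C 0 (2 * PI)).
    { intros t _. apply continuous_RC_mult; [apply continuous_RC_pow, continuous_RC_conj, circ_continuous|].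
      apply continuous_RC_comp; [apply circ_continuous|]. eapply is_powser_continuous; [exact Hp1|apply Hm]. }
    assert (Hc2 : cont_on (fun t => Cconj (circ r t) ^ S n)%C 0 (2 * PI)).
    { intros t _. apply continuous_RC_pow, continuous_RC_conj, circ_continuous. }
    rewrite (Cint_ext _ (fun t => c 0%nat * Cconj (circ r t) ^ S n + RtoC (r ^ 2) * (Cconj (circ r t) ^ n * p1 (circ r t)))%C).
    + rewrite Cint_plus; [|lra|apply cont_on_mult; [apply cont_on_const|exact Hc2]|apply cont_on_mult; [apply cont_on_const|exact Hc1]].
      rewrite !Cint_scal; [|lra|exact Hc1|lra|exact Hc2].
      rewrite circ_conj_pow_int0 by lra. rewrite (IH (fun n => c (S n)) p1 Hp1).
      rewrite Cmult_assoc, <- RtoC_mult.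
      replace (r ^ 2 * (2 * PI * (r ^ 2) ^ n)) with (2 * PI * (r ^ 2) ^ S n) by (rewrite <- tech_pow_Rmult; ring).
      ring.
    + lra.
    + intros t _. rewrite E by apply Hm.
      assert (X : (circ r t * Cconj (circ r t))%C = RtoC (r ^ 2)).
      { rewrite <- Cmod2_conj, circ_mod by lra. reflexivity. }
      rewrite <- X, Cpow_S. ring.
Qed.

Lemma bernoulli_le1 (e : R) (n : nat) : 0 <= e <= 1 -> 1 - INR n * e <= (1 - e) ^ n.
Proof.
  intros He. induction n as [|n IH]; [simpl; lra|]. rewrite S_INR. simpl.
  assert (H := pos_INR n). nra.
Qed.

(** Lets r tend to 1, by Bernoulli's inequality for a suitable r. *)
Lemma le_of_scaled (x b : R) (n : nat) : 0 <= b ->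
  (forall r, 0 < r < 1 -> x * r ^ n <= b) -> x <= b.
Proof.
  intros Hb H. destruct (Rle_lt_dec x b) as [|Hx]; [assumption|exfalso].
  assert (HI := pos_INR n).
  (* with this e, x (1 - n e) is still larger than b *)
  set (e := (x - b) / ((INR n + 2) * x)).
  assert (Hd : 0 < (INR n + 2) * x) by nra.
  assert (He : e * ((INR n + 2) * x) = x - b) by (unfold e; field; split; lra).
  assert (He0 : 0 < e) by (apply Rdiv_lt_0_compat; lra).
  assert (He1 : e < 1) by nra.
  assert (B := bernoulli_le1 e n ltac:(lra)). specialize (H (1 - e) ltac:(lra)).
  assert (x * (1 - INR n * e) <= x * (1 - e) ^ n) by (apply Rmult_le_compat_l; lra).
  nra.
Qed.

(** On the circle |z| = r the function p z^n has mean 0 and p conj z^n has mean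
    c_n r^(2 n). Integrating Re p against the nonnegative weight 1 + Re (eta
    z^n) / r^n therefore leaves 1 + r^n Re (conj eta c_n) / 2, and eta is chosen
    such that conj eta c_n = -|c_n|. *)
Theorem caratheodory_bound c p n : is_powser 1 c p -> c 0%nat = RtoC 1 ->
  (forall z, Cmod z < 1 -> 0 <= Re (p z)) -> Cmod (c (S n)) <= 2.
Proof.
  intros Hp Hc0 Hre. assert (HP := PI_RGT_0).
  apply le_of_scaled with (S n); [lra|]. intros r Hr.
  destruct (Req_dec (Cmod (c (S n))) 0) as [Z|Z]; [rewrite Z; lra|].
  assert (Hpos : 0 < Cmod (c (S n))).
  { assert (X := Cmod_ge_0 (c (S n))). lra. }
  set (m := Cmod (c (S n))) in *.
  set (N := S n) in *.
  set (eta := (RtoC (- / m) * c N)%C).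
  assert (Heta : (Cconj eta * c N)%C = RtoC (- m)).
  { unfold eta. rewrite Cmult_conj.
    replace (Cconj (RtoC (- / m)) * Cconj (c N) * c N)%C with (Cconj (RtoC (- / m)) * (c N * Cconj (c N)))%C by ring.
    rewrite <- Cmod2_conj. fold m.
    replace (Cconj (RtoC (- / m))) with (RtoC (- / m)) by (unfold Cconj, RtoC; simpl; f_equal; ring).
    rewrite <- RtoC_mult. f_equal. field. assumption. }
  assert (Heta1 : Cmod eta = 1).
  { unfold eta. rewrite Cmod_mult, Cmod_R. fold m. rewrite Rabs_Ropp, Rabs_pos_eq.
    - field. assumption.
    - left. now apply Rinv_0_lt_compat. }
  assert (HrN : 0 < r ^ N) by (apply pow_lt; lra).
  set (s := / (2 * r ^ N)).
  assert (Hs : 0 < s) by (apply Rinv_0_lt_compat; lra).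
  assert (Hm : forall t, Cmod (circ r t) < 1) by (intros; rewrite circ_mod; lra).
  assert (Hpc : cont_on (fun t => p (circ r t)) 0 (2 * PI)).
  { intros t _. apply continuous_RC_comp; [apply circ_continuous|]. eapply is_powser_continuous; [exact Hp|apply Hm]. }
  set (w := fun t => (p (circ r t) + (RtoC s * eta) * (circ r t ^ N * p (circ r t)) + (RtoC s * Cconj eta) * (Cconj (circ r t) ^ N * p (circ r t)))%C).
  assert (Hc1 : cont_on (fun t => circ r t ^ N * p (circ r t))%C 0 (2 * PI)).
  { apply cont_on_mult; [|exact Hpc]. intros t _. apply continuous_RC_pow, circ_continuous. }
  assert (Hc2 : cont_on (fun t => Cconj (circ r t) ^ N * p (circ r t))%C 0 (2 * PI)).
  { apply cont_on_mult; [|exact Hpc]. intros t _. apply continuous_RC_pow, continuous_RC_conj, circ_continuous. }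
  assert (Hc1' : cont_on (fun t => (RtoC s * eta) * (circ r t ^ N * p (circ r t)))%C 0 (2 * PI)).
  { apply cont_on_mult; [apply cont_on_const|exact Hc1]. }
  assert (Hc2' : cont_on (fun t => (RtoC s * Cconj eta) * (Cconj (circ r t) ^ N * p (circ r t)))%C 0 (2 * PI)).
  { apply cont_on_mult; [apply cont_on_const|exact Hc2]. }
  assert (Hw : cont_on w 0 (2 * PI)).
  { unfold w. apply cont_on_plus; [apply cont_on_plus; assumption|assumption]. }
  assert (I : Cint w 0 (2 * PI) = (RtoC (2 * PI) + RtoC (- (PI * m * r ^ N)))%C).
  { unfold w. rewrite Cint_plus; [|lra|now apply cont_on_plus|assumption].
    rewrite Cint_plus; [|lra|assumption|assumption].
    rewrite !Cint_scal; [|lra|assumption|lra|assumption].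
    rewrite (coefficient_integral 1 c p r N) by (auto; lra).
    rewrite (Cint_ext (fun t => p (circ r t)) (fun t => Cconj (circ r t) ^ 0 * p (circ r t))%C); [|lra|intros; simpl; ring].
    rewrite (coefficient_integral 1 c p r 0) by (auto; lra). rewrite Hc0.
    rewrite (Cint_ext (fun t => circ r t ^ N * p (circ r t))%C (fun t => circ r t * (fun z => z ^ n * p z) (circ r t))%C); [|lra|].
    - assert (Z0 : Cint (fun t => circ r t * (fun z => z ^ n * p z)%C (circ r t))%C 0 (2 * PI) = RtoC 0).
      { assert (HH : holomorphic_on_disc 1 (fun z => z ^ n * p z)%C).
        { intros z Hz. destruct (holomorphic_pow 1 n z Hz) as [l1 Hl1].
          destruct (is_powser_holomorphic 1 c p Hp z Hz) as [l2 Hl2].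
          eexists. apply (@is_derive_C_mult (fun z => z ^ n)%C p); eassumption. }
        assert (Hr' : 0 <= r < 1) by lra.
        exact (circle_integral_0 1 (fun z => z ^ n * p z)%C r HH Hr'). }
      rewrite Z0.
      replace (RtoC s * Cconj eta * (RtoC (2 * PI * (r ^ 2) ^ N) * c N))%C with
        (RtoC s * RtoC (2 * PI * (r ^ 2) ^ N) * (Cconj eta * c N))%C by ring.
      rewrite Heta, <- !RtoC_mult. simpl pow at 1. rewrite !Rmult_1_r.
      replace (s * (2 * PI * (r ^ 2) ^ N) * - m) with (- (PI * m * r ^ N)).
      + ring.
      + unfold s. rewrite <- !pow_mult. replace (2 * N)%nat with (N + N)%nat by lia. rewrite pow_add.
        field. lra.
    - intros t _. unfold N. rewrite Cpow_S. ring. }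
  assert (Pos : 0 <= Re (Cint w 0 (2 * PI))).
  { apply Cint_Re_ge0; [lra|exact Hw|]. intros t _.
    set (x := (eta * circ r t ^ N)%C).
    replace (w t) with (RtoC (1 + 2 * s * Re x) * p (circ r t))%C.
    - rewrite re_scal_l. apply Rmult_le_pos; [|apply Hre, Hm].
      assert (X := re_le_Cmod x). unfold x in X at 2. rewrite Cmod_mult, Cmod_pow, Heta1, circ_mod in X by lra.
      assert (X2 : - r ^ N <= Re x).
      { assert (Y := Rle_abs (- Re x)). rewrite Rabs_Ropp in Y. lra. }
      assert (s * r ^ N = / 2) by (unfold s; field; lra). nra.
    - unfold w.
      assert (X : RtoC (2 * s * Re x) = (RtoC s * (x + Cconj x))%C).
      { destruct x as [x1 x2]. unfold RtoC, Cmult, Cplus, Cconj; simpl. f_equal; ring. }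
      rewrite RtoC_plus, X. unfold x. rewrite Cmult_conj, Cpow_conj. ring. }
  rewrite I in Pos. rewrite re_plus, !re_RtoC in Pos.
  assert (0 <= PI * (2 - m * r ^ N)) by lra.
  apply Rmult_le_reg_l with PI; lra.
Qed.

(** * The exponential function *)

Lemma Cexp_plus z w : Cexp (z + w)%C = (Cexp z * Cexp w)%C.
Proof.
  destruct z as [x y], w as [u v]. unfold Cexp, Cplus, Cmult; simpl.
  rewrite exp_plus, cos_plus, sin_plus. f_equal; ring.
Qed.

Lemma Cexp_0 : Cexp (RtoC 0) = RtoC 1.
Proof. unfold Cexp, RtoC; simpl. rewrite exp_0, cos_0, sin_0. f_equal; ring. Qed.

(** From exp x - 1 - x and (cos y, sin y) - 1 - i y being small of first order.
    *)
Lemma Cexp_derive_0 : is_derive Cexp (RtoC 0) (RtoC 1).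
Proof.
  apply is_derive_C_eps. intros eps He. rewrite Cexp_0.
  assert (D : curve_derive (fun s => (cos s, sin s) : C) 0 ((- sin 0, cos 0) : C)).
  { apply is_derive_curve_pair; apply is_derive_Reals; [apply derivable_pt_lim_cos|apply derivable_pt_lim_sin]. }
  rewrite sin_0, cos_0 in D.
  set (e1 := eps / 4). assert (He1 : 0 < e1) by (unfold e1; lra).
  destruct (proj1 (is_derive_curve_eps _ _ _) D e1 He1) as [d1 [Hd1 H1]].
  assert (D2 : curve_derive (fun s => (exp s, 0) : C) 0 ((exp 0, 0) : C)).
  { apply is_derive_curve_pair; apply is_derive_Reals; [apply derivable_pt_lim_exp|apply derivable_pt_lim_const]. }
  destruct (proj1 (is_derive_curve_eps _ _ _) D2 e1 He1) as [d2 [Hd2 H2]].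
  exists (Rmin 1 (Rmin e1 (Rmin d1 d2))). split; [repeat apply Rmin_glb_lt; lra|].
  assert (Z0 : forall c : C, (c - RtoC 0)%C = c) by (intros; ring).
  intros [x y] Hu. rewrite Z0 in *.
  set (h := Cmod (x, y)) in *.
  assert (B1 := Rlt_le_trans _ _ _ Hu (Rmin_l _ _)).
  assert (Hu' := Rlt_le_trans _ _ _ Hu (Rmin_r _ _)).
  assert (B2 := Rlt_le_trans _ _ _ Hu' (Rmin_l _ _)).
  assert (Hu'' := Rlt_le_trans _ _ _ Hu' (Rmin_r _ _)).
  assert (B3 := Rlt_le_trans _ _ _ Hu'' (Rmin_l _ _)).
  assert (B4 := Rlt_le_trans _ _ _ Hu'' (Rmin_r _ _)).
  assert (M := Rmax_Cmod (x, y)). simpl in M. fold h in M.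
  assert (Hx : Rabs x <= h) by (eapply Rle_trans; [apply Rmax_l|exact M]).
  assert (Hy : Rabs y <= h) by (eapply Rle_trans; [apply Rmax_r|exact M]).
  specialize (H1 y). specialize (H2 x). rewrite Rminus_0_r in H1, H2.
  specialize (H1 ltac:(lra)). specialize (H2 ltac:(lra)). rewrite sin_0, cos_0 in H1. rewrite exp_0 in H2.
  assert (Ha := Rabs_pos x). assert (Hb := Rabs_pos y).
  set (U := ((cos y, sin y) - (1, 0) - RtoC y * ((- 0)%R, 1))%C) in *.
  set (E := ((exp x, 0) - (1, 0) - RtoC x * (1, 0))%C) in *.
  replace (Cexp (x, y) - RtoC 1 - RtoC 1 * (x, y))%C with
    (E * (cos y, sin y) + (RtoC (1 + x) * U + RtoC x * (Ci * RtoC y)))%C.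
  2:{ unfold Cexp, E, U, Cminus, Cplus, Copp, Cmult, RtoC, Ci; simpl. f_equal; ring. }
  assert (C1 : Cmod (cos y, sin y) = 1).
  { assert (X := circ_mod 1 y Rle_0_1). unfold circ in X. rewrite Cmult_1_l in X. exact X. }
  norm_split.
  eapply Rle_trans; [apply Rplus_le_compat_l, Cmod_triangle|].
  rewrite !Cmod_mult, C1, !Cmod_R, Cmod_Ci.
  assert (R1 : Rabs (1 + x) <= 2).
  { eapply Rle_trans; [apply Rabs_triang|]. rewrite Rabs_R1. lra. }
  assert (T1 : Cmod E <= e1 * h) by (eapply Rle_trans; [exact H2|]; apply Rmult_le_compat_l; lra).
  assert (T2 : Cmod U <= e1 * h) by (eapply Rle_trans; [exact H1|]; apply Rmult_le_compat_l; lra).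
  assert (T3 : Rabs (1 + x) * Cmod U <= 2 * (e1 * h)).
  { apply Rmult_le_compat; auto; [apply Rabs_pos|apply Cmod_ge_0]. }
  assert (T4 : Rabs x * Rabs y <= e1 * h) by (apply Rmult_le_compat; lra).
  unfold e1 in *. lra.
Qed.

Lemma Cexp_derive z : is_derive Cexp z (Cexp z).
Proof.
  assert (D : is_derive (fun u => u - z)%C z (RtoC 1 - RtoC 0)%C).
  { eapply is_derive_C_minus; [apply is_derive_C_id|apply is_derive_C_const]. }
  assert (D0 : is_derive Cexp (z - z)%C (RtoC 1)).
  { replace (z - z)%C with (RtoC 0) by ring. apply Cexp_derive_0. }
  assert (D1 := is_derive_C_mult (is_derive_C_const (Cexp z) z) (is_derive_C_comp Cexp (fun u => u - z)%C z _ _ D0 D)).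
  apply (is_derive_C_ext_loc (fun u => Cexp z * Cexp (u - z))%C _ _ _ 1); [lra| |].
  - intros u _. rewrite <- Cexp_plus. f_equal. ring.
  - cbv beta in D1.
    replace (RtoC 0 * Cexp (z - z) + Cexp z * (RtoC 1 * (RtoC 1 - RtoC 0)))%C with (Cexp z) in D1 by ring.
    exact D1.
Qed.

(** * Taylor polynomials of degree 3 *)

Definition near0 (P : C -> Prop) : Prop := exists d, 0 < d /\ forall z, Cmod z < d -> P z.
Definition bnd (S : C -> C) : Prop := exists K, 0 < K /\ near0 (fun z => Cmod (S z) <= K).

Lemma near0_and P Q : near0 P -> near0 Q -> near0 (fun z => P z /\ Q z).
Proof.
  intros (d & Hd & HP) (e & He & HQ). exists (Rmin d e). split; [now apply Rmin_glb_lt|].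
  intros z Hz. split; [apply HP|apply HQ]; eapply Rlt_le_trans; try exact Hz; [apply Rmin_l|apply Rmin_r].
Qed.

Lemma near0_mono (P Q : C -> Prop) : (forall z, P z -> Q z) -> near0 P -> near0 Q.
Proof. intros H (d & Hd & HP). exists d. split; auto. Qed.

Lemma near0_all (P : C -> Prop) : (forall z, P z) -> near0 P.
Proof. intros H. exists 1. split; [lra|auto]. Qed.

Lemma near0_disc r : 0 < r -> near0 (fun z => Cmod z < r).
Proof. intros H. exists r. auto. Qed.

Lemma bnd_const c : bnd (fun _ => c).
Proof.
  assert (H := Cmod_ge_0 c).
  exists (Cmod c + 1). split; [lra|]. apply near0_all. intros _. lra.
Qed.

Lemma bnd_id : bnd (fun z => z).
Proof. exists 1. split; [lra|]. exists 1. split; [lra|]. intros; lra. Qed.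

Lemma bnd_plus S T : bnd S -> bnd T -> bnd (fun z => S z + T z)%C.
Proof.
  intros (K & HK & H1) (L & HL & H2). exists (K + L). split; [lra|].
  eapply near0_mono; [|exact (near0_and _ _ H1 H2)]. intros z [A B]. simpl in *.
  norm_split. lra.
Qed.

Lemma bnd_mult S T : bnd S -> bnd T -> bnd (fun z => S z * T z)%C.
Proof.
  intros (K & HK & H1) (L & HL & H2). exists (K * L). split; [nra|].
  eapply near0_mono; [|exact (near0_and _ _ H1 H2)]. intros z [A B]. simpl in *.
  rewrite Cmod_mult. apply Rmult_le_compat; auto; apply Cmod_ge_0.
Qed.

Lemma bnd_continuous f : continuous f (RtoC 0) -> bnd f.
Proof.
  intros H. destruct (proj1 (continuous_C_eps _ _) H 1 Rlt_0_1) as [d [Hd H']].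
  assert (X := Cmod_ge_0 (f (RtoC 0))).
  exists (Cmod (f (RtoC 0)) + 1). split; [lra|]. exists d. split; [assumption|]. intros z Hz.
  specialize (H' z). replace (z - RtoC 0)%C with z in H' by ring. specialize (H' Hz).
  replace (f z) with ((f z - f (RtoC 0)) + f (RtoC 0))%C by ring.
  norm_split. lra.
Qed.

Lemma near0_pull P H h : near0 P -> bnd H -> near0 (fun z => h z = z * H z)%C -> near0 (fun z => P (h z)).
Proof.
  intros (d & Hd & HP) (K & HK & HH) HE.
  assert (HdK : 0 < d / K) by (apply Rdiv_lt_0_compat; lra).
  eapply near0_mono; [|exact (near0_and _ _ (near0_disc _ HdK) (near0_and _ _ HH HE))].
  intros z (A & B & E). simpl in *. apply HP. rewrite E, Cmod_mult.
  apply Rmult_lt_compat_r with (r := K) in A; [|assumption].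
  replace (d / K * K) with d in A by (field; lra).
  eapply Rle_lt_trans; [|exact A]. apply Rmult_le_compat_l; [apply Cmod_ge_0|assumption].
Qed.

Lemma bnd_pull S H h : bnd S -> bnd H -> near0 (fun z => h z = z * H z)%C -> bnd (fun z => S (h z)).
Proof.
  intros (K & HK & H1) HH HE. exists K. split; [assumption|].
  exact (near0_pull (fun z => Cmod (S z) <= K) H h H1 HH HE).
Qed.

(** Since S is bounded, z S z tends to 0 with z. *)
Lemma bnd_lim0 (c : C) S : bnd S -> near0 (fun z => z <> RtoC 0 -> c + z * S z = RtoC 0)%C -> c = RtoC 0.
Proof.
  intros (K & HK & H1) H2. destruct (near0_and _ _ H1 H2) as (d & Hd & H).
  apply Cmod_eq_0. apply Rle_antisym; [|apply Cmod_ge_0]. apply le_epsilon. intros eps He.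
  set (t := Rmin d (eps / K) / 2).
  assert (HeK : 0 < eps / K) by (apply Rdiv_lt_0_compat; lra).
  assert (Hmin : 0 < Rmin d (eps / K)) by now apply Rmin_glb_lt.
  assert (M1 : Rmin d (eps / K) <= d) by apply Rmin_l.
  assert (M2 : Rmin d (eps / K) <= eps / K) by apply Rmin_r.
  assert (Ht : 0 < t) by (unfold t; lra).
  assert (Hm : Cmod (RtoC t) = t) by (rewrite Cmod_R; apply Rabs_pos_eq; lra).
  destruct (H (RtoC t)) as [A B]; [rewrite Hm; unfold t; lra|].
  assert (Hnz : RtoC t <> RtoC 0) by (apply Cmod_gt_0; lra).
  specialize (B Hnz). replace c with ((c + RtoC t * S (RtoC t)) - RtoC t * S (RtoC t))%C by ring.
  rewrite B. replace (RtoC 0 - RtoC t * S (RtoC t))%C with (- (RtoC t * S (RtoC t)))%C by ring.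
  rewrite Cmod_opp, Cmod_mult, Hm.
  assert (t <= eps / K) by (unfold t; lra).
  apply Rle_trans with (eps / K * K).
  - apply Rmult_le_compat; [lra|apply Cmod_ge_0|lra|exact A].
  - right. field. lra.
Qed.

(** The Taylor polynomial of degree 3 at 0 with a remainder z^4 S; it is written
    in Horner form, so that the rules for sums and products are ring identities
    with an explicit new S. *)
Definition jet (g : C -> C) (a0 a1 a2 a3 : C) : Prop :=
  exists S, bnd S /\ near0 (fun z => g z = a0 + z * (a1 + z * (a2 + z * (a3 + z * S z))))%C.

Ltac bnd_auto := repeat first [apply bnd_const | apply bnd_id | assumption | apply bnd_plus | apply bnd_mult ].

Lemma jet_unique {g a0 a1 a2 a3 b0 b1 b2 b3} :
  jet g a0 a1 a2 a3 -> jet g b0 b1 b2 b3 -> a0 = b0 /\ a1 = b1 /\ a2 = b2 /\ a3 = b3.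
Proof.
  intros (S & HS & E) (T & HT & F). assert (EF := near0_and _ _ E F). clear E F.
  assert (E0 : a0 = b0).
  { apply Csub_0_eq. apply (bnd_lim0 _ (fun z => (a1 + z * (a2 + z * (a3 + z * S z))) + RtoC (-1) * (b1 + z * (b2 + z * (b3 + z * T z))))%C).
    - bnd_auto.
    - eapply near0_mono; [|exact EF]. intros z [A B] Hz. simpl in *. rewrite A in B.
      rewrite RtoC_m1.
      transitivity ((a0 + z * (a1 + z * (a2 + z * (a3 + z * S z)))) - (b0 + z * (b1 + z * (b2 + z * (b3 + z * T z)))))%C; [ring|rewrite B; ring]. }
  subst b0.
  assert (EF1 : near0 (fun z => z <> RtoC 0 -> (a1 + z * (a2 + z * (a3 + z * S z))) = (b1 + z * (b2 + z * (b3 + z * T z))))%C).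
  { eapply near0_mono; [|exact EF]. intros z [A B] Hz. simpl in *. rewrite A in B.
    transitivity (/ z * ((a0 + z * (a1 + z * (a2 + z * (a3 + z * S z)))) - a0))%C; [field; assumption|].
    rewrite B. field. assumption. }
  assert (E1 : a1 = b1).
  { apply Csub_0_eq. apply (bnd_lim0 _ (fun z => (a2 + z * (a3 + z * S z)) + RtoC (-1) * (b2 + z * (b3 + z * T z)))%C).
    - bnd_auto.
    - eapply near0_mono; [|exact EF1]. intros z A Hz. specialize (A Hz). simpl in *.
      rewrite RtoC_m1.
      transitivity ((a1 + z * (a2 + z * (a3 + z * S z))) - (b1 + z * (b2 + z * (b3 + z * T z))))%C; [ring|rewrite A; ring]. }
  subst b1.
  assert (EF2 : near0 (fun z => z <> RtoC 0 -> ((a2 + z * (a3 + z * S z))) = ((b2 + z * (b3 + z * T z))))%C).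
  { eapply near0_mono; [|exact EF1]. intros z A Hz. specialize (A Hz). simpl in *.
    transitivity (/ z * ((a1 + z * (a2 + z * (a3 + z * S z))) - a1))%C; [field; assumption|].
    rewrite A. field. assumption. }
  assert (E2 : a2 = b2).
  { apply Csub_0_eq. apply (bnd_lim0 _ (fun z => ((a3 + z * S z)) + RtoC (-1) * ((b3 + z * T z)))%C).
    - bnd_auto.
    - eapply near0_mono; [|exact EF2]. intros z A Hz. specialize (A Hz). simpl in *.
      rewrite RtoC_m1.
      transitivity (((a2 + z * (a3 + z * S z))) - ((b2 + z * (b3 + z * T z))))%C; [ring|rewrite A; ring]. }
  subst b2.
  assert (E3 : a3 = b3).
  { apply Csub_0_eq. apply (bnd_lim0 _ (fun z => (S z) + RtoC (-1) * (T z))%C).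
    - bnd_auto.
    - eapply near0_mono; [|exact EF2]. intros z A Hz. specialize (A Hz). simpl in *.
      rewrite RtoC_m1.
      transitivity (/ z * ((a2 + z * (a3 + z * S z)) - a2 - ((a2 + z * (b3 + z * T z)) - a2)))%C; [field; assumption|].
      rewrite A. field. assumption. }
  auto.
Qed.

Lemma jet_ext f g a0 a1 a2 a3 : near0 (fun z => f z = g z) -> jet f a0 a1 a2 a3 -> jet g a0 a1 a2 a3.
Proof.
  intros E (S & HS & F). exists S. split; [assumption|].
  eapply near0_mono; [|exact (near0_and _ _ E F)]. intros z [A B]. now rewrite <- A.
Qed.

Lemma jet_const c : jet (fun _ => c) c (RtoC 0) (RtoC 0) (RtoC 0).
Proof. exists (fun _ => RtoC 0). split; [apply bnd_const|]. apply near0_all. intros z. ring. Qed.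

Lemma jet_id : jet (fun z => z) (RtoC 0) (RtoC 1) (RtoC 0) (RtoC 0).
Proof. exists (fun _ => RtoC 0). split; [apply bnd_const|]. apply near0_all. intros z. ring. Qed.

Lemma jet_plus {f g a0 a1 a2 a3 b0 b1 b2 b3} : jet f a0 a1 a2 a3 -> jet g b0 b1 b2 b3 ->
  jet (fun z => f z + g z)%C (a0 + b0)%C (a1 + b1)%C (a2 + b2)%C (a3 + b3)%C.
Proof.
  intros (S & HS & E) (T & HT & F). exists (fun z => S z + T z)%C. split; [bnd_auto|].
  eapply near0_mono; [|exact (near0_and _ _ E F)]. intros z [A B]. simpl in *. rewrite A, B. ring.
Qed.

Lemma jet_mult {f g a0 a1 a2 a3 b0 b1 b2 b3} : jet f a0 a1 a2 a3 -> jet g b0 b1 b2 b3 ->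
  jet (fun z => f z * g z)%C (a0 * b0)%C (a0 * b1 + a1 * b0)%C (a0 * b2 + a1 * b1 + a2 * b0)%C
    (a0 * b3 + a1 * b2 + a2 * b1 + a3 * b0)%C.
Proof.
  intros (S & HS & E) (T & HT & F).
  exists (fun z => a0 * T z + a1 * (b3 + z * T z) + a2 * (b2 + z * (b3 + z * T z))
     + a3 * (b1 + z * (b2 + z * (b3 + z * T z))) + S z * (b0 + z * (b1 + z * (b2 + z * (b3 + z * T z)))))%C.
  split; [bnd_auto|].
  eapply near0_mono; [|exact (near0_and _ _ E F)]. intros z [A B]. simpl in *. rewrite A, B. ring.
Qed.

Lemma jet_eq f a0 a1 a2 a3 b0 b1 b2 b3 : jet f a0 a1 a2 a3 -> a0 = b0 -> a1 = b1 -> a2 = b2 -> a3 = b3 ->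
  jet f b0 b1 b2 b3.
Proof. intros; subst; assumption. Qed.

(** h z = z H z with H bounded, so the remainder h^4 S(h) is again z^4 times a
    bounded function. *)
Lemma jet_comp g h l0 l1 l2 l3 h1 h2 h3 : jet g l0 l1 l2 l3 -> jet h (RtoC 0) h1 h2 h3 ->
  jet (fun z => g (h z)) l0 (l1 * h1)%C (l1 * h2 + l2 * (h1 * h1))%C
    (l1 * h3 + RtoC 2 * l2 * h1 * h2 + l3 * (h1 * h1 * h1))%C.
Proof.
  intros (S & HS & E) Hh. assert (Hh' := Hh). destruct Hh' as (T & HT & F).
  set (H := (fun z => h1 + z * (h2 + z * (h3 + z * T z)))%C).
  assert (BH : bnd H) by (unfold H; bnd_auto).
  assert (EH : near0 (fun z => h z = z * H z)%C).
  { eapply near0_mono; [|exact F]. intros z A. simpl in *. rewrite A. unfold H. ring. }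
  assert (EP := near0_pull _ _ _ E BH EH). simpl in EP.
  assert (J2 := jet_mult Hh Hh).
  assert (J3 := jet_mult J2 Hh).
  assert (J := jet_plus (jet_const l0)
    (jet_plus (jet_mult (jet_const l1) Hh)
    (jet_plus (jet_mult (jet_const l2) J2)
     (jet_mult (jet_const l3) J3)))).
  cbv beta in J.
  assert (JS : jet (fun z => h z * h z * (h z * h z) * S (h z))%C (RtoC 0) (RtoC 0) (RtoC 0) (RtoC 0)).
  { exists (fun z => H z * H z * (H z * H z) * S (h z))%C. split.
    - assert (BS := bnd_pull S H h HS BH EH). 
      apply (bnd_mult (fun z => H z * H z * (H z * H z))%C (fun z => S (h z))); [|exact BS]. bnd_auto.
    - eapply near0_mono; [|exact EH]. intros z A. simpl in *. rewrite A. ring. }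
  assert (J' := jet_plus J JS).
  eapply jet_eq; [eapply jet_ext; [|exact J']|ring|ring|ring|].
  - eapply near0_mono; [|exact EP]. intros z A. simpl in *. rewrite A. ring.
  - replace (RtoC 2) with (RtoC 1 + RtoC 1)%C by (rewrite <- RtoC_plus; f_equal; lra). ring.
Qed.

Lemma is_powser_jet {rho a f} : 0 < rho -> is_powser rho a f ->
  jet f (a 0%nat) (a 1%nat) (a 2%nat) (a 3%nat).
Proof.
  intros Hr H.
  destruct (is_powser_shift Hr H) as (f1 & H1 & E1).
  destruct (is_powser_shift Hr H1) as (f2 & H2 & E2).
  destruct (is_powser_shift Hr H2) as (f3 & H3 & E3).
  destruct (is_powser_shift Hr H3) as (f4 & H4 & E4).
  exists f4. split.
  - apply bnd_continuous. eapply is_powser_continuous; [exact H4|]. now rewrite Cmod_0.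
  - exists rho. split; [assumption|]. intros z Hz. rewrite E1, E2, E3, E4 by assumption. reflexivity.
Qed.

Lemma jet_value0 f a0 a1 a2 a3 : jet f a0 a1 a2 a3 -> f (RtoC 0) = a0.
Proof.
  intros (S & _ & d & Hd & E). rewrite (E (RtoC 0)); [ring|now rewrite Cmod_0].
Qed.

(** * Logarithmic inverse coefficients in terms of f *)

(** Substituting w = f z in exp (L w) w = F w gives exp (L (f z)) f z = z near
    0; the derivative of this identity, multiplied by f, is f = z f' (1 + f
    L'(f)). Working with f inside avoids the differentiability of F. The three
    equations are the coefficients of z^2, z^3, z^4. *)
Theorem log_inverse_relation (f F : C -> C) (Gamma a : nat -> C) :
  is_powser 1 a f -> a 0%nat = RtoC 0 -> a 1%nat = RtoC 1 ->
  inverse_on_disc (1 / 4) f F -> log_inverse_coefficients F Gamma ->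
  (RtoC 2 * Gamma 1%nat = - a 2%nat /\
   RtoC 4 * Gamma 2%nat = RtoC 3 * (a 2%nat * a 2%nat) - RtoC 2 * a 3%nat /\
   RtoC 6 * Gamma 3%nat = - RtoC 3 * a 4%nat + RtoC 12 * (a 2%nat * a 3%nat) - RtoC 10 * (a 2%nat * a 2%nat * a 2%nat))%C.
Proof.
  intros Ha Ha0 Ha1 [HF1 HF2] (L & [HL0 HL] & HS).
  assert (Hf0 : f (RtoC 0) = RtoC 0) by (rewrite (is_powser_0 1 a f Rlt_0_1 Ha); exact Ha0).
  set (lam := fun n => match n with O => RtoC 0 | S k => (RtoC 2 * Gamma (S k))%C end).
  assert (Hlam : is_powser (1 / 4) lam L).
  { intros w Hw. destruct (HS w Hw) as (T & HT & ->).
    replace (RtoC 2 * T)%C with (lam 0%nat * w ^ 0 + RtoC 2 * T)%C by (simpl; ring).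
    apply (is_series_C_shift (fun n => lam n * w ^ n)%C).
    eapply is_series_C_ext; [|apply is_series_C_scal; exact HT].
    intros n. cbv beta. replace (n + 1)%nat with (S n) by lia. unfold lam. ring. }
  destruct (is_powser_C_derive Hlam) as [Hl HLd].
  destruct (is_powser_C_derive Ha) as [Hf' Hfd].
  assert (HCexp : forall w, Cmod w < 1 / 4 -> (Cexp (L w) * w)%C = F w).
  { intros w Hw. destruct (excluded_middle_informative (w = RtoC 0)) as [->|Hw0].
    - rewrite <- Hf0 at 3. rewrite HF2; [ring|rewrite Cmod_0; lra|rewrite Hf0, Cmod_0; lra].
    - destruct (HL w Hw) as [_ ->]; [field|]; assumption. }
  assert (Near : near0 (fun z => Cmod z < 1 /\ Cmod (f z) < 1 / 4)).
  { apply near0_and; [apply near0_disc; lra|].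
    assert (Cf : continuous f (RtoC 0)) by (eapply is_powser_continuous; [exact Ha|rewrite Cmod_0; lra]).
    destruct (proj1 (continuous_C_eps _ _) Cf (1 / 4)) as [d [Hd Hd']]; [lra|].
    exists d. split; [assumption|]. intros z Hz. specialize (Hd' z).
    replace (z - RtoC 0)%C with z in Hd' by ring. rewrite Hf0 in Hd'.
    replace (f z - RtoC 0)%C with (f z) in Hd' by ring. now apply Hd'. }
  destruct Near as (d & Hd & Near).
  assert (Rel : forall z, Cmod z < d ->
     (f z = z * (C_derive f z * (1 + f z * C_derive L (f z))))%C).
  { intros z Hz. destruct (Near z Hz) as [Hz1 Hz2].
    assert (D1 := is_derive_C_comp Cexp (fun u => L (f u)) z _ _ (Cexp_derive (L (f z)))
       (is_derive_C_comp L f z _ _ (HLd _ Hz2) (Hfd _ Hz1))).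
    assert (D2 := is_derive_C_mult D1 (Hfd _ Hz1)). cbv beta in D2.
    assert (D3 : is_derive (fun u => Cexp (L (f u)) * f u)%C z (RtoC 1)).
    { apply (is_derive_C_ext_loc (fun u => u) _ _ _ (d - Cmod z)); [lra| |apply is_derive_C_id].
      intros u Hu. assert (Hud : Cmod u < d).
      { assert (Y := Cmod_le_add u z). lra. }
      destruct (Near u Hud) as [Hu1 Hu2]. rewrite HCexp by assumption. symmetry. now apply HF2. }
    assert (E := eq_trans (eq_sym (is_C_derive_unique _ _ _ D2)) (is_C_derive_unique _ _ _ D3)).
    assert (Ez : (Cexp (L (f z)) * f z)%C = z) by (rewrite HCexp by assumption; now apply HF2).
    transitivity (Cexp (L (f z)) * f z * (C_derive f z * (1 + f z * C_derive L (f z))))%C; [|now rewrite Ez].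
    apply (f_equal (fun c => f z * c)%C) in E.
    transitivity (f z * RtoC 1)%C; [ring|]. rewrite <- E. ring. }
  destruct (is_powser_shift Rlt_0_1 Ha) as (phi & Hphi & Ephi).
  assert (Jphi := is_powser_jet Rlt_0_1 Hphi).
  assert (Jf := is_powser_jet Rlt_0_1 Ha). rewrite Ha0, Ha1 in Jf.
  assert (Jf' := is_powser_jet Rlt_0_1 Hf').
  assert (Hq : 0 < 1 / 4) by lra.
  assert (Jl := is_powser_jet Hq Hl).
  assert (Jlf := jet_comp _ _ _ _ _ _ _ _ _ Jl Jf).
  assert (J := jet_mult Jf' (jet_plus (jet_const (RtoC 1)) (jet_mult Jf Jlf))).
  cbv beta in J.
  assert (J0 := jet_value0 _ _ _ _ _ J). assert (P0 := jet_value0 _ _ _ _ _ Jphi). cbv beta in J0, P0.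
  assert (Jphi2 : jet (fun z => C_derive f z * (1 + f z * C_derive L (f z)))%C (a 1%nat) (a 2%nat) (a 3%nat) (a 4%nat)).
  { apply jet_ext with phi; [|exact Jphi]. exists (Rmin 1 d). split; [apply Rmin_glb_lt; lra|].
    intros z Hz. assert (Hz1 := Rlt_le_trans _ _ _ Hz (Rmin_l _ _)).
    assert (Hz2 := Rlt_le_trans _ _ _ Hz (Rmin_r _ _)).
    destruct (excluded_middle_informative (z = RtoC 0)) as [->|Hz0].
    - rewrite P0, J0, Ha1. unfold deriv_coef. rewrite Ha1. simpl. ring.
    - transitivity (/ z * f z)%C.
      + rewrite Ephi, Ha0 by assumption. field. assumption.
      + rewrite (Rel z Hz2) at 1. field. assumption. }
  destruct (jet_unique J Jphi2) as (_ & X1 & X2 & X3).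
  unfold deriv_coef, lam in X1, X2, X3. rewrite Ha1 in X1, X2, X3.
  replace (INR 1) with 1 in * by (simpl; lra). replace (INR 2) with 2 in * by (simpl; lra).
  replace (INR 3) with 3 in * by (simpl; lra). replace (INR 4) with 4 in * by (simpl; lra).
  set (b2 := a 2%nat) in *. set (b3 := a 3%nat) in *. set (b4 := a 4%nat) in *.
  set (g1 := Gamma 1%nat) in *. set (g2 := Gamma 2%nat) in *. set (g3 := Gamma 3%nat) in *.
  assert (Z1 : (RtoC 2 * g1 = - b2)%C) by (apply (Ceq_comb _ _ _ _ (RtoC 1) X1); ring).
  assert (G1 : g1 = (- (/ RtoC 2) * b2)%C).
  { transitivity (/ RtoC 2 * (RtoC 2 * g1))%C; [field|rewrite Z1; ring]. }
  assert (Z2 : (RtoC 4 * g2 = RtoC 3 * (b2 * b2) - RtoC 2 * b3)%C).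
  { apply (Ceq_comb _ _ _ _ (RtoC 1) X2). rewrite G1. field. }
  assert (G2 : g2 = (/ RtoC 4 * (RtoC 3 * (b2 * b2) - RtoC 2 * b3))%C).
  { rewrite <- Z2. field. }
  split; [exact Z1|]. split; [exact Z2|].
  apply (Ceq_comb _ _ _ _ (RtoC 1) X3). rewrite G1, G2. field.
Qed.

(** * Caratheodory functions with a rotated Schwarz function *)

Definition caratheodory (p : C -> C) : Prop :=
  holomorphic_on_disc 1 p /\ p (RtoC 0) = RtoC 1 /\ forall z, Cmod z < 1 -> 0 < Re (p z).

Lemma holomorphic_jet p : holomorphic_on_disc 1 p -> exists c0 c1 c2 c3, jet p c0 c1 c2 c3.
Proof.
  intros H. destruct (holomorphic_is_powser 1 p Rlt_0_1 H) as [c Hc].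
  exists (c 0%nat), (c 1%nat), (c 2%nat), (c 3%nat). now apply (is_powser_jet Rlt_0_1).
Qed.

Lemma caratheodory_jet_bound {p c0 c1 c2 c3} : caratheodory p -> jet p c0 c1 c2 c3 ->
  c0 = RtoC 1 /\ Cmod c1 <= 2 /\ Cmod c2 <= 2 /\ Cmod c3 <= 2.
Proof.
  intros (Hh & H0 & Hp) J.
  destruct (holomorphic_is_powser 1 p Rlt_0_1 Hh) as [c Hc].
  destruct (jet_unique J (is_powser_jet Rlt_0_1 Hc)) as (-> & -> & -> & ->).
  assert (E : c 0%nat = RtoC 1) by (rewrite <- H0; symmetry; apply (is_powser_0 1); [lra|assumption]).
  assert (B := fun n => caratheodory_bound c p n Hc E (fun z Hz => Rlt_le _ _ (Hp z Hz))).
  repeat split; auto.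
Qed.

Lemma Re_pos_nonzero z : 0 < Re z -> z <> RtoC 0.
Proof. intros H ->. rewrite re_RtoC in H. lra. Qed.

Lemma Cdiv_conj_form (n d : C) : d <> RtoC 0 ->
  (n / d)%C = (RtoC (/ Cmod d ^ 2) * (n * Cconj d))%C.
Proof.
  intros Hd. assert (Hm : 0 < Cmod d) by now apply Cmod_gt_0.
  rewrite RtoC_inv by (apply Rgt_not_eq, pow_lt, Hm). rewrite Cmod2_conj.
  assert (Hc : Cconj d <> RtoC 0).
  { intros Q. apply Hd. rewrite <- (Cconj_conj d), Q. apply Cconj_0. }
  field. split; assumption.
Qed.

Lemma Re_div (n d : C) : d <> RtoC 0 -> 0 < Re (n * Cconj d)%C -> 0 < Re (n / d)%C.
Proof.
  intros Hd H. rewrite Cdiv_conj_form, re_scal_l by assumption.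
  apply Rmult_lt_0_compat; [|assumption]. now apply Rinv_0_lt_compat, pow_lt, Cmod_gt_0.
Qed.

(** If omega = (p - 1) / (p + 1), this is (1 + eps omega) / (1 - eps omega). *)
Definition schwarz_rotate (eps : C) (p : C -> C) (z : C) : C :=
  (((1 + eps) * p z + (1 - eps)) / ((1 - eps) * p z + (1 + eps)))%C.

(** This real part is |1 + eps|^2 Re w + |1 - eps|^2 Re w = 4 Re w, because (1 +
    eps) (1 - conj eps) is imaginary on the unit circle. *)
Lemma schwarz_rotate_Re eps w : Cmod eps = 1 -> 0 < Re w ->
  0 < Re (((1 + eps) * w + (1 - eps)) * Cconj ((1 - eps) * w + (1 + eps)))%C.
Proof.
  intros He Hw. assert (E := Cmod2_alt eps). rewrite He in E.
  destruct eps as [x y], w as [u v]. unfold Re, Im in *; simpl in *.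
  match goal with |- 0 < ?a => replace a with (2 * u * (1 + (x * x + y * y))
    + (1 - (x * x + y * y)) * (1 + u * u + v * v)) by ring end.
  assert (E' : x * x + y * y = 1) by lra. rewrite E'. lra.
Qed.

Lemma schwarz_rotate_den eps w : Cmod eps = 1 -> 0 < Re w -> ((1 - eps) * w + (1 + eps))%C <> RtoC 0.
Proof.
  intros He Hw Q. assert (H := schwarz_rotate_Re eps w He Hw). rewrite Q in H.
  replace (((1 + eps) * w + (1 - eps)) * Cconj (RtoC 0))%C with (RtoC 0) in H.
  - rewrite re_RtoC in H. lra.
  - rewrite Cconj_0. ring.
Qed.

Lemma caratheodory_rotate eps p : Cmod eps = 1 -> caratheodory p -> caratheodory (schwarz_rotate eps p).
Proof.
  intros He (Hh & H0 & Hp). split; [|split].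
  - intros z Hz. destruct (Hh z Hz) as [l Hl].
    assert (DN := is_derive_C_plus (is_derive_C_mult (is_derive_C_const (1 + eps)%C z) Hl) (is_derive_C_const (1 - eps)%C z)).
    assert (DD := is_derive_C_plus (is_derive_C_mult (is_derive_C_const (1 - eps)%C z) Hl) (is_derive_C_const (1 + eps)%C z)).
    cbv beta in DN, DD.
    eexists. exact (is_derive_C_div DN DD (schwarz_rotate_den eps (p z) He (Hp z Hz))).
  - unfold schwarz_rotate. rewrite H0.
    replace ((1 + eps) * 1 + (1 - eps))%C with (RtoC 2) by ring.
    replace ((1 - eps) * 1 + (1 + eps))%C with (RtoC 2) by ring. field.
  - intros z Hz. unfold schwarz_rotate. apply Re_div; [apply schwarz_rotate_den|apply schwarz_rotate_Re]; auto.
Qed.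

(** The coefficients follow from multiplying the defining quotient by its
    denominator. *)
Lemma jet_schwarz_rotate eps p c1 c2 c3 : Cmod eps = 1 -> caratheodory p -> jet p (RtoC 1) c1 c2 c3 ->
  jet (schwarz_rotate eps p) (RtoC 1) (eps * c1)%C (eps * (c2 - (1 - eps) / 2 * (c1 * c1)))%C
    (eps * (c3 - (1 - eps) * (c1 * c2) + (1 - eps) / 2 * ((1 - eps) / 2) * (c1 * c1 * c1)))%C.
Proof.
  intros He Hc J. assert (Hr := caratheodory_rotate eps p He Hc).
  destruct (holomorphic_jet _ (proj1 Hr)) as (d0 & d1 & d2 & d3 & Jd).
  assert (D0 : d0 = RtoC 1) by apply (caratheodory_jet_bound Hr Jd). subst d0.
  assert (JN := jet_plus (jet_mult (jet_const (1 + eps)%C) J) (jet_const (1 - eps)%C)).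
  assert (JD := jet_plus (jet_mult (jet_const (1 - eps)%C) J) (jet_const (1 + eps)%C)).
  assert (JM := jet_mult Jd JD). cbv beta in JM, JN.
  assert (NE : near0 (fun z => schwarz_rotate eps p z * ((1 - eps) * p z + (1 + eps)) = (1 + eps) * p z + (1 - eps))%C).
  { exists 1. split; [lra|]. intros z Hz. unfold schwarz_rotate. field. apply schwarz_rotate_den; [assumption|].
    now apply (proj2 (proj2 Hc)). }
  apply (jet_ext _ _ _ _ _ _ NE) in JM.
  destruct (jet_unique JM JN) as (_ & X1 & X2 & X3).
  assert (E1 : d1 = (eps * c1)%C) by (apply (Ceq_comb _ _ _ _ (/ 2)%C X1); field).
  assert (E2 : d2 = (eps * (c2 - (1 - eps) / 2 * (c1 * c1)))%C).
  { apply (Ceq_comb _ _ _ _ (/ 2)%C X2). rewrite E1. field. }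
  apply (jet_eq _ _ _ _ _ _ _ _ _ Jd); auto.
  apply (Ceq_comb _ _ _ _ (/ 2)%C X3). rewrite E1, E2. field.
Qed.

Definition caratheodory_coeffs (c1 c2 c3 : C) : Prop :=
  exists p, caratheodory p /\ jet p (RtoC 1) c1 c2 c3.

(** * Bounds for the coefficient functionals *)

Lemma rotate_third {c1 c2 c3} (H : caratheodory_coeffs c1 c2 c3) eps : Cmod eps = 1 ->
  Cmod (c3 - (1 - eps) * (c1 * c2) + (1 - eps) / 2 * ((1 - eps) / 2) * (c1 * c1 * c1))%C <= 2.
Proof.
  destruct H as (p & Hp & J). intros He. destruct (caratheodory_jet_bound (caratheodory_rotate eps p He Hp) (jet_schwarz_rotate eps p c1 c2 c3 He Hp J)) as (_ & _ & _ & B).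
  rewrite Cmod_mult, He in B. lra.
Qed.

Lemma rotate_second {c1 c2 c3} (H : caratheodory_coeffs c1 c2 c3) eps : Cmod eps = 1 -> Cmod (c2 - (1 - eps) / 2 * (c1 * c1))%C <= 2.
Proof.
  destruct H as (p & Hp & J). intros He. destruct (caratheodory_jet_bound (caratheodory_rotate eps p He Hp) (jet_schwarz_rotate eps p c1 c2 c3 He Hp J)) as (_ & _ & B & _).
  rewrite Cmod_mult, He in B. lra.
Qed.

Lemma coeff_bounds {c1 c2 c3} (H : caratheodory_coeffs c1 c2 c3) : Cmod c1 <= 2 /\ Cmod c2 <= 2 /\ Cmod c3 <= 2.
Proof. destruct H as (p & Hp & J). apply (caratheodory_jet_bound Hp J). Qed.

(** The rotation by eps = -1 is 1/p. *)
Lemma inverse_second {c1 c2 c3} (H : caratheodory_coeffs c1 c2 c3) : Cmod (c2 - c1 * c1)%C <= 2.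
Proof.
  assert (B := (rotate_second H) (- (1))%C ltac:(rewrite Cmod_opp; apply Cmod_1)).
  replace (c2 - c1 * c1)%C with (c2 - (1 - - (1)) / 2 * (c1 * c1))%C by field. exact B.
Qed.

Lemma inverse_third {c1 c2 c3} (H : caratheodory_coeffs c1 c2 c3) : Cmod (c3 - 2 * (c1 * c2) + c1 * c1 * c1)%C <= 2.
Proof.
  assert (B := (rotate_third H) (- (1))%C ltac:(rewrite Cmod_opp; apply Cmod_1)).
  replace (c3 - 2 * (c1 * c2) + c1 * c1 * c1)%C with
   (c3 - (1 - - (1)) * (c1 * c2) + (1 - - (1)) / 2 * ((1 - - (1)) / 2) * (c1 * c1 * c1))%C by field. exact B.
Qed.

Lemma Cmod_comb2 (s t : R) (x y : C) : Cmod (RtoC s * x + RtoC t * y)%C <= Rabs s * Cmod x + Rabs t * Cmod y.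
Proof. norm_split. rewrite !Cmod_mult, !Cmod_R. lra. Qed.

(** A convex combination of the second coefficients of p and, up to sign, of
    1/p. *)
Lemma quadratic_bound_low c1 c2 c3 (H : caratheodory_coeffs c1 c2 c3) v : 0 <= v <= 1 -> Cmod (c2 - RtoC v * (c1 * c1))%C <= 2.
Proof.
  intros Hv. assert (B1 := proj1 (proj2 (coeff_bounds H))). assert (B2 := inverse_second H).
  replace (c2 - RtoC v * (c1 * c1))%C with (RtoC (1 - v) * c2 + RtoC v * (c2 - c1 * c1))%C
    by (rewrite RtoC_minus; ring).
  eapply Rle_trans; [apply Cmod_comb2|]. rewrite !Rabs_pos_eq by lra. nra.
Qed.

Lemma c1_sq_bound {c1 c2 c3} (H : caratheodory_coeffs c1 c2 c3) : Cmod (c1 * c1)%C <= 4.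
Proof. rewrite Cmod_mult. assert (B := proj1 (coeff_bounds H)). assert (X := Cmod_ge_0 c1). nra. Qed.

Lemma c1_cube_bound {c1 c2 c3} (H : caratheodory_coeffs c1 c2 c3) : Cmod (c1 * c1 * c1)%C <= 8.
Proof.
  rewrite Cmod_mult. assert (B := proj1 (coeff_bounds H)). assert (X := Cmod_ge_0 c1). assert (Y := c1_sq_bound H).
  assert (Z := Cmod_ge_0 (c1 * c1)%C). nra.
Qed.

(** The second coefficient of 1/p, up to sign, plus a multiple of c_1^2. *)
Lemma quadratic_bound_high c1 c2 c3 (H : caratheodory_coeffs c1 c2 c3) v : 1 <= v -> Cmod (c2 - RtoC v * (c1 * c1))%C <= 4 * v - 2.
Proof.
  intros Hv. assert (B2 := inverse_second H). assert (B := c1_sq_bound H).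
  replace (c2 - RtoC v * (c1 * c1))%C with (RtoC 1 * (c2 - c1 * c1) + RtoC (1 - v) * (c1 * c1))%C
    by (rewrite RtoC_minus; ring).
  eapply Rle_trans; [apply Cmod_comb2|]. rewrite Rabs_R1, Rabs_left1 by lra. nra.
Qed.

(** The functional to which Gamma_3 is proportional. For B = D = 1 it is the
    third coefficient of -1/p. *)
Definition cubic (c1 c2 c3 : C) (B D : R) : C := (c3 - RtoC (2 * B) * (c1 * c2) + RtoC D * (c1 * c1 * c1))%C.

(** Here the extremal value is the one of c_n = 2. With d_1, d_2, d_3 the
    coefficients of 1/p, the functional is -d_3 - 2 (B - 1) d_1 d_2 - (D + 1 - 2
    B) d_1^3, and each term is estimated by |d_n| <= 2. *)
Lemma cubic_bound_steep c1 c2 c3 (H : caratheodory_coeffs c1 c2 c3) B D : 1 <= B -> 2 * B <= D + 1 -> Cmod (cubic c1 c2 c3 B D) <= 2 - 8 * B + 8 * D.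
Proof.
  intros HB HD. assert (B1 := inverse_third H). assert (B2 := inverse_second H). assert (B3 := c1_cube_bound H).
  assert (B4 : Cmod (c1 * (c2 - c1 * c1))%C <= 4).
  { rewrite Cmod_mult. assert (Q := proj1 (coeff_bounds H)). assert (X := Cmod_ge_0 c1).
    assert (Y := Cmod_ge_0 (c2 - c1 * c1)%C). nra. }
  replace (cubic c1 c2 c3 B D) with (RtoC 1 * (c3 - 2 * (c1 * c2) + c1 * c1 * c1) + RtoC 1 * (RtoC (2 - 2 * B) * (c1 * (c2 - c1 * c1)) + RtoC (D + 1 - 2 * B) * (c1 * c1 * c1)))%C.
  2:{ unfold cubic. rewrite !RtoC_minus, RtoC_plus, !RtoC_mult. ring. }
  eapply Rle_trans; [apply Cmod_comb2|]. rewrite Rabs_R1.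
  eapply Rle_trans; [apply Rplus_le_compat_l, Rmult_le_compat_l; [lra|apply Cmod_comb2]|].
  rewrite Rabs_left1, Rabs_pos_eq by lra. nra.
Qed.

(** A convex combination of the third coefficients of p and of -1/p. *)
Lemma cubic_bound_diag {c1 c2 c3} (H : caratheodory_coeffs c1 c2 c3) B : 0 <= B <= 1 -> Cmod (cubic c1 c2 c3 B B) <= 2.
Proof.
  intros HB. assert (B1 := inverse_third H). assert (B2 := proj2 (proj2 (coeff_bounds H))).
  replace (cubic c1 c2 c3 B B) with (RtoC (1 - B) * c3 + RtoC B * (c3 - 2 * (c1 * c2) + c1 * c1 * c1))%C.
  2:{ unfold cubic. rewrite RtoC_minus, RtoC_mult. ring. }
  eapply Rle_trans; [apply Cmod_comb2|]. rewrite !Rabs_pos_eq by lra. nra.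
Qed.

Lemma cubic_bound_mid c1 c2 c3 (H : caratheodory_coeffs c1 c2 c3) B D : 0 <= B <= 1 -> B <= D -> Cmod (cubic c1 c2 c3 B D) <= 2 - 8 * B + 8 * D.
Proof.
  intros HB HD. assert (B1 := (cubic_bound_diag H) B HB). assert (B3 := c1_cube_bound H).
  replace (cubic c1 c2 c3 B D) with (RtoC 1 * cubic c1 c2 c3 B B + RtoC (D - B) * (c1 * c1 * c1))%C.
  2:{ unfold cubic. rewrite RtoC_minus. ring. }
  eapply Rle_trans; [apply Cmod_comb2|]. rewrite Rabs_R1, Rabs_pos_eq by lra. nra.
Qed.

(** Averaging the third coefficients over the rotations by eps and conj eps on
    the unit circle gives D = 2 B^2 - B when Re eps = 1 - 2 B. *)
Lemma cubic_bound_parabola {c1 c2 c3} (H : caratheodory_coeffs c1 c2 c3) B : 0 <= B <= 1 -> Cmod (cubic c1 c2 c3 B (2 * B ^ 2 - B)) <= 2.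
Proof.
  intros HB. set (x := 1 - 2 * B). set (y := sqrt (1 - x ^ 2)).
  assert (Hx : 0 <= 1 - x ^ 2) by (unfold x; nra).
  assert (Hy : y * y = 1 - x ^ 2) by now apply sqrt_sqrt.
  assert (M : forall t, t * t = 1 - x ^ 2 -> Cmod (x, t) = 1).
  { intros t Ht. unfold Cmod; simpl. replace (x * (x * 1) + t * (t * 1)) with 1 by (simpl in Ht; lra). apply sqrt_1. }
  assert (B1 := (rotate_third H) (x, y) (M y Hy)).
  assert (B2 := (rotate_third H) (x, - y) (M (- y) ltac:(lra))).
  replace (cubic c1 c2 c3 B (2 * B ^ 2 - B)) with
    (RtoC (/ 2) * (c3 - (1 - (x, y)) * (c1 * c2) + (1 - (x, y)) / 2 * ((1 - (x, y)) / 2) * (c1 * c1 * c1))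
    + RtoC (/ 2) * (c3 - (1 - (x, (-y)%R)) * (c1 * c2) + (1 - (x, (-y)%R)) / 2 * ((1 - (x, (-y)%R)) / 2) * (c1 * c1 * c1)))%C.
  - eapply Rle_trans; [apply Cmod_comb2|]. rewrite !Rabs_pos_eq by lra. lra.
  - assert (E1 : ((x, y) = RtoC x + Ci * RtoC y)%C) by (unfold RtoC, Ci, Cplus, Cmult; simpl; f_equal; ring).
    assert (E2 : ((x, (-y)%R) = RtoC x - Ci * RtoC y)%C) by (unfold RtoC, Ci, Cminus, Copp, Cplus, Cmult; simpl; f_equal; ring).
    assert (EC : (Ci * Ci = - (1))%C) by (unfold RtoC, Ci, Copp, Cmult; simpl; f_equal; ring).
    assert (EY : (RtoC y * RtoC y = 1 - RtoC x * RtoC x)%C).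
    { rewrite <- !RtoC_mult, Hy, <- RtoC_minus. f_equal. ring. }
    unfold cubic. rewrite E1, E2. rewrite RtoC_inv by lra.
    replace (RtoC (2 * B)) with (1 - RtoC x)%C by (rewrite <- RtoC_minus; f_equal; unfold x; ring).
    replace (RtoC (2 * B ^ 2 - B)) with (/ 2 * (RtoC x * RtoC x - RtoC x))%C
      by (rewrite <- RtoC_inv, <- RtoC_mult, <- RtoC_minus, <- RtoC_mult by lra; f_equal; unfold x; field).
    transitivity (c3 - (1 - RtoC x) * (c1 * c2) + / 4 * ((1 - RtoC x) * (1 - RtoC x) + (Ci * Ci) * (RtoC y * RtoC y)) * (c1 * c1 * c1))%C.
    + field.
    + rewrite EC, EY. field.
Qed.

(** For fixed B the functional is affine in D, so it suffices to know the bound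
    at the two endpoints. *)
Lemma cubic_bound_flat c1 c2 c3 (H : caratheodory_coeffs c1 c2 c3) B D : 0 < B < 1 -> 2 * B ^ 2 - B <= D <= B -> Cmod (cubic c1 c2 c3 B D) <= 2.
Proof.
  intros HB HD. assert (B1 := (cubic_bound_diag H) B ltac:(lra)). assert (B2 := (cubic_bound_parabola H) B ltac:(lra)).
  assert (Hd : 0 < 2 * (B - B ^ 2)) by nra.
  set (t := (D - (2 * B ^ 2 - B)) / (2 * (B - B ^ 2))).
  assert (Ht : t * (2 * (B - B ^ 2)) = D - (2 * B ^ 2 - B)) by (unfold t; field; nra).
  assert (Ht0 : 0 <= t) by (apply Rdiv_le_0_compat; lra).
  assert (Ht1 : t <= 1) by nra.
  replace (cubic c1 c2 c3 B D) with (RtoC t * cubic c1 c2 c3 B B + RtoC (1 - t) * cubic c1 c2 c3 B (2 * B ^ 2 - B))%C.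
  - eapply Rle_trans; [apply Cmod_comb2|]. rewrite !Rabs_pos_eq by lra. nra.
  - unfold cubic. replace D with (t * B + (1 - t) * (2 * B ^ 2 - B)) by lra.
    rewrite (RtoC_plus (t * B)), (RtoC_mult t B), (RtoC_mult (1 - t)), !(RtoC_minus 1 t). ring.
Qed.

(** * The class W(alpha) and the upper bounds *)

Definition W_op (alpha : R) (f : C -> C) (z : C) : C :=
  (C_derive f z + RtoC alpha * z * C_derive (C_derive f) z)%C.

Lemma W_op_powser alpha rho a f : is_powser rho a f ->
  is_powser rho (fun n => RtoC (1 + INR n * alpha) * deriv_coef a n)%C (W_op alpha f).
Proof.
  intros Ha. destruct (is_powser_C_derive Ha) as [H1 _].
  destruct (is_powser_C_derive H1) as [H2 _].
  intros z Hz. specialize (H1 z Hz). specialize (H2 z Hz).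
  assert (H3 : Cseries (fun n => RtoC (INR n) * deriv_coef a n * z ^ n)%C
     (z * C_derive (C_derive f) z)%C).
  { assert (E : (z * C_derive (C_derive f) z)%C = (RtoC (INR 0) * deriv_coef a 0 * z ^ 0 + z * C_derive (C_derive f) z)%C :> C)
      by (change (INR 0) with 0; ring).
    rewrite E. apply (is_series_C_shift (fun n => RtoC (INR n) * deriv_coef a n * z ^ n)%C).
    eapply is_series_C_ext; [|apply is_series_C_scal; exact H2].
    intros n. cbv beta. unfold deriv_coef at 1. rewrite Cpow_S. ring. }
  unfold W_op. rewrite <- Cmult_assoc.
  eapply is_series_C_ext; [|exact (is_series_C_plus _ _ _ _ H1 (is_series_C_scal (RtoC alpha) _ _ H3))].
  intros n. cbv beta. rewrite RtoC_plus, RtoC_mult. ring.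
Qed.

(** With this v and the B and D that follow, Gamma_2 is a multiple of c_2 - v
    c_1^2 and Gamma_3 of the cubic functional. *)
Definition weight_v (alpha : R) : R := 9 * (1 + 2 * alpha) / (8 * (1 + alpha) ^ 2).
Definition weight_B (alpha : R) : R := 4 * (1 + 3 * alpha) / (3 * (1 + alpha) * (1 + 2 * alpha)).
Definition weight_D (alpha : R) : R := 5 * (1 + 3 * alpha) / (3 * (1 + alpha) ^ 3).

Lemma RtoC_neq0 x : x <> 0 -> RtoC x <> RtoC 0.
Proof. intros H Q. injection Q. assumption. Qed.

Theorem gamma_formula alpha f F Gamma c1 c2 c3 : 0 <= alpha -> class_A f ->
  inverse_on_disc (1 / 4) f F -> log_inverse_coefficients F Gamma ->
  jet (W_op alpha f) (RtoC 1) c1 c2 c3 ->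
  Gamma 1%nat = (RtoC (- / (4 * (1 + alpha))) * c1)%C /\
  Gamma 2%nat = (RtoC (- / (6 * (1 + 2 * alpha))) * (c2 - RtoC (weight_v alpha) * (c1 * c1)))%C /\
  Gamma 3%nat = (RtoC (- / (8 * (1 + 3 * alpha))) * cubic c1 c2 c3 (weight_B alpha) (weight_D alpha))%C.
Proof.
  intros Hal (Hh & Hf0 & Hf1) HF HL J.
  destruct (holomorphic_is_powser 1 f Rlt_0_1 Hh) as [a Ha].
  assert (Ha0 : a 0%nat = RtoC 0) by (rewrite <- (is_powser_0 1 a f Rlt_0_1 Ha); exact Hf0).
  assert (Ha1 : a 1%nat = RtoC 1).
  { rewrite <- Hf1. rewrite (is_powser_0 1 (deriv_coef a) (C_derive f) Rlt_0_1 (proj1 (is_powser_C_derive Ha))).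
    unfold deriv_coef. simpl. ring. }
  destruct (log_inverse_relation f F Gamma a Ha Ha0 Ha1 HF HL) as (G1 & G2 & G3).
  destruct (jet_unique J (is_powser_jet Rlt_0_1 (W_op_powser alpha 1 a f Ha))) as (_ & -> & -> & ->).
  unfold deriv_coef.
  replace (INR 1) with 1 in * by (simpl; lra). replace (INR 2) with 2 in * by (simpl; lra).
  replace (INR 3) with 3 in * by (simpl; lra). replace (INR 4) with 4 in * by (simpl; lra).
  set (b2 := a 2%nat) in *. set (b3 := a 3%nat) in *. set (b4 := a 4%nat) in *.
  assert (N1 : (1 + RtoC alpha)%C <> RtoC 0) by (rewrite <- RtoC_plus; apply RtoC_neq0; lra).
  assert (N2 : (1 + 2 * RtoC alpha)%C <> RtoC 0) by (rewrite <- RtoC_mult, <- RtoC_plus; apply RtoC_neq0; lra).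
  assert (N3 : (1 + 3 * RtoC alpha)%C <> RtoC 0) by (rewrite <- RtoC_mult, <- RtoC_plus; apply RtoC_neq0; lra).
  assert (P1 : 0 < 1 + alpha) by lra. assert (P1' : 0 < (1 + alpha) ^ 2) by (apply pow_lt; lra).
  assert (P1'' : 0 < (1 + alpha) ^ 3) by (apply pow_lt; lra).
  assert (Q : forall x y k : C, k <> RtoC 0 -> (k * x = y -> x = y / k)%C).
  { intros x y k Hk <-. field. assumption. }
  apply Q in G1; [|apply RtoC_neq0; lra]. apply Q in G2; [|apply RtoC_neq0; lra]. apply Q in G3; [|apply RtoC_neq0; lra].
  rewrite G1, G2, G3. clear G1 G2 G3.
  unfold cubic, weight_v, weight_B, weight_D, Rdiv.
  assert (PB : 0 < 3 * (1 + alpha) * (1 + 2 * alpha)) by (repeat apply Rmult_lt_0_compat; lra).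
  repeat split.
  - rewrite RtoC_opp, RtoC_inv by lra. rewrite !RtoC_plus, !RtoC_mult, !RtoC_plus. field. exact N1.
  - rewrite RtoC_opp, !RtoC_mult, !RtoC_inv by lra.
    rewrite ?RtoC_plus, ?RtoC_mult, ?RtoC_pow, ?RtoC_plus, ?RtoC_mult. field. auto.
  - rewrite RtoC_opp, !RtoC_mult, !RtoC_inv by lra.
    rewrite ?RtoC_plus, ?RtoC_mult, ?RtoC_pow, ?RtoC_plus, ?RtoC_mult. field. auto.
Qed.

Lemma class_W_caratheodory alpha f : class_W alpha f -> caratheodory (W_op alpha f).
Proof.
  intros [(Hh & Hf0 & Hf1) Hp].
  destruct (holomorphic_is_powser 1 f Rlt_0_1 Hh) as [a Ha].
  split; [|split].
  - eapply is_powser_holomorphic. apply (W_op_powser alpha 1 a f Ha).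
  - unfold W_op. rewrite Hf1. ring.
  - exact Hp.
Qed.

Lemma sqrt5_bounds : 2.236 < sqrt 5 < 2.237.
Proof.
  assert (H := sqrt_sqrt 5 ltac:(lra)). assert (H0 := sqrt_pos 5). split; nra.
Qed.

Lemma alpha3_root : 4 * alpha3 ^ 2 = 2 * alpha3 + 1.
Proof.
  unfold alpha3. assert (H := sqrt_sqrt 5 ltac:(lra)). nra.
Qed.

(** v >= 1 is 8 alpha^2 - 2 alpha - 1 <= 0, whose positive root is 1/2. *)
Lemma bound2_low alpha : 0 <= alpha < 1 / 2 ->
  1 <= weight_v alpha /\ bound2 alpha = (4 * weight_v alpha - 2) / (6 * (1 + 2 * alpha)).
Proof.
  intros Ha. unfold bound2, weight_v. destruct (Rlt_dec alpha (1 / 2)); [|lra]. split.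
  - apply Rmult_le_reg_r with (8 * (1 + alpha) ^ 2); [nra|].
    unfold Rdiv. rewrite Rmult_assoc, Rinv_l by nra. nra.
  - field. lra.
Qed.

Lemma bound2_high alpha : 1 / 2 <= alpha ->
  0 <= weight_v alpha <= 1 /\ bound2 alpha = 2 / (6 * (1 + 2 * alpha)).
Proof.
  intros Ha. unfold bound2, weight_v. destruct (Rlt_dec alpha (1 / 2)); [lra|]. split; [split|].
  - apply Rdiv_le_0_compat; nra.
  - apply Rmult_le_reg_r with (8 * (1 + alpha) ^ 2); [nra|].
    unfold Rdiv. rewrite Rmult_assoc, Rinv_l by nra. nra.
  - field. lra.
Qed.

Lemma Rle_div_cross a b c d : 0 < b -> 0 < d -> a * d <= c * b -> a / b <= c / d.
Proof.
  intros Hb Hd H. apply Rmult_le_reg_r with (b * d); [nra|].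
  replace (a / b * (b * d)) with (a * d) by (field; lra).
  replace (c / d * (b * d)) with (c * b) by (field; lra). assumption.
Qed.

(** Since D / B = 5 (1 + 2 alpha) / (4 (1 + alpha)^2), the sign of D - B is that
    of 1 + 2 alpha - 4 alpha^2, which vanishes at alpha3. *)
Lemma weight_relation alpha : 0 <= alpha -> weight_D alpha * (4 * (1 + alpha) ^ 2) = weight_B alpha * (5 * (1 + 2 * alpha)).
Proof. intros Ha. unfold weight_B, weight_D. field. lra. Qed.

Lemma weight_B_pos alpha : 0 <= alpha -> 0 < weight_B alpha.
Proof.
  intros Ha. unfold weight_B. apply Rdiv_lt_0_compat; [lra|]. repeat apply Rmult_lt_0_compat; lra.
Qed.

(** Both regimes B >= 1 and B <= 1 occur in this range. The first one ends at
    the positive root of 6 x^2 - 3 x - 1, which lies below 0.73; the inequality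
    2 B <= D + 1 is then a polynomial one in alpha, with equality at alpha = 0.
    *)
Lemma bound3_low alpha : 0 <= alpha <= alpha3 ->
  bound3 alpha = (2 - 8 * weight_B alpha + 8 * weight_D alpha) / (8 * (1 + 3 * alpha)) /\
  weight_B alpha <= weight_D alpha /\ (1 <= weight_B alpha -> 2 * weight_B alpha <= weight_D alpha + 1).
Proof.
  intros Ha. assert (A3 := alpha3_root). assert (S5 := sqrt5_bounds).
  assert (HA : 0.80 < alpha3 < 0.81) by (unfold alpha3; lra).
  split; [|split].
  - unfold bound3. destruct (Rle_dec alpha alpha3); [|lra]. unfold weight_B, weight_D. field. lra.
  - assert (R := weight_relation alpha (proj1 Ha)). assert (P := weight_B_pos alpha (proj1 Ha)).
    assert (4 * alpha ^ 2 <= 2 * alpha + 1) by nra.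
    apply Rmult_le_reg_r with (4 * (1 + alpha) ^ 2); [nra|]. rewrite R. apply Rmult_le_compat_l; nra.
  - intros HB.
    assert (Q : alpha < 0.73).
    { destruct (Rlt_le_dec alpha 0.73) as [|K]; [assumption|exfalso].
      assert (weight_B alpha < 1); [|lra]. unfold weight_B.
      apply Rmult_lt_reg_r with (3 * (1 + alpha) * (1 + 2 * alpha)); [nra|].
      unfold Rdiv. rewrite Rmult_assoc, Rinv_l by nra. nra. }
    unfold weight_B, weight_D.
    apply Rmult_le_reg_r with (3 * (1 + alpha) ^ 3 * (1 + 2 * alpha)).
    { apply Rmult_lt_0_compat; [|lra]. apply Rmult_lt_0_compat; [lra|]. apply pow_lt. lra. }
    replace (2 * (4 * (1 + 3 * alpha) / (3 * (1 + alpha) * (1 + 2 * alpha))) * (3 * (1 + alpha) ^ 3 * (1 + 2 * alpha)))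
      with (8 * (1 + 3 * alpha) * (1 + alpha) ^ 2) by (field; lra).
    replace ((5 * (1 + 3 * alpha) / (3 * (1 + alpha) ^ 3) + 1) * (3 * (1 + alpha) ^ 3 * (1 + 2 * alpha)))
      with (5 * (1 + 3 * alpha) * (1 + 2 * alpha) + 3 * (1 + alpha) ^ 3 * (1 + 2 * alpha)) by (field; lra).
    destruct Ha as [Ha _]. ring_simplify. 
    assert (0 <= alpha * alpha) by nra. nra.
Qed.

(** After clearing denominators, 2 B^2 - B <= D is 24 alpha^3 + 24 alpha^2 - 20
    alpha - 5 >= 0, which holds from alpha = 0.8 on. *)
Lemma bound3_high alpha : alpha3 < alpha ->
  bound3 alpha = 2 / (8 * (1 + 3 * alpha)) /\
  0 < weight_B alpha < 1 /\ 2 * weight_B alpha ^ 2 - weight_B alpha <= weight_D alpha <= weight_B alpha.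
Proof.
  intros Ha. assert (A3 := alpha3_root). assert (S5 := sqrt5_bounds).
  assert (HA : 0.80 < alpha3 < 0.81) by (unfold alpha3; lra).
  assert (H0 : 0 <= alpha) by lra.
  assert (R := weight_relation alpha H0). assert (P := weight_B_pos alpha H0).
  assert (B1 : weight_B alpha < 1).
  { unfold weight_B. apply Rmult_lt_reg_r with (3 * (1 + alpha) * (1 + 2 * alpha)); [nra|].
    unfold Rdiv. rewrite Rmult_assoc, Rinv_l by nra. nra. }
  split; [|split; [lra|split]].
  - unfold bound3. destruct (Rle_dec alpha alpha3); [lra|]. field. lra.
  - assert (E : weight_B alpha * (3 * (1 + alpha) * (1 + 2 * alpha)) = 4 * (1 + 3 * alpha)) by (unfold weight_B; field; lra).
    apply Rmult_le_reg_r with (4 * (1 + alpha) ^ 2); [nra|]. rewrite R.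
    replace ((2 * weight_B alpha ^ 2 - weight_B alpha) * (4 * (1 + alpha) ^ 2)) with (weight_B alpha * ((2 * weight_B alpha - 1) * (4 * (1 + alpha) ^ 2))) by ring.
    apply Rmult_le_compat_l; [lra|].
    apply Rmult_le_reg_r with (3 * (1 + 2 * alpha)); [lra|].
    replace ((2 * weight_B alpha - 1) * (4 * (1 + alpha) ^ 2) * (3 * (1 + 2 * alpha))) with
      (8 * (1 + alpha) * (weight_B alpha * (3 * (1 + alpha) * (1 + 2 * alpha))) - 12 * (1 + alpha) ^ 2 * (1 + 2 * alpha)) by ring.
    rewrite E. ring_simplify. nra.
  - assert (2 * alpha + 1 <= 4 * alpha ^ 2) by nra.
    apply Rmult_le_reg_r with (4 * (1 + alpha) ^ 2); [nra|]. rewrite R. apply Rmult_le_compat_l; nra.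
Qed.

Lemma Cmod_scaled (k : R) (x : C) (M : R) : 0 < k -> Cmod x <= M -> Cmod (RtoC (- / k) * x)%C <= M / k.
Proof.
  intros Hk Hx. rewrite Cmod_mult, Cmod_R, Rabs_Ropp, Rabs_pos_eq by (left; now apply Rinv_0_lt_compat).
  unfold Rdiv. rewrite Rmult_comm. apply Rmult_le_compat_r; [left; now apply Rinv_0_lt_compat|assumption].
Qed.

Theorem upper_bounds alpha f F Gamma : 0 <= alpha -> class_W alpha f ->
  inverse_on_disc (1 / 4) f F -> log_inverse_coefficients F Gamma ->
  Cmod (Gamma 1%nat) <= bound1 alpha /\
  Cmod (Gamma 2%nat) <= bound2 alpha /\
  Cmod (Gamma 3%nat) <= bound3 alpha.
Proof.
  intros Ha HW HF HL. assert (Hc := class_W_caratheodory alpha f HW).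
  destruct (holomorphic_jet _ (proj1 Hc)) as (c0 & c1 & c2 & c3 & J).
  assert (E0 := proj1 (caratheodory_jet_bound Hc J)). subst c0.
  assert (H : caratheodory_coeffs c1 c2 c3) by (exists (W_op alpha f); split; assumption).
  destruct (gamma_formula alpha f F Gamma c1 c2 c3 Ha (proj1 HW) HF HL J) as (-> & -> & ->).
  split; [|split].
  - replace (bound1 alpha) with (2 / (4 * (1 + alpha))) by (unfold bound1; field; lra).
    apply Cmod_scaled; [lra|]. apply (coeff_bounds H).
  - destruct (Rlt_le_dec alpha (1 / 2)) as [Hl|Hl].
    + destruct (bound2_low alpha (conj Ha Hl)) as [Hv ->]. apply Cmod_scaled; [lra|].
      now apply quadratic_bound_high with c3.
    + destruct (bound2_high alpha Hl) as [Hv ->]. apply Cmod_scaled; [lra|].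
      now apply quadratic_bound_low with c3.
  - destruct (Rle_lt_dec alpha alpha3) as [Hl|Hl].
    + destruct (bound3_low alpha (conj Ha Hl)) as (-> & H1 & H2). apply Cmod_scaled; [lra|].
      assert (P := weight_B_pos alpha Ha).
      destruct (Rle_lt_dec 1 (weight_B alpha)).
      * apply cubic_bound_steep; auto.
      * apply cubic_bound_mid; auto. lra.
    + destruct (bound3_high alpha Hl) as (-> & H1 & H2). apply Cmod_scaled; [lra|].
      now apply cubic_bound_flat.
Qed.

(** * Functions with prescribed f' + alpha z f'' *)

(** The equation f' + alpha z f'' = p prescribes the coefficients of f, and they
    are dominated by those of p. *)
Lemma W_op_surjective alpha p : 0 <= alpha -> holomorphic_on_disc 1 p -> p (RtoC 0) = RtoC 1 ->
  exists f, class_A f /\ forall z, Cmod z < 1 -> W_op alpha f z = p z.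
Proof.
  intros Hal Hp Hp0. destruct (holomorphic_is_powser 1 p Rlt_0_1 Hp) as [c Hc].
  set (a := fun n => match n with O => RtoC 0 | S k => (RtoC (/ (INR (S k) * (1 + INR k * alpha))) * c k)%C end).
  assert (Hden : forall k, 1 <= INR (S k) * (1 + INR k * alpha)).
  { intros k. rewrite S_INR. assert (X := pos_INR k). assert (0 <= INR k * alpha) by now apply Rmult_le_pos. nra. }
  assert (Hser : forall z, exists s, Cmod z < 1 -> Cseries (fun n => a n * z ^ n)%C s).
  { intros z. destruct (Rlt_le_dec (Cmod z) 1) as [Hz|Hz]; [|exists (RtoC 0); intros; lra].
    assert (Hz0 := Cmod_ge_0 z).
    set (r := (Cmod z + 1) / 2). assert (Hr : Cmod z < r < 1) by (unfold r; lra).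
    destruct (is_powser_bound 1 c p r Hc ltac:(lra)) as [M [HM HB]].
    assert (Hq : 0 <= Cmod z / r < 1).
    { split; [apply Rdiv_le_0_compat; lra|]. apply Rmult_lt_reg_r with r; [lra|].
      unfold Rdiv. rewrite Rmult_assoc, Rinv_l; lra. }
    destruct (ex_series_C_le (fun n => a (S n) * z ^ S n)%C (fun n => M * (Cmod z / r) ^ n)) as [s Hs].
    - intros n. unfold a. rewrite !Cmod_mult, Cmod_pow, Cmod_R.
      rewrite Rabs_pos_eq by (left; apply Rinv_0_lt_compat; specialize (Hden n); lra).
      assert (I : / (INR (S n) * (1 + INR n * alpha)) <= 1).
      { assert (I := Rinv_le_contravar 1 _ Rlt_0_1 (Hden n)). rewrite Rinv_1 in I. exact I. }
      assert (I0 : 0 < / (INR (S n) * (1 + INR n * alpha))) by (apply Rinv_0_lt_compat; specialize (Hden n); lra).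
      assert (E : Cmod z ^ n = (Cmod z / r) ^ n * r ^ n).
      { rewrite <- Rpow_mult_distr. f_equal. field. lra. }
      change (Cmod z ^ S n) with (Cmod z * Cmod z ^ n).
      assert (P1 : 0 <= Cmod z ^ n) by now apply pow_le.
      assert (P2 : 0 <= (Cmod z / r) ^ n) by now apply pow_le.
      assert (C0 := Cmod_ge_0 (c n)).
      apply Rle_trans with (Cmod (c n) * Cmod z ^ n).
      + rewrite <- (Rmult_1_l (Cmod (c n) * Cmod z ^ n)).
        replace (/ (INR (S n) * (1 + INR n * alpha)) * Cmod (c n) * (Cmod z * Cmod z ^ n))
          with ((/ (INR (S n) * (1 + INR n * alpha)) * Cmod z) * (Cmod (c n) * Cmod z ^ n)) by ring.
        apply Rmult_le_compat_r; [now apply Rmult_le_pos|]. nra.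
      + rewrite E. specialize (HB n).
        replace (Cmod (c n) * ((Cmod z / r) ^ n * r ^ n)) with (Cmod (c n) * r ^ n * (Cmod z / r) ^ n) by ring.
        now apply Rmult_le_compat_r.
    - apply (ex_series_scal_l (V := R_NormedModule)). apply ex_series_geom.
      rewrite Rabs_pos_eq; lra.
    - exists (a 0%nat * z ^ 0 + s)%C. intros _.
      now apply (is_series_C_shift (fun n => a n * z ^ n)%C). }
  set (f := fun z => proj1_sig (constructive_indefinite_description _ (Hser z))).
  assert (Hf : is_powser 1 a f).
  { intros z Hz. unfold f. destruct (constructive_indefinite_description _ (Hser z)) as [s Hs].
    now apply Hs. }
  assert (HW : forall z, Cmod z < 1 -> W_op alpha f z = p z).
  { intros z Hz. apply (is_series_C_unique (fun n => c n * z ^ n)%C); [|now apply Hc].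
    eapply is_series_C_ext; [|apply (W_op_powser alpha 1 a f Hf z Hz)].
    intros n. cbv beta. unfold deriv_coef, a. rewrite !Cmult_assoc, <- !RtoC_mult.
    replace ((1 + INR n * alpha) * INR (S n) * / (INR (S n) * (1 + INR n * alpha))) with 1; [ring|].
    specialize (Hden n). set (x := INR (S n)) in *. set (y := 1 + INR n * alpha) in *.
    field. split; intros Q; rewrite Q in Hden; lra. }
  exists f. split; [|exact HW]. split; [|split].
  - eapply is_powser_holomorphic, Hf.
  - apply (is_powser_0 1 a f Rlt_0_1 Hf).
  - rewrite (is_powser_0 1 (deriv_coef a) (C_derive f) Rlt_0_1 (proj1 (is_powser_C_derive Hf))).
    unfold deriv_coef, a. rewrite <- (is_powser_0 1 c p Rlt_0_1 Hc), Hp0. simpl.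
    replace (1 * (1 + 0 * alpha)) with 1 by ring. rewrite Rinv_1. ring.
Qed.

(** * Minima on closed discs and the size of f' *)

(** Compactness of the closed disc: an estimate that holds with some d near
    every point holds with one d everywhere, provided that it weakens as d
    decreases. *)
Lemma disc_uniform (r : R) (Q : C -> R -> Prop) :
  (forall u d d', 0 < d <= d' -> Q u d' -> Q u d) ->
  (forall z, Cmod z <= r -> exists d, 0 < d /\
      forall u, Cmod u <= r -> Cmod (u - z)%C < d -> Q u d) ->
  exists d, 0 < d /\ forall u, Cmod u <= r -> Q u d.
Proof.
  intros Hmon Hloc.
  assert (L : forall x y : R, exists d : posreal, forall u, Cmod u <= r ->
     Rabs (fst u - x) < d -> Rabs (snd u - y) < d -> Q u d).
  { intros x y.
    assert (T : forall u : C, Cmod (u - (x, y))%C <= Rabs (fst u - x) + Rabs (snd u - y)).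
    { intros [u1 u2]. replace ((u1, u2) - (x, y))%C with (RtoC (u1 - x) + Ci * RtoC (u2 - y))%C.
      - norm_split. rewrite Cmod_mult, Cmod_Ci, !Cmod_R. simpl. lra.
      - unfold RtoC, Cminus, Cplus, Copp, Cmult, Ci; simpl. f_equal; ring. }
    destruct (Rle_lt_dec (Cmod (x, y)) r) as [Hz|Hz].
    - destruct (Hloc (x, y) Hz) as [d [Hd H]].
      assert (Hd2 : 0 < d / 2) by lra. exists (mkposreal _ Hd2). intros u Hu H1 H2. simpl in *.
      apply Hmon with d; [lra|]. apply H; [assumption|]. specialize (T u). lra.
    - assert (Hd : 0 < (Cmod (x, y) - r) / 2) by lra. exists (mkposreal _ Hd). intros u Hu H1 H2. simpl in *.
      exfalso. specialize (T u).
      assert (Cmod (x, y) <= Cmod u + Cmod (u - (x, y))%C).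
      { replace (Cmod (x, y)) with (Cmod (u - (u - (x, y)))%C).
        - norm_split. rewrite Cmod_opp. lra.
        - f_equal. generalize ((x, y) : C). intros c. ring. }
      lra. }
  set (delta := fun x y => proj1_sig (constructive_indefinite_description _ (L x y))).
  assert (Hdelta : forall x y u, Cmod u <= r -> Rabs (fst u - x) < delta x y -> Rabs (snd u - y) < delta x y -> Q u (delta x y)).
  { intros x y. unfold delta. exact (proj2_sig (constructive_indefinite_description _ (L x y))). }
  destruct (compactness_value_2d (- r) r (- r) r delta) as [d Hd].
  exists d. split; [apply cond_pos|]. intros u Hu. apply NNPP. intros HQ.
  assert (M := Rmax_Cmod u).
  assert (M1 : Rabs (fst u) <= r) by (eapply Rle_trans; [eapply Rle_trans; [apply Rmax_l|exact M]|exact Hu]).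
  assert (M2 : Rabs (snd u) <= r) by (eapply Rle_trans; [eapply Rle_trans; [apply Rmax_r|exact M]|exact Hu]).
  apply Rabs_le_between in M1. apply Rabs_le_between in M2.
  apply (Hd (fst u) (snd u) M1 M2). intros (x & y & _ & _ & H1 & H2 & H3).
  apply HQ. apply Hmon with (delta x y); [split; [apply cond_pos|exact H3]|]. now apply Hdelta.
Qed.

(** Two uses of compactness: with -1/d as lower bound it shows that h is bounded
    below, and with m + d as lower bound that the infimum m is attained. *)
Lemma disc_min (r : R) (h : C -> R) : 0 <= r ->
  (forall z, Cmod z <= r -> forall eps, 0 < eps -> exists d, 0 < d /\
     forall u, Cmod (u - z)%C < d -> Rabs (h u - h z) < eps) ->
  exists z0, Cmod z0 <= r /\ forall z, Cmod z <= r -> h z0 <= h z.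
Proof.
  intros Hr Hc.
  destruct (disc_uniform r (fun u d => - / d <= h u)) as [d [Hd Hb]].
  { intros u d d' Hd H. assert (/ d' <= / d) by (apply Rinv_le_contravar; lra). lra. }
  { intros z Hz. destruct (Hc z Hz 1 Rlt_0_1) as [d [Hd H]].
    assert (Ha := Rabs_pos (h z)).
    assert (Hi : 0 < / (Rabs (h z) + 1)) by (apply Rinv_0_lt_compat; lra).
    exists (Rmin d (/ (Rabs (h z) + 1))). split; [now apply Rmin_glb_lt|].
    intros u Hu Hud. assert (H1 := H u (Rlt_le_trans _ _ _ Hud (Rmin_l _ _))).
    apply Rabs_lt_between in H1.
    assert (I : Rabs (h z) + 1 <= / Rmin d (/ (Rabs (h z) + 1))).
    { rewrite <- (Rinv_inv (Rabs (h z) + 1)) at 1. apply Rinv_le_contravar; [now apply Rmin_glb_lt|apply Rmin_r]. }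
    assert (Hz2 := Rle_abs (- h z)). rewrite Rabs_Ropp in Hz2. lra. }
  destruct (completeness (fun y => exists z, Cmod z <= r /\ y = - h z)) as [m [Hm1 Hm2]].
  { exists (/ d). intros y (z & Hz & ->). specialize (Hb z Hz). lra. }
  { exists (- h (RtoC 0)), (RtoC 0). rewrite Cmod_0. auto. }
  apply NNPP. intros Hno.
  assert (Hgt : forall z, Cmod z <= r -> - m < h z).
  { intros z Hz. assert (H := Hm1 (- h z) (ex_intro _ z (conj Hz eq_refl))).
    destruct (Req_dec (h z) (- m)) as [E|E]; [|lra]. exfalso. apply Hno. exists z. split; [assumption|].
    intros u Hu. assert (H' := Hm1 (- h u) (ex_intro _ u (conj Hu eq_refl))). lra. }
  destruct (disc_uniform r (fun u d => - m + d <= h u)) as [e [He Hb2]].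
  { intros u x x' Hx H. lra. }
  { intros z Hz. assert (H := Hgt z Hz). destruct (Hc z Hz ((h z + m) / 2)) as [x [Hx H']]; [lra|].
    exists (Rmin x ((h z + m) / 2)). split; [apply Rmin_glb_lt; lra|].
    intros u Hu Hud. assert (H1 := H' u (Rlt_le_trans _ _ _ Hud (Rmin_l _ _))).
    apply Rabs_lt_between in H1. assert (Y := Rmin_r x ((h z + m) / 2)). lra. }
  assert (B : m <= m - e).
  { apply Hm2. intros y (z & Hz & ->). specialize (Hb2 z Hz). lra. }
  lra.
Qed.

Lemma Re_continuous_eps f z : continuous f z -> forall eps, 0 < eps -> exists d, 0 < d /\
  forall u, Cmod (u - z)%C < d -> Rabs (Re (f u) - Re (f z)) < eps.
Proof.
  intros H eps He. destruct (proj1 (continuous_C_eps f z) H eps He) as [d [Hd H']].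
  exists d. split; [assumption|]. intros u Hu. eapply Rle_lt_trans; [|apply (H' u Hu)].
  replace (Re (f u) - Re (f z)) with (Re (f u - f z)%C).
  - apply re_le_Cmod.
  - unfold Cminus. rewrite re_plus, re_opp. reflexivity.
Qed.

Lemma Cmod_dist (x y : C) : Rabs (Cmod x - Cmod y) <= Cmod (x - y)%C.
Proof.
  assert (A1 : Cmod x <= Cmod (x - y)%C + Cmod y).
  { replace x with ((x - y) + y)%C at 1 by ring. apply Cmod_triangle. }
  assert (A2 : Cmod y <= Cmod (x - y)%C + Cmod x).
  { replace y with (- (x - y) + x)%C at 1 by ring.
    norm_split. rewrite Cmod_opp. lra. }
  apply Rabs_le. lra.
Qed.

Lemma Re_line_derive g g' k u v t : is_derive g (line u v t) g' ->
  is_derive (fun s => Re (k * g (line u v s))%C) t (Re (k * (g' * (v - u)))%C).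
Proof.
  intros H.
  assert (D := is_derive_curve_comp g (line u v) t _ _ H (line_derive u v t)).
  assert (Dk := is_derive_C_mult (is_derive_C_const k (g (line u v t))) (is_derive_C_id (g (line u v t)))).
  assert (D2 := is_derive_curve_comp _ (fun s => g (line u v s)) t _ _ Dk D). cbv beta in D2.
  assert (D3 := is_derive_curve_Re _ _ _ D2). cbv beta in D3.
  replace (k * (g' * (v - u)))%C with ((RtoC 0 * g (line u v t) + k * RtoC 1) * (g' * (v - u)))%C by ring.
  exact D3.
Qed.

(** Let z0 be a point of the closed disc where Re f' is minimal. Along the ray
    from 0 the minimum is reached at the endpoint z0, so the radial derivative
    Re (z0 f''(z0)) is not positive; hence Re f'(z0) >= Re (f' + alpha z
    f'')(z0). *)
Theorem Re_derive_lower alpha f r mu : 0 <= alpha -> 0 <= r < 1 -> holomorphic_on_disc 1 f ->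
  (forall z, Cmod z <= r -> mu <= Re (W_op alpha f z)) ->
  forall z, Cmod z <= r -> mu <= Re (C_derive f z).
Proof.
  intros Hal Hr Hf HW z Hz.
  destruct (holomorphic_is_powser 1 f Rlt_0_1 Hf) as [a Ha].
  destruct (is_powser_C_derive Ha) as [H1 D1].
  destruct (is_powser_C_derive H1) as [H2 D2].
  destruct (disc_min r (fun z => Re (C_derive f z))) as (z0 & Hz0 & Hmin); [lra| |].
  { intros u Hu. apply Re_continuous_eps. eapply is_powser_continuous; [exact H1|lra]. }
  apply Rle_trans with (Re (C_derive f z0)); [|now apply Hmin].
  assert (HD : is_derive (fun s => Re (RtoC 1 * C_derive f (line (RtoC 0) z0 s))%C) 1
      (Re (RtoC 1 * (C_derive (C_derive f) z0 * (z0 - RtoC 0)))%C)).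
  { apply Re_line_derive. replace (line (RtoC 0) z0 1) with z0 by (unfold line; ring). apply D2. lra. }
  set (l := Re (RtoC 1 * (C_derive (C_derive f) z0 * (z0 - RtoC 0)))%C) in HD.
  assert (Hl : l <= 0).
  { apply Rnot_lt_le. intros Hl. apply is_derive_Reals in HD.
    destruct (HD (l / 2)) as [d Hd]; [lra|]. 
    (* a step backwards along the ray *)
    set (k := - (Rmin d 1 / 2)). assert (Hk : 0 < Rmin d 1) by (apply Rmin_glb_lt; [apply cond_pos|lra]).
    assert (K1 := Rmin_l d 1). assert (K2 := Rmin_r d 1).
    specialize (Hd k ltac:(unfold k; lra)).
    rewrite Rabs_left in Hd by (unfold k; lra). specialize (Hd ltac:(unfold k; lra)).
    replace (line (RtoC 0) z0 1) with z0 in Hd by (unfold line; ring).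
    assert (Q := Hmin (line (RtoC 0) z0 (1 + k))).
    assert (Q' : Cmod (line (RtoC 0) z0 (1 + k)) <= r).
    { apply line_disc; [rewrite Cmod_0; lra|assumption|unfold k; lra]. }
    specialize (Q Q'). rewrite !Cmult_1_l in Hd.
    apply Rabs_lt_between in Hd.
    assert (X : 0 < (Re (C_derive f (line 0 z0 (1 + k))) - Re (C_derive f z0)) / k) by lra.
    assert (Hik : / k < 0) by (apply Rinv_lt_0_compat; unfold k; lra). unfold Rdiv in X. nra. }
  specialize (HW z0 Hz0). unfold W_op in HW. rewrite re_plus in HW.
  replace (RtoC alpha * z0 * C_derive (C_derive f) z0)%C with
    (RtoC alpha * (RtoC 1 * (C_derive (C_derive f) z0 * (z0 - RtoC 0))))%C in HW by ring.
  rewrite re_scal_l in HW. fold l in HW. nra.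
Qed.

(** * Injectivity, covering and the inverse function *)

Lemma MVT_unit (phi dphi : R -> R) :
  (forall t, 0 <= t <= 1 -> is_derive phi t (dphi t)) ->
  exists c, 0 <= c <= 1 /\ phi 1 - phi 0 = dphi c.
Proof.
  intros D. destruct (MVT_gen phi 0 1 dphi) as (c & Hc & E).
  - intros x Hx. rewrite Rmin_left, Rmax_right in Hx by lra. apply D. lra.
  - intros x Hx. rewrite Rmin_left, Rmax_right in Hx by lra.
    apply continuity_pt_filterlim. apply (ex_derive_continuous (V := R_NormedModule)).
    exists (dphi x). now apply D.
  - rewrite Rmin_left, Rmax_right in Hc by lra. exists c. split; [exact Hc|]. lra.
Qed.

(** The mean value theorem for the real part of f / (v - u) on the segment from
    u to v; with kappa > 0 this is the injectivity criterion of Noshiro and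
    Warschawski. *)
Lemma expansion_of_Re_derive (f : C -> C) (r kappa : R) : 0 < r ->
  (forall z, Cmod z <= r -> is_derive f z (C_derive f z)) ->
  (forall z, Cmod z <= r -> kappa <= Re (C_derive f z)) ->
  forall u v, Cmod u <= r -> Cmod v <= r -> kappa * Cmod (v - u)%C <= Cmod (f v - f u)%C.
Proof.
  intros Hr Hd Hk u v Hu Hv.
  destruct (excluded_middle_informative (v = u)) as [->|Hne].
  { replace (u - u)%C with (RtoC 0) by ring. rewrite Cmod_0, Rmult_0_r. apply Cmod_ge_0. }
  assert (Hvu : (v - u)%C <> RtoC 0).
  { intros Q. now apply Hne, Csub_0_eq. }
  set (phi := fun s => Re (/ (v - u) * f (line u v s))%C).
  set (dphi := fun s => Re (/ (v - u) * (C_derive f (line u v s) * (v - u)))%C).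
  assert (Hl : forall t, 0 <= t <= 1 -> Cmod (line u v t) <= r) by (intros; now apply line_disc).
  assert (D : forall t, 0 <= t <= 1 -> is_derive phi t (dphi t)).
  { intros t Ht. apply Re_line_derive, Hd, Hl, Ht. }
  destruct (MVT_unit phi dphi D) as (c & Hc & E).
  assert (K : kappa <= dphi c).
  { unfold dphi. replace (/ (v - u) * (C_derive f (line u v c) * (v - u)))%C with (C_derive f (line u v c)) by (field; assumption).
    apply Hk, Hl, Hc. }
  assert (E2 : phi 1 - phi 0 = Re ((f v - f u) / (v - u))%C).
  { unfold phi. replace (line u v 1) with v by (unfold line; ring). replace (line u v 0) with u by (unfold line; ring).
    replace ((f v - f u) / (v - u))%C with (/ (v - u) * f v - / (v - u) * f u)%C by (field; assumption).
    unfold Cminus. rewrite re_plus, re_opp. reflexivity. }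
  assert (X := re_le_Cmod ((f v - f u) / (v - u))%C).
  rewrite Cmod_div in X by assumption.
  assert (P : 0 < Cmod (v - u)%C) by now apply Cmod_gt_0.
  assert (Y := Rle_abs (Re ((f v - f u) / (v - u))%C)).
  assert (Z : kappa <= Cmod (f v - f u)%C / Cmod (v - u)%C) by lra.
  apply Rmult_le_compat_r with (r := Cmod (v - u)%C) in Z; [|lra].
  unfold Rdiv in Z. rewrite Rmult_assoc, Rinv_l, Rmult_1_r in Z by lra. exact Z.
Qed.

(** The polynomial is the integral over [0, r] of (1 - s) (1 - s + s^2 / 2), a
    lower bound of (1 - s) / (1 + s) which is close enough to it: at r = 4/5 the
    result exceeds 1/3. *)
Lemma radial_growth (f : C -> C) (r : R) : 0 < r < 1 -> f (RtoC 0) = RtoC 0 ->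
  (forall z, Cmod z <= r -> is_derive f z (C_derive f z)) ->
  (forall z, Cmod z <= r -> (1 - Cmod z) / (1 + Cmod z) <= Re (C_derive f z)) ->
  forall z, Cmod z = r -> r - r ^ 2 + r ^ 3 / 2 - r ^ 4 / 8 <= Cmod (f z).
Proof.
  intros Hr Hf0 Hd Hk z Hz.
  assert (Hz0 : z <> RtoC 0) by (apply Cmod_gt_0; lra).
  set (G := fun s => r * s - r ^ 2 * s ^ 2 + r ^ 3 * s ^ 3 / 2 - r ^ 4 * s ^ 4 / 8).
  set (dG := fun s => r - r ^ 2 * (2 * s) + r ^ 3 * (3 * s ^ 2) / 2 - r ^ 4 * (4 * s ^ 3) / 8).
  set (phi := fun s => Re (RtoC r / z * f (line (RtoC 0) z s))%C - G s).
  set (dphi := fun s => Re (RtoC r / z * (C_derive f (line (RtoC 0) z s) * (z - RtoC 0)))%C - dG s).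
  assert (Hl : forall t, 0 <= t <= 1 -> Cmod (line (RtoC 0) z t) = t * r).
  { intros t Ht. unfold line. replace (RtoC 0 + RtoC t * (z - RtoC 0))%C with (RtoC t * z)%C by ring.
    rewrite Cmod_mult, Cmod_R, Rabs_pos_eq, Hz by lra. reflexivity. }
  assert (D : forall t, 0 <= t <= 1 -> is_derive phi t (dphi t)).
  { intros t Ht. apply (is_derive_minus (V := R_NormedModule)).
    - apply Re_line_derive, Hd. rewrite Hl by assumption. nra.
    - unfold G, dG. auto_derive; [auto|]. simpl. field. }
  destruct (MVT_unit phi dphi D) as (c & Hc & E).
  assert (K : 0 <= dphi c).
  { unfold dphi.
    replace (RtoC r / z * (C_derive f (line (RtoC 0) z c) * (z - RtoC 0)))%C with (RtoC r * C_derive f (line (RtoC 0) z c))%C by (field; assumption).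
    rewrite re_scal_l. assert (Q := Hk (line (RtoC 0) z c)). rewrite (Hl c Hc) in Q.
    specialize (Q ltac:(nra)).
    set (s := c * r) in *. assert (Hs : 0 <= s <= 1) by (unfold s; nra).
    assert (B : (1 - s) * (1 - s + s ^ 2 / 2) <= (1 - s) / (1 + s)).
    { apply Rmult_le_reg_r with (1 + s); [lra|]. replace ((1 - s) / (1 + s) * (1 + s)) with (1 - s) by (field; lra).
      assert (0 <= s ^ 2 * (1 - s)) by (apply Rmult_le_pos; [apply pow_le; lra|lra]).
      assert (0 <= (1 - s) * (s ^ 2 * (1 - s))) by (apply Rmult_le_pos; lra). nra. }
    replace (dG c) with (r * ((1 - s) * (1 - s + s ^ 2 / 2))) by (unfold dG, s; field).
    assert (r * ((1 - s) * (1 - s + s ^ 2 / 2)) <= r * Re (C_derive f (line 0 z c))) by (apply Rmult_le_compat_l; lra).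
    lra. }
  assert (E2 : phi 1 - phi 0 = Re (RtoC r / z * f z)%C - (r - r ^ 2 + r ^ 3 / 2 - r ^ 4 / 8)).
  { unfold phi, G. replace (line (RtoC 0) z 1) with z by (unfold line; ring). replace (line (RtoC 0) z 0) with (RtoC 0) by (unfold line; ring).
    rewrite Hf0. replace (RtoC r / z * RtoC 0)%C with (RtoC 0) by ring. rewrite re_RtoC. lra. }
  assert (X := re_le_Cmod (RtoC r / z * f z)%C).
  rewrite Cmod_mult, Cmod_div, Cmod_R, Hz, (Rabs_pos_eq r) in X by (assumption || lra).
  replace (r / r * Cmod (f z)) with (Cmod (f z)) in X by (field; lra).
  assert (Y := Rle_abs (Re (RtoC r / z * f z)%C)). lra.
Qed.

(** If f takes at z0 a value closer to w than any value on the boundary circle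
    can be, |f - w| has an interior minimum; a short Newton step would decrease
    a nonzero minimum. *)
Lemma covering_step (f : C -> C) (r m : R) (z0 w : C) : 0 < r ->
  (forall z, Cmod z <= r -> is_derive f z (C_derive f z)) ->
  (forall z, Cmod z <= r -> C_derive f z <> RtoC 0) ->
  (forall z, Cmod z = r -> m <= Cmod (f z)) ->
  Cmod z0 <= r -> Cmod (f z0 - w)%C < m - Cmod w ->
  exists z, Cmod z < r /\ f z = w.
Proof.
  intros Hr Hd Hn Hm Hz0 H0.
  destruct (disc_min r (fun z => Cmod (f z - w)%C)) as (z1 & Hz1 & Hmin); [lra| |].
  { intros z Hz eps He. destruct (proj1 (continuous_C_eps f z) (is_derive_C_continuous _ _ _ (Hd z Hz)) eps He) as [d [Hdp Hd']].
    exists d. split; [assumption|]. intros u Hu. eapply Rle_lt_trans; [apply Cmod_dist|].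
    replace (f u - w - (f z - w))%C with (f u - f z)%C by ring. now apply Hd'. }
  assert (H1 : Cmod (f z1 - w)%C < m - Cmod w) by (eapply Rle_lt_trans; [apply Hmin; exact Hz0|exact H0]).
  assert (Hz1' : Cmod z1 < r).
  { destruct (Rle_lt_or_eq_dec _ _ Hz1) as [|Q]; [assumption|exfalso]. specialize (Hm z1 Q).
    assert (X : Cmod (f z1) <= Cmod (f z1 - w)%C + Cmod w).
    { replace (f z1) with ((f z1 - w) + w)%C at 1 by ring. apply Cmod_triangle. }
    lra. }
  exists z1. split; [assumption|].
  apply NNPP. intros Hw.
  assert (Hv : (f z1 - w)%C <> RtoC 0).
  { intros Q. now apply Hw, Csub_0_eq. }
  set (v := (f z1 - w)%C) in *. set (D := C_derive f z1). assert (HD : D <> RtoC 0) by (apply Hn; assumption).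
  assert (HvP : 0 < Cmod v) by now apply Cmod_gt_0.
  assert (HDP : 0 < Cmod D) by now apply Cmod_gt_0.
  destruct (proj1 (is_derive_C_eps f z1 D) (Hd z1 Hz1) (Cmod D / 2)) as [d [Hdp Hd']]; [lra|].
  set (k := Cmod v / Cmod D). assert (Hk : 0 < k) by (apply Rdiv_lt_0_compat; lra).
  (* The Newton step is shortened by a factor s that keeps it inside the disc and
     inside the range of the linear approximation. *)
  set (s := Rmin d (r - Cmod z1) / (2 * (k + Rmin d (r - Cmod z1)))).
  assert (Hmn : 0 < Rmin d (r - Cmod z1)) by (apply Rmin_glb_lt; lra).
  assert (Hs : 0 < s) by (apply Rdiv_lt_0_compat; lra).
  assert (Hs1 : s < 1).
  { unfold s. apply Rmult_lt_reg_r with (2 * (k + Rmin d (r - Cmod z1))); [lra|].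
    unfold Rdiv. rewrite Rmult_assoc, Rinv_l by lra. lra. }
  assert (Hsk : s * k < Rmin d (r - Cmod z1)).
  { unfold s. apply Rmult_lt_reg_r with (2 * (k + Rmin d (r - Cmod z1))); [lra|].
    replace (Rmin d (r - Cmod z1) / (2 * (k + Rmin d (r - Cmod z1))) * k * (2 * (k + Rmin d (r - Cmod z1))))
      with (Rmin d (r - Cmod z1) * k) by (field; lra). nra. }
  set (u := (z1 - RtoC s * (v / D))%C).
  assert (Hu : Cmod (u - z1)%C = s * k).
  { unfold u. replace (z1 - RtoC s * (v / D) - z1)%C with (- (RtoC s * (v / D)))%C by ring.
    rewrite Cmod_opp, Cmod_mult, Cmod_div, Cmod_R, Rabs_pos_eq by (assumption || lra). reflexivity. }
  assert (U1 := Rmin_l d (r - Cmod z1)). assert (U2 := Rmin_r d (r - Cmod z1)).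
  specialize (Hd' u ltac:(rewrite Hu; lra)).
  assert (Hur : Cmod u <= r).
  { replace u with (z1 + (u - z1))%C by ring. norm_split. rewrite Hu. lra. }
  specialize (Hmin u Hur). cbv beta in Hmin. fold v in Hmin.
  assert (T : Cmod (f u - w)%C <= (1 - s) * Cmod v + Cmod D / 2 * (s * k)).
  { rewrite <- Hu.
    replace (f u - w)%C with (RtoC (1 - s) * v + (f u - f z1 - D * (u - z1)))%C.
    - norm_split. rewrite Cmod_mult, Cmod_R, Rabs_pos_eq by lra. lra.
    - unfold u at 2. rewrite RtoC_minus. unfold v. field. assumption. }
  replace (Cmod D / 2 * (s * k)) with (s / 2 * Cmod v) in T by (unfold k; field; lra).
  nra.
Qed.

Lemma constant_of_derive_0 (rho : R) (E : C -> C) : (forall z, Cmod z < rho -> is_derive E z (RtoC 0)) ->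
  forall z, Cmod z < rho -> E z = E (RtoC 0).
Proof.
  intros H z Hz. assert (Hz0 := Cmod_ge_0 z).
  assert (S := seg_int_FTC E (fun _ => RtoC 0) (RtoC 0) z).
  assert (X : seg_int (fun _ => RtoC 0) (RtoC 0) z = RtoC 0) by (unfold seg_int; rewrite Cint_const; ring).
  rewrite X in S. replace (E z) with ((E z - E (RtoC 0)) + E (RtoC 0))%C by ring. rewrite <- S; [ring| |].
  - intros t Ht. apply H. eapply Rle_lt_trans; [apply (line_disc (RtoC 0) z t (Cmod z))|]; try lra.
    rewrite Cmod_0. lra.
  - intros t _. apply continuous_const.
Qed.

(** F w = w G w with G without zeros. A primitive L of G'/G makes exp (-L) G
    constant, and the constant is G 0 = 1. *)
Theorem log_exists rho F : 0 < rho -> holomorphic_on_disc rho F -> F (RtoC 0) = RtoC 0 ->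
  C_derive F (RtoC 0) = RtoC 1 -> (forall w, Cmod w < rho -> F w = RtoC 0 -> w = RtoC 0) ->
  exists L lam, is_powser rho lam L /\ lam 0%nat = RtoC 0 /\ log_branch_on_disc rho F L.
Proof.
  intros Hr HF HF0 HF1 Hnz.
  destruct (holomorphic_is_powser rho F Hr HF) as [A HA].
  destruct (is_powser_shift Hr HA) as (G & HG & EG).
  assert (A0 : A 0%nat = RtoC 0) by (rewrite <- (is_powser_0 rho A F Hr HA); exact HF0).
  assert (G0 : G (RtoC 0) = RtoC 1).
  { rewrite (is_powser_0 rho _ G Hr HG), <- HF1.
    rewrite (is_powser_0 rho (deriv_coef A) (C_derive F) Hr (proj1 (is_powser_C_derive HA))).
    unfold deriv_coef. simpl. ring. }
  assert (Gnz : forall w, Cmod w < rho -> G w <> RtoC 0).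
  { intros w Hw Q. assert (w = RtoC 0).
    { apply Hnz; [assumption|]. rewrite EG, Q, A0 by assumption. ring. }
    subst w. rewrite G0 in Q. injection Q. lra. }
  destruct (is_powser_C_derive HG) as [HG1 DG].
  assert (Hl : holomorphic_on_disc rho (fun w => C_derive G w / G w)%C).
  { intros w Hw. destruct (is_powser_holomorphic _ _ _ HG1 w Hw) as [l1 H1].
    eexists. exact (is_derive_C_div H1 (DG w Hw) (Gnz w Hw)). }
  destruct (holomorphic_primitive rho _ Hl) as (L & HL0 & HL).
  assert (HLh : holomorphic_on_disc rho L) by (intros w Hw; eexists; apply (HL w Hw)).
  destruct (holomorphic_is_powser rho L Hr HLh) as [lam Hlam].
  exists L, lam. split; [exact Hlam|]. split.
  { rewrite <- (is_powser_0 rho lam L Hr Hlam). exact HL0. }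
  assert (HE : forall w, Cmod w < rho -> (Cexp (- L w) * G w)%C = RtoC 1).
  { intros w Hw. rewrite (constant_of_derive_0 rho (fun w => Cexp (- L w) * G w)%C); auto.
    - rewrite HL0, G0. replace (- RtoC 0)%C with (RtoC 0) by ring. rewrite Cexp_0. ring.
    - intros u Hu.
      assert (DN := is_derive_C_minus (is_derive_C_const (RtoC 0) u) (HL u Hu)).
      assert (DE := is_derive_C_comp Cexp _ u _ _ (Cexp_derive _) DN).
      assert (DM := is_derive_C_mult DE (DG u Hu)). cbv beta in DM.
      apply (is_derive_C_ext_loc (fun u => Cexp (RtoC 0 - L u) * G u)%C _ _ _ 1); [lra| |].
      + intros x _. do 2 f_equal. ring.
      + assert (EZ : (Cexp (0 - L u) * (0 - C_derive G u / G u) * G u + Cexp (0 - L u) * C_derive G u)%C = RtoC 0)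
          by (field; now apply Gnz).
        rewrite EZ in DM. exact DM. }
  split; [exact HL0|]. intros w Hw. split.
  - eapply is_derive_C_continuous, (HL w Hw).
  - intros Hw0. rewrite EG, A0 by assumption.
    replace ((RtoC 0 + w * G w) / w)%C with (G w) by (field; assumption).
    transitivity (Cexp (L w) * (Cexp (- L w) * G w))%C; [rewrite HE by assumption; ring|].
    rewrite Cmult_assoc, <- Cexp_plus. replace (L w + - L w)%C with (RtoC 0) by ring.
    rewrite Cexp_0. ring.
Qed.

(** Values |w| < 1/4 are reached in two steps, from 0 to 2 w / 3 and from there
    to w. On |z| = 4/5 one has |f| >= 1/3, and both steps are shorter than the
    distance 1/3 - |w| that a covering step allows for its target. *)
Theorem inverse_exists f : class_A f ->
  (forall z, Cmod z < 1 -> (1 - Cmod z) / (1 + Cmod z) <= Re (C_derive f z)) ->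
  exists F Gamma, inverse_on_disc (1 / 4) f F /\ log_inverse_coefficients F Gamma.
Proof.
  intros (Hh & Hf0 & Hf1) Hre.
  destruct (holomorphic_is_powser 1 f Rlt_0_1 Hh) as [a Ha].
  destruct (is_powser_C_derive Ha) as [Ha' Hd].
  assert (Hre2 : forall r z, 0 < r < 1 -> Cmod z <= r -> (1 - r) / (1 + r) <= Re (C_derive f z)).
  { intros r z Hr Hz. assert (Hz0 := Cmod_ge_0 z). eapply Rle_trans; [|apply Hre; lra].
    apply Rle_div_cross; nra. }
  assert (Hpos : forall r, 0 < r < 1 -> 0 < (1 - r) / (1 + r)) by (intros; apply Rdiv_lt_0_compat; lra).
  assert (Hnz : forall z, Cmod z < 1 -> C_derive f z <> RtoC 0).
  { intros z Hz. apply Re_pos_nonzero. eapply Rlt_le_trans; [|apply Hre, Hz].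
    assert (Hz0 := Cmod_ge_0 z). apply Rdiv_lt_0_compat; lra. }
  assert (Gr : forall r u v, 0 < r < 1 -> Cmod u <= r -> Cmod v <= r ->
     (1 - r) / (1 + r) * Cmod (v - u)%C <= Cmod (f v - f u)%C).
  { intros r u v Hr. apply expansion_of_Re_derive; [lra| |].
    - intros z Hz. apply Hd. lra.
    - intros z Hz. now apply Hre2. }
  assert (Inj : forall u v, Cmod u < 1 -> Cmod v < 1 -> f u = f v -> u = v).
  { intros u v Hu Hv E. assert (Hu0 := Cmod_ge_0 u). assert (Hv0 := Cmod_ge_0 v).
    set (r := (Rmax (Cmod u) (Cmod v) + 1) / 2).
    assert (R1 := Rmax_l (Cmod u) (Cmod v)). assert (R2 := Rmax_r (Cmod u) (Cmod v)).
    assert (R3 : Rmax (Cmod u) (Cmod v) < 1) by now apply Rmax_lub_lt.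
    assert (Hr : 0 < r < 1) by (unfold r; lra).
    assert (X := Gr r v u Hr ltac:(unfold r; lra) ltac:(unfold r; lra)).
    rewrite E in X. replace (f v - f v)%C with (RtoC 0) in X by ring. rewrite Cmod_0 in X.
    specialize (Hpos r Hr).
    assert (Z : Cmod (u - v)%C = 0) by (assert (Y := Cmod_ge_0 (u - v)%C); nra).
    now apply Csub_0_eq, Cmod_eq_0. }
  assert (Rad : forall z, Cmod z = 4 / 5 -> 1 / 3 <= Cmod (f z)).
  { intros z Hz. eapply Rle_trans; [|apply (radial_growth f (4 / 5))]; auto; try lra.
    - intros u Hu. apply Hd. lra.
    - intros u Hu. apply Hre. lra. }
  assert (Step : forall z0 w, Cmod z0 <= 4 / 5 -> Cmod (f z0 - w)%C < 1 / 3 - Cmod w ->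
     exists z, Cmod z < 4 / 5 /\ f z = w).
  { intros z0 w. apply covering_step; auto; try lra.
    - intros z Hz. apply Hd. lra.
    - intros z Hz. apply Hnz. lra. }
  assert (Sur : forall w, exists z, Cmod w < 1 / 4 -> Cmod z < 4 / 5 /\ f z = w).
  { intros w. destruct (Rlt_le_dec (Cmod w) (1 / 4)) as [Hw|Hw]; [|exists (RtoC 0); intros; lra].
    (* f 0 = 0 is close enough to 2 w / 3, and 2 w / 3 to w *)
    destruct (Step (RtoC 0) (RtoC (2 / 3) * w)%C) as (z1 & Hz1 & E1).
    - rewrite Cmod_0. lra.
    - rewrite Hf0. replace (RtoC 0 - RtoC (2 / 3) * w)%C with (- (RtoC (2 / 3) * w))%C by ring.
      rewrite Cmod_opp, Cmod_mult, Cmod_R, Rabs_pos_eq by lra. lra.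
    - destruct (Step z1 w) as (z & Hz & E); [lra| |exists z; auto].
      rewrite E1. replace (RtoC (2 / 3) * w - w)%C with (RtoC (- (1 / 3)) * w)%C.
      + rewrite Cmod_mult, Cmod_R, Rabs_left by lra. lra.
      + replace (- (1 / 3)) with (2 / 3 - 1) by lra. rewrite RtoC_minus. ring. }
  set (F := fun w => proj1_sig (constructive_indefinite_description _ (Sur w))).
  assert (HF : forall w, Cmod w < 1 / 4 -> Cmod (F w) < 4 / 5 /\ f (F w) = w).
  { intros w. unfold F. exact (proj2_sig (constructive_indefinite_description _ (Sur w))). }
  assert (Inv : inverse_on_disc (1 / 4) f F).
  { split.
    - intros w Hw. destruct (HF w Hw). split; [lra|assumption].
    - intros z Hz Hfz. destruct (HF (f z) Hfz). apply Inj; auto. lra. }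
  assert (Lip : forall w w', Cmod w < 1 / 4 -> Cmod w' < 1 / 4 -> Cmod (F w' - F w)%C <= 9 * Cmod (w' - w)%C).
  { intros w w' Hw Hw'. destruct (HF w Hw) as [A1 A2]. destruct (HF w' Hw') as [B1 B2].
    assert (X := Gr (4 / 5) (F w) (F w') ltac:(lra) ltac:(lra) ltac:(lra)). rewrite A2, B2 in X. lra. }
  assert (DF : forall w, Cmod w < 1 / 4 -> is_derive F w (/ C_derive f (F w))%C).
  { intros w Hw. destruct (HF w Hw) as [A1 A2].
    assert (N : C_derive f (F w) <> RtoC 0) by (apply Hnz; lra).
    set (D := C_derive f (F w)) in *. assert (HDP : 0 < Cmod D) by now apply Cmod_gt_0.
    apply is_derive_C_eps. intros eps He.
    assert (He' : 0 < eps * Cmod D / 9) by (apply Rdiv_lt_0_compat; [apply Rmult_lt_0_compat|]; lra).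
    destruct (proj1 (is_derive_C_eps f (F w) D) (Hd (F w) ltac:(lra)) _ He') as [d [Hdp Hd']].
    exists (Rmin (1 / 4 - Cmod w) (d / 9)). split; [apply Rmin_glb_lt; lra|]. intros u Hu.
    assert (U1 := Rlt_le_trans _ _ _ Hu (Rmin_l _ _)). assert (U2 := Rlt_le_trans _ _ _ Hu (Rmin_r _ _)).
    assert (Hu4 : Cmod u < 1 / 4).
    { assert (Y := Cmod_le_add u w). lra. }
    assert (LL := Lip w u Hw Hu4). specialize (Hd' (F u) ltac:(lra)).
    rewrite (proj2 (HF u Hu4)), A2 in Hd'.
    replace (F u - F w - / D * (u - w))%C with (- / D * (u - w - D * (F u - F w)))%C by (field; assumption).
    rewrite Cmod_mult, Cmod_opp, Cmod_inv by assumption.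
    apply Rmult_le_reg_l with (Cmod D); [assumption|].
    rewrite <- Rmult_assoc, Rinv_r, Rmult_1_l by lra.
    eapply Rle_trans; [exact Hd'|].
    replace (Cmod D * (eps * Cmod (u - w)%C)) with (eps * Cmod D / 9 * (9 * Cmod (u - w)%C)) by field.
    apply Rmult_le_compat_l; lra. }
  assert (HF0 : F (RtoC 0) = RtoC 0).
  { rewrite <- Hf0 at 1. apply Inv; [rewrite Cmod_0; lra|rewrite Hf0, Cmod_0; lra]. }
  destruct (log_exists (1 / 4) F) as (L & lam & Hlam & Hlam0 & HL).
  - lra.
  - intros w Hw. eexists. apply (DF w Hw).
  - exact HF0.
  - assert (Z : Cmod (RtoC 0) < 1 / 4) by (rewrite Cmod_0; lra).
    rewrite (is_C_derive_unique _ _ _ (DF (RtoC 0) Z)), HF0, Hf1. field.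
  - intros w Hw Q. rewrite <- (proj2 (HF w Hw)), Q. exact Hf0.
  - exists F, (fun n => lam n / 2)%C. split; [exact Inv|]. exists L. split; [exact HL|].
    intros w Hw. exists (L w / 2)%C. split; [|field].
    eapply is_series_C_ext; [|replace (L w / 2)%C with (/ 2 * L w)%C by field; apply is_series_C_scal].
    2:{ apply (is_series_C_shift (fun n => lam n * w ^ n)%C).
        replace (lam 0%nat * w ^ 0 + L w)%C with (L w) by (rewrite Hlam0; simpl; ring). apply (Hlam w Hw). }
    intros n. cbv beta. replace (n + 1)%nat with (S n) by lia. field.
Qed.

(** * The extremal functions *)

(** The Caratheodory functions of the extremal f. For k = 1 all c_n are 2; for k
    = 2 and k = 3 the first nonzero coefficient is c_k = 2. *)
Definition cayley_pow (k : nat) (z : C) : C := ((1 + z ^ k) / (1 - z ^ k))%C.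

Lemma one_minus_nonzero u : Cmod u < 1 -> (1 - u)%C <> RtoC 0.
Proof.
  intros Hu Q. assert (E : u = RtoC 1) by (replace u with (1 - (1 - u))%C by ring; rewrite Q; ring).
  rewrite E, Cmod_1 in Hu. lra.
Qed.

(** Re ((1 + u) / (1 - u)) = (1 - |u|^2) / |1 - u|^2, and |1 - u| <= 1 + |u|. *)
Lemma Re_cayley u r : Cmod u <= r -> r < 1 -> (1 - r) / (1 + r) <= Re ((1 + u) / (1 - u))%C.
Proof.
  intros Hu Hr. assert (Hu0 := Cmod_ge_0 u).
  assert (N := one_minus_nonzero u ltac:(lra)).
  apply Rle_trans with ((1 - Cmod u) / (1 + Cmod u)).
  { apply Rle_div_cross; nra. }
  rewrite Cdiv_conj_form, re_scal_l by assumption.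
  assert (Hm : 0 < Cmod (1 - u)%C) by now apply Cmod_gt_0.
  replace (Re ((1 + u) * Cconj (1 - u))%C) with (1 - Cmod u ^ 2).
  2:{ rewrite Cmod2_alt. destruct u as [x y]. unfold Re, Im; simpl. ring. }
  assert (T : Cmod (1 - u)%C <= 1 + Cmod u).
  { unfold Cminus. norm_split. rewrite Cmod_opp, Cmod_1. lra. }
  rewrite Rmult_comm. change ((1 - Cmod u ^ 2) * / Cmod (1 - u)%C ^ 2) with ((1 - Cmod u ^ 2) / Cmod (1 - u)%C ^ 2).
  apply Rle_div_cross; [lra|apply pow_lt; lra|].
  assert (Cmod (1 - u)%C ^ 2 <= (1 + Cmod u) ^ 2) by (apply pow_incr; lra).
  replace ((1 - Cmod u ^ 2) * (1 + Cmod u)) with ((1 - Cmod u) * (1 + Cmod u) ^ 2) by ring.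
  apply Rmult_le_compat_l; lra.
Qed.

Lemma Cmod_pow_S_le k z : Cmod z < 1 -> Cmod (z ^ S k)%C <= Cmod z.
Proof.
  intros Hz. assert (Hz0 := Cmod_ge_0 z). rewrite Cmod_pow. simpl.
  assert (Cmod z ^ k <= 1).
  { rewrite <- (pow1 k). apply pow_incr. lra. }
  assert (0 <= Cmod z ^ k) by now apply pow_le. nra.
Qed.

Lemma cayley_pow_holomorphic k : holomorphic_on_disc 1 (cayley_pow (S k)).
Proof.
  intros z Hz. destruct (holomorphic_pow 1 (S k) z Hz) as [l Hl].
  assert (DN := is_derive_C_plus (is_derive_C_const (RtoC 1) z) Hl).
  assert (DD := is_derive_C_minus (is_derive_C_const (RtoC 1) z) Hl).
  assert (P := Cmod_pow_S_le k z Hz).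
  eexists. exact (is_derive_C_div DN DD (one_minus_nonzero (z ^ S k)%C ltac:(lra))).
Qed.

(** Solve f' + alpha z f'' = p for p = (1 + z^(k+1)) / (1 - z^(k+1)). *)
Theorem extremal_function alpha k : 0 <= alpha -> exists f F Gamma,
  class_W alpha f /\ inverse_on_disc (1 / 4) f F /\ log_inverse_coefficients F Gamma /\
  near0 (fun z => W_op alpha f z = cayley_pow (S k) z).
Proof.
  intros Ha. destruct (W_op_surjective alpha (cayley_pow (S k)) Ha (cayley_pow_holomorphic k)) as (f & HA & HW).
  { unfold cayley_pow. rewrite Cpow_S. field. }
  assert (Low : forall r z, r < 1 -> Cmod z <= r -> (1 - r) / (1 + r) <= Re (W_op alpha f z)).
  { intros r z Hr Hz. rewrite HW by lra. unfold cayley_pow. apply Re_cayley; [|assumption].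
    eapply Rle_trans; [apply Cmod_pow_S_le; lra|assumption]. }
  assert (HcW : class_W alpha f).
  { split; [exact HA|]. intros z Hz. change (0 < Re (W_op alpha f z)).
    eapply Rlt_le_trans; [|apply (Low (Cmod z) z Hz); lra].
    assert (Hz0 := Cmod_ge_0 z). apply Rdiv_lt_0_compat; lra. }
  destruct (inverse_exists f HA) as (F & Gamma & HI & HL).
  { intros z Hz. assert (Hz0 := Cmod_ge_0 z).
    apply (Re_derive_lower alpha f (Cmod z)); try lra.
    - apply HA.
    - intros u Hu. apply Low; lra. }
  exists f, F, Gamma. split; [exact HcW|]. split; [exact HI|]. split; [exact HL|].
  exists 1. split; [lra|]. exact HW.
Qed.

Lemma jet_cayley_pow g k u1 u2 u3 : near0 (fun z => g z = cayley_pow (S k) z) -> holomorphic_on_disc 1 g ->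
  jet (fun z => z ^ S k)%C (RtoC 0) u1 u2 u3 ->
  jet g (RtoC 1) (RtoC 2 * u1)%C (RtoC 2 * u2 + RtoC 2 * (u1 * u1))%C
    (RtoC 2 * u3 + RtoC 4 * (u1 * u2) + RtoC 2 * (u1 * u1 * u1))%C.
Proof.
  intros E Hg Ju. destruct (holomorphic_jet g Hg) as (c0 & c1 & c2 & c3 & Jg).
  assert (JM := jet_mult Jg (jet_plus (jet_const (RtoC 1)) (jet_mult (jet_const (RtoC (-1))) Ju))).
  assert (JP := jet_plus (jet_const (RtoC 1)) Ju). cbv beta in JM, JP.
  assert (E1 : near0 (fun z => g z * (1 + RtoC (-1) * z ^ S k) = 1 + z ^ S k)%C).
  { eapply near0_mono; [|exact (near0_and _ _ E (near0_disc 1 Rlt_0_1))]. intros z [H1 H2].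
    rewrite H1. unfold cayley_pow. assert (P := Cmod_pow_S_le k z H2).
    assert (N := one_minus_nonzero (z ^ S k)%C ltac:(lra)).
    rewrite RtoC_m1.
    replace (1 + - (1) * z ^ S k)%C with (1 - z ^ S k)%C by ring. field. exact N. }
  destruct (jet_unique (jet_ext _ _ _ _ _ _ E1 JM) JP) as (X0 & X1 & X2 & X3).
  rewrite RtoC_m1 in *.
  assert (E0 : c0 = RtoC 1) by (apply (Ceq_comb _ _ _ _ (RtoC 1) X0); ring). subst c0.
  assert (F1 : c1 = (RtoC 2 * u1)%C) by (apply (Ceq_comb _ _ _ _ (RtoC 1) X1); ring). subst c1.
  assert (F2 : c2 = (RtoC 2 * u2 + RtoC 2 * (u1 * u1))%C) by (apply (Ceq_comb _ _ _ _ (RtoC 1) X2); ring). subst c2.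
  apply (jet_eq _ _ _ _ _ _ _ _ _ Jg); auto.
  apply (Ceq_comb _ _ _ _ (RtoC 1) X3); ring.
Qed.

Lemma jet_pow1 : jet (fun z => z ^ 1)%C (RtoC 0) (RtoC 1) (RtoC 0) (RtoC 0).
Proof. apply jet_ext with (fun z => z); [|apply jet_id]. apply near0_all. intros z. simpl. ring. Qed.

Lemma jet_pow2 : jet (fun z => z ^ 2)%C (RtoC 0) (RtoC 0) (RtoC 1) (RtoC 0).
Proof.
  eapply jet_eq; [eapply jet_ext; [|apply (jet_mult jet_id jet_pow1)]| | | |]; try ring.
  apply near0_all. intros z. simpl. ring.
Qed.

Lemma jet_pow3 : jet (fun z => z ^ 3)%C (RtoC 0) (RtoC 0) (RtoC 0) (RtoC 1).
Proof.
  eapply jet_eq; [eapply jet_ext; [|apply (jet_mult jet_id jet_pow2)]| | | |]; try ring.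
  apply near0_all. intros z. simpl. ring.
Qed.

Theorem extremal_coefficients alpha k u1 u2 u3 : 0 <= alpha ->
  jet (fun z => z ^ S k)%C (RtoC 0) (RtoC u1) (RtoC u2) (RtoC u3) ->
  exists f F Gamma,
  class_W alpha f /\ inverse_on_disc (1 / 4) f F /\ log_inverse_coefficients F Gamma /\
  let c1 := 2 * u1 in let c2 := 2 * u2 + 2 * (u1 * u1) in
  let c3 := 2 * u3 + 4 * (u1 * u2) + 2 * (u1 * u1 * u1) in
  Cmod (Gamma 1%nat) = Rabs c1 / (4 * (1 + alpha)) /\
  Cmod (Gamma 2%nat) = Rabs (c2 - weight_v alpha * (c1 * c1)) / (6 * (1 + 2 * alpha)) /\
  Cmod (Gamma 3%nat) = Rabs (c3 - 2 * weight_B alpha * (c1 * c2) + weight_D alpha * (c1 * c1 * c1)) / (8 * (1 + 3 * alpha)).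
Proof.
  intros Ha Ju. destruct (extremal_function alpha k Ha) as (f & F & Gamma & HW & HI & HL & HE).
  exists f, F, Gamma. split; [exact HW|]. split; [exact HI|]. split; [exact HL|].
  intros c1 c2 c3.
  assert (J := jet_cayley_pow _ _ _ _ _ HE (proj1 (class_W_caratheodory alpha f HW)) Ju).
  rewrite <- !RtoC_mult, <- !RtoC_plus in J. fold c1 c2 c3 in J.
  destruct (gamma_formula alpha f F Gamma _ _ _ Ha (proj1 HW) HI HL J) as (-> & -> & ->).
  assert (Q : forall k x, 0 < k -> Cmod (RtoC (- / k) * RtoC x)%C = Rabs x / k).
  { intros k' x Hk. rewrite Cmod_mult, !Cmod_R, Rabs_Ropp, Rabs_pos_eq by (left; now apply Rinv_0_lt_compat).
    unfold Rdiv. ring. }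
  assert (T2 : (RtoC c2 - RtoC (weight_v alpha) * (RtoC c1 * RtoC c1))%C = RtoC (c2 - weight_v alpha * (c1 * c1)))
    by (rewrite RtoC_minus, !RtoC_mult; reflexivity).
  assert (T3 : cubic (RtoC c1) (RtoC c2) (RtoC c3) (weight_B alpha) (weight_D alpha)
     = RtoC (c3 - 2 * weight_B alpha * (c1 * c2) + weight_D alpha * (c1 * c1 * c1)))
    by (unfold cubic; rewrite RtoC_plus, RtoC_minus, !RtoC_mult; reflexivity).
  rewrite T2, T3, !Q by lra. auto.
Qed.

Theorem theorem3p2 (alpha : R) (halpha : 0 <= alpha) :
  (forall (f F : C -> C) (Gamma : nat -> C),
      class_W alpha f ->
      inverse_on_disc (1 / 4) f F ->
      log_inverse_coefficients F Gamma ->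
      Cmod (Gamma 1%nat) <= bound1 alpha /\
      Cmod (Gamma 2%nat) <= bound2 alpha /\
      Cmod (Gamma 3%nat) <= bound3 alpha) /\
  (exists (f F : C -> C) (Gamma : nat -> C),
      class_W alpha f /\
      inverse_on_disc (1 / 4) f F /\
      log_inverse_coefficients F Gamma /\
      Cmod (Gamma 1%nat) = bound1 alpha) /\
  (exists (f F : C -> C) (Gamma : nat -> C),
      class_W alpha f /\
      inverse_on_disc (1 / 4) f F /\
      log_inverse_coefficients F Gamma /\
      Cmod (Gamma 2%nat) = bound2 alpha) /\
  (exists (f F : C -> C) (Gamma : nat -> C),
      class_W alpha f /\
      inverse_on_disc (1 / 4) f F /\
      log_inverse_coefficients F Gamma /\
      Cmod (Gamma 3%nat) = bound3 alpha).
Proof.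
  (* The exponents k + 1 are 1, 2, 3; the other numbers are the coefficients of
     z, z^2, z^3 in z^(k+1). *)
  destruct (extremal_coefficients alpha 0 1 0 0 halpha jet_pow1) as (f1 & F1 & G1 & W1 & I1 & L1 & A1 & A2 & A3).
  destruct (extremal_coefficients alpha 1 0 1 0 halpha jet_pow2) as (f2 & F2 & G2 & W2 & I2 & L2 & _ & B2 & _).
  destruct (extremal_coefficients alpha 2 0 0 1 halpha jet_pow3) as (f3 & F3 & G3 & W3 & I3 & L3 & _ & _ & C3).
  split; [intros f F Gamma; now apply upper_bounds|]. split; [|split].
  - exists f1, F1, G1. repeat (split; [assumption|]). rewrite A1.
    rewrite Rabs_pos_eq by lra. unfold bound1. field. lra.
  - destruct (Rlt_le_dec alpha (1 / 2)) as [Hl|Hl].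
    + destruct (bound2_low alpha (conj halpha Hl)) as [Hv Hb].
      exists f1, F1, G1. repeat (split; [assumption|]). rewrite A2, Hb. f_equal.
      rewrite Rabs_left1; lra.
    + destruct (bound2_high alpha Hl) as [Hv Hb].
      exists f2, F2, G2. repeat (split; [assumption|]). rewrite B2, Hb. f_equal.
      rewrite Rabs_pos_eq; lra.
  - destruct (Rle_lt_dec alpha alpha3) as [Hl|Hl].
    + destruct (bound3_low alpha (conj halpha Hl)) as (Hb & H1 & H2).
      exists f1, F1, G1. repeat (split; [assumption|]). rewrite A3, Hb. f_equal.
      rewrite Rabs_pos_eq; lra.
    + destruct (bound3_high alpha Hl) as (Hb & H1 & H2).
      exists f3, F3, G3. repeat (split; [assumption|]). rewrite C3, Hb. f_equal.
      rewrite Rabs_pos_eq; lra.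
Qed.
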